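(* Let $n\ge 2$ and let $\kappa$ be a partition of $n-1$. The map $\mu: f\mapsto df/f$ induces an isomorphism of complex orbifolds $$\mathrm{Conf}_n(\mathbb C)[\kappa]/\mathrm{Aff}\;\cong\;\Omega_\kappa .$$
   Context: $\mathrm{Conf}_n(\mathbb C)$ is the space of monic squarefree complex polynomials of degree $n$, equivalently unordered configurations of $n$ distinct points of $\mathbb C$. For a partition $\kappa=\{k_1,\dots,k_p\}$ of $n-1$, $\mathrm{Conf}_n(\mathbb C)[\kappa]$ is the subspace of $f$ such that the multiplicities of the roots of $f'$ form the partition $\kappa$. $\mathcal{MD}(\kappa)$ is the set of meromorphic differentials $\omega$ on $\mathbb{CP}^1$ having exactly $p$ zeroes, all in $\mathbb C$, of orders $k_1,\dots,k_p$, and whose poles are $n$ simple poles in $\mathbb C$ each with residue $1$ (i.e. period $2\pi i$ around it) and one simple pole at $\infty$ with residue $-n$. $\mathrm{Aff}=\{z\mapsto az+b: a\in\mathbb C^*, b\in\mathbb C\}$ acts on $\mathcal{MD}(\kappa)$ by $\alpha\cdot\omega=(\alpha^{-1})^*\omega$ and on $\mathrm{Conf}_n(\mathbb C)[\kappa]$ by moving the roots, $\{z_1,\dots,z_n\}\mapsto\{\alpha(z_1),\dots,\alpha(z_n)\}$. Both actions are proper, by holomorphic automorphisms, with finite stabilizers, so the quotients are complex orbifolds; $\Omega_\kappa:=\mathcal{MD}(\kappa)/\mathrm{Aff}$. *)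

(* Defs.v *)
From HB Require Import structures.
From mathcomp Require Import all_boot all_order all_algebra.
From mathcomp Require Import all_classical all_reals all_analysis.
From mathcomp Require Import complex.

Set Implicit Arguments.
Unset Strict Implicit.
Unset Printing Implicit Defensive.

Import Order.TTheory GRing.Theory Num.Theory numFieldNormedType.Exports.

Local Open Scope classical_set_scope.
Local Open Scope ring_scope.

(** * Complex manifolds

    A [cspace] is a set [spt] of points with an embedding [crd] into a complex
    normed space; its topology is the induced one.  As in
    Milnor or Guillemin-Pollack, a map between such sets is holomorphic when it
    extends, locally in the ambient space, to a holomorphic (i.e.
    complex-differentiable) map, and a manifold is a set locally biholomorphic
    to open subsets of C^d.  All the spaces used below sit in
    finite-dimensional ambient spaces, so they are Hausdorff and
    second countable. *)

Section Manifolds.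
Variable R : realType.

Record cspace := CSpace {
  pt :> Type;
  spt : set pt;
  amb : normedModType R[i];
  crd : pt -> amb }.

Arguments spt : clear implicits.
Arguments crd {c} _.

Definition restr (X : cspace) (A : set X) : cspace :=
  @CSpace X (spt X `&` A) (amb X) crd.

Definition prodsp (X Y : cspace) : cspace :=
  @CSpace (X * Y)%type (spt X `*` spt Y) (amb X * amb Y)%type
    (fun p => (crd p.1, crd p.2)).

Definition Cn (d : nat) : normedModType R[i] := 'rV[R[i]]_d.

Definition open_model (d : nat) (W : set (Cn d)) : cspace :=
  @CSpace (Cn d) W (Cn d) id.

Definition open_in (X : cspace) (U : set X) : Prop :=
  U `<=` spt X /\
  forall x, U x -> \forall v \near crd x, forall y, spt X y -> crd y = v -> U y.

Definition compact_in (X : cspace) (K : set X) : Prop :=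
  K `<=` spt X /\ compact (@crd X @` K).

Definition holo (X Y : cspace) (F : X -> Y) : Prop :=
  (forall x, spt X x -> spt Y (F x)) /\
  forall x, spt X x -> exists Phi : amb X -> amb Y,
    \forall v \near crd x, differentiable Phi v /\
      forall y, spt X y -> crd y = v -> crd (F y) = Phi v.

Definition biholo (X Y : cspace) (F : X -> Y) : Prop :=
  holo F /\ exists G : Y -> X, holo G /\
    (forall x, spt X x -> G (F x) = x) /\ (forall y, spt Y y -> F (G y) = y).

Definition complex_manifold (X : cspace) : Prop :=
  {in spt X &, injective (@crd X)} /\
  exists d : nat, forall x, spt X x ->
    exists (U : set X) (W : set (Cn d)) (phi : X -> Cn d),
      [/\ open_in U, U x, open W & @biholo (restr U) (open_model W) phi].

(* By the implicit function theorem, a holomorphic map of manifolds is a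
   submersion iff it has a local holomorphic section through every point. *)
Definition submersion (X Y : cspace) (F : X -> Y) : Prop :=
  holo F /\
  forall x, spt X x -> exists (V : set Y) (s : Y -> X),
    [/\ open_in V, V (F x), @holo (restr V) X s, s (F x) = x
      & forall y, V y -> F (s y) = y].

Definition surjective_submersion (X Y : cspace) (F : X -> Y) : Prop :=
  submersion F /\ forall y, spt Y y -> exists2 x, spt X x & F x = y.

Definition proper_map (X Y : cspace) (F : X -> Y) : Prop :=
  forall K : set Y, compact_in K -> compact_in (spt X `&` F @^-1` K).

End Manifolds.

Arguments spt {R} _ _.
Arguments crd {R c} _.

(** * Complex orbifolds

    A complex orbifold is presented by a proper holomorphic Lie groupoid with
    finite isotropy groups, and isomorphisms of orbifolds are generated by
    essential (Morita) equivalences of groupoids (Moerdijk, "Orbifolds as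
    groupoids").  Effectiveness is not required: for [kappa = [:: n - 1]] every
    point of the quotients below has a stabiliser of order [n]. *)

Section Orbifolds.
Variable R : realType.

(* [cmp (g, h)] is [g] after [h]; it is meaningful when [src g = tgt h]. *)
Record hgroupoid := HGroupoid {
  obj : cspace R;
  arr : cspace R;
  src : arr -> obj;
  tgt : arr -> obj;
  idt : obj -> arr;
  inv : arr -> arr;
  cmp : arr * arr -> arr }.

Definition composable (G : hgroupoid) : cspace R :=
  @restr R (prodsp (arr G) (arr G)) [set gh | src gh.1 = tgt gh.2].

Definition groupoid_laws (G : hgroupoid) : Prop :=
  [/\ forall x, spt (obj G) x -> src (idt x) = x /\ tgt (idt x) = x,
      forall g, spt (arr G) g -> src (inv g) = tgt g /\ tgt (inv g) = src g,
      forall g h, spt (composable G) (g, h) ->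
        src (cmp (g, h)) = src h /\ tgt (cmp (g, h)) = tgt g,
      forall g h k, spt (composable G) (g, h) -> spt (composable G) (h, k) ->
        cmp (g, cmp (h, k)) = cmp (cmp (g, h), k)
    & forall g, spt (arr G) g ->
        [/\ cmp (g, idt (src g)) = g, cmp (idt (tgt g), g) = g,
            cmp (inv g, g) = idt (src g) & cmp (g, inv g) = idt (tgt g)]].

Definition holomorphic_groupoid (G : hgroupoid) : Prop :=
  [/\ complex_manifold (obj G) /\ complex_manifold (arr G),
      submersion (@src G) /\ submersion (@tgt G),
      holo (@idt G) /\ holo (@inv G),
      @holo R (composable G) (arr G) (@cmp G)
    & groupoid_laws G].

Definition isotropy (G : hgroupoid) (x : obj G) : set (arr G) :=
  [set g | spt (arr G) g /\ src g = x /\ tgt g = x].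

Definition complex_orbifold (G : hgroupoid) : Prop :=
  [/\ holomorphic_groupoid G,
      @proper_map R (arr G) (prodsp (obj G) (obj G)) (fun g => (src g, tgt g))
    & forall x, spt (obj G) x -> finite_set (isotropy x)].

Definition hfunctor (H G : hgroupoid) (F0 : obj H -> obj G)
    (F1 : arr H -> arr G) : Prop :=
  [/\ holo F0 /\ holo F1,
      forall h, spt (arr H) h ->
        src (F1 h) = F0 (src h) /\ tgt (F1 h) = F0 (tgt h),
      forall x, spt (obj H) x -> F1 (idt x) = idt (F0 x)
    & forall g h, spt (composable H) (g, h) ->
        F1 (cmp (g, h)) = cmp (F1 g, F1 h)].

(* The two fibre products in the definition of an essential equivalence:
   G1 x_{G0} H0 and (H0 x H0) x_{G0 x G0} G1. *)
Definition ess_domain (H G : hgroupoid) (F0 : obj H -> obj G) : cspace R :=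
  @restr R (prodsp (arr G) (obj H)) [set gx | src gx.1 = F0 gx.2].

Definition ff_target (H G : hgroupoid) (F0 : obj H -> obj G) : cspace R :=
  @restr R (prodsp (prodsp (obj H) (obj H)) (arr G))
    [set p | src p.2 = F0 p.1.1 /\ tgt p.2 = F0 p.1.2].

Definition essential_equivalence (H G : hgroupoid) (F0 : obj H -> obj G)
    (F1 : arr H -> arr G) : Prop :=
  [/\ hfunctor F0 F1,
      @surjective_submersion R (ess_domain F0) (obj G) (fun gx => tgt gx.1)
    & @biholo R (arr H) (ff_target F0) (fun h => ((src h, tgt h), F1 h))].

Definition orbifold_isomorphism (H G : hgroupoid) (F0 : obj H -> obj G)
    (F1 : arr H -> arr G) : Prop :=
  [/\ complex_orbifold H, complex_orbifold G & essential_equivalence F0 F1].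

End Orbifolds.

(** * Quotients by the affine group *)

Section Affine.
Variable R : realType.
Local Notation C := R[i].

(* (a, b) stands for z |-> a z + b *)
Definition aff : Type := (C * C)%type.
Definition aff_app (al : aff) (z : C) : C := al.1 * z + al.2.
Definition aff_id : aff := (1, 0).
Definition aff_inv (al : aff) : aff := (al.1^-1, - (al.1^-1 * al.2)).
Definition aff_mul (al be : aff) : aff := (al.1 * be.1, al.1 * be.2 + al.2).

Definition Aff : cspace R :=
  @CSpace R aff [set al | al.1 != 0] (C^o * C^o)%type id.

Definition aff_quotient (X : cspace R) (act : aff -> X -> X) : hgroupoid R :=
  @HGroupoid R X (prodsp Aff X)
    (fun ax => ax.2)
    (fun ax => act ax.1 ax.2)
    (fun x => (aff_id, x))
    (fun ax => (aff_inv ax.1, act ax.1 ax.2))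
    (fun gh => (aff_mul gh.1.1 gh.2.1, gh.2.2)).

End Affine.

(** * Stratified configuration spaces *)

Definition is_partition (kappa : seq nat) (m : nat) : Prop :=
  all (fun k => 0 < k)%N kappa /\ sumn kappa = m.

Section Configurations.
Variable R : realType.
Local Notation C := R[i].

Definition root_seq (f : {poly C}) : seq C := sval (closed_field_poly_normal f).

Definition squarefree (f : {poly C}) : Prop :=
  forall g : {poly C}, g ^+ 2 %| f -> (size g <= 1)%N.

Definition root_mults (f : {poly C}) : seq nat :=
  [seq count_mem z (root_seq f) | z <- undup (root_seq f)].

Definition Conf_set (n : nat) (kappa : seq nat) : set {poly C} :=
  [set f | [/\ f \is monic, size f = n.+1, squarefree f
             & perm_eq (root_mults f^`()) kappa]].

Definition Conf (n : nat) (kappa : seq nat) : cspace R :=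
  @CSpace R {poly C} (Conf_set n kappa) (Cn R n) (fun f => \row_(i < n) f`_i).

Definition move_roots (al : aff R) (f : {poly C}) : {poly C} :=
  \prod_(z <- root_seq f) ('X - (aff_app al z)%:P).

Definition Conf_quotient (n : nat) (kappa : seq nat) : hgroupoid R :=
  @aff_quotient R (Conf n kappa) move_roots.

End Configurations.

(** * Meromorphic differentials on CP^1

    A differential g(z) dz is represented by its coefficient g : C -> C in the
    affine chart.  In the chart w = 1/z it is - g(1/w) / w^2 dw. *)

Section Differentials.
Variable R : realType.
Local Notation C := R[i].

(* g(z) = \sum_(j >= 0) c_j (z - a)^(k + j) in a punctured neighbourhood *)
Definition laurent_at (g : C -> C) (a : C) (k : int) (c : nat -> C) : Prop :=
  \forall z \near (a : C^o)^',
    series (fun j : nat => c j * (z - a) ^ (k + j%:Z) : C^o) @ \oo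
      --> (g z : C^o).

Definition meromorphic_at (g : C -> C) (a : C) : Prop :=
  exists k c, laurent_at g a k c.

Definition has_order (g : C -> C) (a : C) (k : int) : Prop :=
  exists2 c, c 0%N != 0 & laurent_at g a k c.

Definition has_residue (g : C -> C) (a r : C) : Prop :=
  exists (m : nat) (c : nat -> C),
    laurent_at g a (- (m.+1)%:Z) c /\ c m = r.

Definition chart_infty (g : C -> C) : C -> C := fun w => - g w^-1 / w ^+ 2.

(* g takes its analytic value wherever it is holomorphic and, by convention, 0
   at its poles: functions that differ only at removable points or poles are
   the same differential, and this selects one representative. *)
Definition normalized (g : C -> C) : Prop :=
  forall a, (forall c, laurent_at g a 0 c -> g a = c 0%N) /\
            (~ (exists c, laurent_at g a 0 c) -> g a = 0).

Definition meromorphic_differential (g : C -> C) : Prop :=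
  [/\ forall a, meromorphic_at g a, meromorphic_at (chart_infty g) 0
    & normalized g].

(* zs : the zeroes, ps : the finite poles *)
Definition MD_set (n : nat) (kappa : seq nat) : set (C -> C) :=
  [set g | meromorphic_differential g /\
    exists zs ps : seq C,
      [/\ uniq (zs ++ ps), size zs = size kappa /\ size ps = n,
          forall i, (i < size kappa)%N ->
            has_order g (nth 0 zs i) (nth 0%N kappa i)%:Z,
          forall a, a \in ps -> has_order g a (- 1) /\ has_residue g a 1
        & (forall a, a \notin zs ++ ps -> has_order g a 0) /\
          (has_order (chart_infty g) 0 (- 1) /\
           has_residue (chart_infty g) 0 (- n%:R))]].

Definition divisor_order (g : C -> C) (a : C) : int :=
  xget 0 [set k | has_order g a k].

Definition zero_divisor (g : C -> C) : {poly C} :=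
  \big[*%R/1]_(a \in [set: C])
    ('X - a%:P) ^+ `|Num.max (divisor_order g a) 0|%N.

Definition pole_divisor (g : C -> C) : {poly C} :=
  \big[*%R/1]_(a \in [set: C])
    ('X - a%:P) ^+ `|Num.max (- divisor_order g a) 0|%N.

(* A differential in MD(kappa) is determined by its divisor (its scale being
   fixed by the residues).  The complex structure on MD(kappa) is the one given
   by the positions of the zeroes and of the poles, i.e. by the coefficients of
   the monic polynomials that vanish on them with multiplicity. *)
Definition MD (n : nat) (kappa : seq nat) : cspace R :=
  @CSpace R (C -> C) (MD_set n kappa) (Cn R n.-1 * Cn R n)%type
    (fun g => (\row_(i < n.-1) (zero_divisor g)`_i,
               \row_(i < n) (pole_divisor g)`_i)).

Definition pullback (al : aff R) (g : C -> C) : C -> C :=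
  fun z => g (aff_app al z) * al.1.

Definition Omega (n : nat) (kappa : seq nat) : hgroupoid R :=
  @aff_quotient R (MD n kappa) (fun al => pullback (aff_inv al)).

(* the coefficient of df / f; as x / 0 = 0, it vanishes at the poles *)
Definition dlog (f : {poly C}) : C -> C := fun z => f^`().[z] / f.[z].

End Differentials.

(* Main.v *)
(* The inverse of f |-> f'/f sends a differential to the monic polynomial whose
   roots are its finite poles.  It is defined on all of MD(kappa): for g in
   MD(kappa) with pole polynomial f, the difference g - f'/f has only removable
   singularities and vanishes at infinity, so it is zero by Liouville's theorem.
   Since the two maps are equivariant and holomorphic, the manifold structure and
   the properness of the action need only be established on Conf_n[kappa].

   Conf_n[kappa] is charted by the ordered critical points together with f(0):
   f is a polynomial function of these, and conversely a critical point of
   multiplicity k is a simple root of the k-th derivative of f, hence by the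
   implicit function theorem depends holomorphically on the coefficients.

   An affine map z |-> az + b multiplies the coefficients of the polynomial
   centred at its centroid by powers of a.  A configuration of at least two points
   has a nonzero centred coefficient, so |a| stays bounded away from 0 and
   infinity over compact sets, which gives properness. *)

(* Holomorphy is tested on extensions to the ambient coefficient space, where polynomials are
   neither squarefree nor confined to the stratum. This shapes the formulas. The action is rewritten
   as [move_poly], which is polynomial in all data. Critical points are followed through higher
   derivatives because, off the stratum, a critical point of multiplicity [k] may split, while the
   simple root of the [k]-th derivative persists.

   The analysis rests on power series alone. The coefficients of a convergent expansion grow at most
   geometrically, and the resulting bound on the remainder yields uniqueness of expansions, a
   maximum principle and Liouville's theorem, without contour integrals.

   Properness also needs limits to stay in the group. In the closed relation saying that the move of
   [f] is [h], the degenerate value [a = 0] would make [h] an [n]-th power of a linear factor, which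
   is not squarefree for [n >= 2]. The translation part is not bounded separately: the two centroids
   determine it. *)
Require Import Defs.
From mathcomp Require Import all_boot all_order all_algebra.
From mathcomp Require Import all_classical all_reals all_analysis.
From mathcomp Require Import complex.
From mathcomp Require Import zify ring lra.

Set Implicit Arguments.
Unset Strict Implicit.
Unset Printing Implicit Defensive.

Import Order.TTheory GRing.Theory Num.Theory numFieldNormedType.Exports.

Local Open Scope classical_set_scope.
Local Open Scope ring_scope.

(** * Polynomials with prescribed roots *)

Section RootMultiplicities.
Variable F : fieldType.

Lemma mup_prod_XsubC (x : F) (s : seq F) :
  mup x (\prod_(z <- s) ('X - z%:P)) = count_mem x s.
Proof.
elim: s => [|z s IH]; first by rewrite big_nil mupNroot // root1.
rewrite big_cons mupM ?polyXsubC_eq0 ?monic_neq0 ?monic_prod_XsubC // IH.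
by rewrite -['X - z%:P]expr1 mup_XsubCX /=; case: eqP.
Qed.

Lemma eq_prod_XsubC (s t : seq F) :
  \prod_(z <- s) ('X - z%:P) = \prod_(z <- t) ('X - z%:P) -> perm_eq s t.
Proof.
move=> e; apply/allP => x _ /=.
by rewrite -!mup_prod_XsubC e.
Qed.

End RootMultiplicities.

Lemma nth_map_index (T : eqType) (c : T -> nat) (s : seq T) (x : T) :
  x \in s -> nth 0%N (map c s) (index x s) = c x.
Proof. by move=> xs; rewrite (nth_map x) ?index_mem // nth_index. Qed.

Section PolynomialAlgebra.
Variable R : realType.
Local Notation C := R[i].

Lemma root_seqE (f : {poly C}) :
  f = lead_coef f *: \prod_(z <- root_seq f) ('X - z%:P).
Proof. exact: svalP (closed_field_poly_normal f). Qed.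

Lemma monic_root_seqE (f : {poly C}) :
  f \is monic -> f = \prod_(z <- root_seq f) ('X - z%:P).
Proof. by move=> /monicP fm; rewrite {1}[f]root_seqE fm scale1r. Qed.

Lemma count_root_seq (f : {poly C}) (x : C) :
  f != 0 -> count_mem x (root_seq f) = mup x f.
Proof.
move=> f0; rewrite [in RHS](root_seqE f) -mul_polyC mupMr ?mup_prod_XsubC //.
by rewrite rootE hornerC lead_coef_eq0.
Qed.

Lemma mem_root_seq (f : {poly C}) (x : C) : f != 0 -> (x \in root_seq f) = root f x.
Proof.
by move=> f0; rewrite {2}(root_seqE f) rootZ ?lead_coef_eq0 // root_prod_XsubC.
Qed.

Lemma root_seq_prod_XsubC (s : seq C) :
  perm_eq (root_seq (\prod_(z <- s) ('X - z%:P))) s.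
Proof.
by apply/eq_prod_XsubC; rewrite -monic_root_seqE // monic_prod_XsubC.
Qed.

Lemma size_root_seq (f : {poly C}) (n : nat) :
  size f = n.+1 -> size (root_seq f) = n.
Proof.
move=> sf; have f0 : f != 0 by rewrite -size_poly_eq0 sf.
by move: sf; rewrite {1}(root_seqE f) size_scale ?lead_coef_eq0 // size_prod_XsubC => -[].
Qed.

Definition mult_poly (p : nat) (k : 'I_p -> nat) (w : 'I_p -> C) : {poly C} :=
  \prod_(i < p) ('X - (w i)%:P) ^+ k i.

Lemma mult_poly_monic p k w : @mult_poly p k w \is monic.
Proof. by apply: rpred_prod => i _; apply: monic_exp; apply: monicXsubC. Qed.

Lemma mup_mult_poly p k w x :
  mup x (@mult_poly p k w) = (\sum_(i < p) (w i == x) * k i)%N.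
Proof.
have H : forall r : seq 'I_p, mup x (\prod_(i <- r) ('X - (w i)%:P) ^+ k i) =
    (\sum_(i <- r) (w i == x) * k i)%N.
  elim=> [|i r IH]; first by rewrite !big_nil mupNroot // root1.
  rewrite !big_cons mupM ?IH ?mup_XsubCX ?expf_neq0 ?polyXsubC_eq0 //.
    by rewrite eq_sym; case: eqP => //=; rewrite ?mul1n ?mul0n.
  by apply: monic_neq0; apply: rpred_prod => j _; apply: monic_exp; apply: monicXsubC.
exact: H.
Qed.

Lemma mup_mult_poly_inj p k w i : injective w -> mup (w i) (@mult_poly p k w) = k i.
Proof.
move=> iw; rewrite mup_mult_poly (bigD1 i) //= eqxx mul1n big1 ?addn0 // => j ji.
by rewrite (inj_eq iw) (negPf ji).
Qed.

Lemma root_mult_poly p k w x : (forall i, 0 < k i)%N ->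
  root (@mult_poly p k w) x = [exists i, w i == x].
Proof.
move=> kp; rewrite -[root _ _]negbK.
have m0 : mult_poly k w != 0 by apply: monic_neq0; apply: mult_poly_monic.
have <- : (0 < mup x (mult_poly k w))%N = root (mult_poly k w) x.
  by rewrite -XsubC_dvd // dvdp_XsubCl.
rewrite negbK mup_mult_poly lt0n; apply/idP/existsP.
  move=> H; apply: contrapT => nex; move/eqP: H; apply; rewrite big1 // => i _.
  by case: eqP => // e; case: nex; exists i; apply/eqP.
by case=> i /eqP wi; rewrite (bigD1 i) //= wi eqxx mul1n addn_eq0 negb_and -lt0n kp.
Qed.

Lemma size_mult_poly p k w : size (@mult_poly p k w) = (\sum_(i < p) k i).+1.
Proof.
rewrite size_prod => [|i _]; last by rewrite expf_neq0 ?polyXsubC_eq0.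
under eq_bigr do rewrite size_exp_XsubC.
have -> : (\sum_(i < p) (k i).+1 = \sum_(i < p) k i + p)%N.
  under eq_bigr do rewrite -addn1.
  by rewrite big_split /= sum1_card card_ord.
by rewrite card_ord -addSn addnK.
Qed.

Lemma sum_nth_ord (s : seq nat) : (\sum_(i < size s) nth 0%N s i = sumn s)%N.
Proof. by rewrite sumnE (big_nth 0%N) big_mkord. Qed.

Lemma monic_eq_mup (f g : {poly C}) : f \is monic -> g \is monic ->
  (forall x, mup x f = mup x g) -> f = g.
Proof.
move=> fm gm H; rewrite (monic_root_seqE fm) (monic_root_seqE gm); apply: perm_big.
by apply/allP => x _ /=; rewrite !count_root_seq ?monic_neq0 // H.
Qed.

(** Exchanges the unordered multiplicity condition for a labelling of the roots by the parts of
    [kappa], which is the form needed for charts. A permutation between the two lists says which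
    root receives which part. *)
Lemma root_multsP (q : {poly C}) (kappa : seq nat) : q != 0 ->
  all (fun k => 0 < k)%N kappa ->
  perm_eq (root_mults q) kappa <->
  exists2 w : 'I_(size kappa) -> C, injective w &
    q = lead_coef q *: mult_poly (fun i : 'I_(size kappa) => nth 0%N kappa i) w.
Proof.
move=> q0 kpos; set u := undup (root_seq q).
have cE z : count_mem z (root_seq q) = mup z q by rewrite count_root_seq.
have uE z : (z \in u) = (0 < mup z q)%N by rewrite mem_undup -has_pred1 has_count cE.
have rmE : root_mults q = [seq mup z q | z <- u].
  by rewrite /root_mults; apply: eq_map => z; rewrite cE.
rewrite rmE; split.
  (* [Is] permutes the positions in [u], and [kappa] is the list of multiplicities read along [Is];
     the [i]-th label therefore goes to the root at position [nth 0 Is i]. *)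
  rewrite perm_sym => /(perm_iotaP 0%N)[Is]; rewrite size_map => pI kE.
  have sI : size Is = size u by rewrite (perm_size pI) size_iota.
  have sk : size kappa = size u by rewrite kE size_map sI.
  have uI : uniq Is by rewrite (perm_uniq pI) iota_uniq.
  have lI i : (i < size kappa)%N -> (nth 0%N Is i < size u)%N.
    move=> li; have : nth 0%N Is i \in Is by rewrite mem_nth // sI -sk.
    by rewrite (perm_mem pI) mem_iota.
  exists (fun i => nth 0 u (nth 0%N Is i)).
    move=> i j /eqP; rewrite nth_uniq ?undup_uniq ?lI // nth_uniq ?sI -?sk //.
    by move=> /eqP /val_inj.
  rewrite {1}(root_seqE q); congr (_ *: _).
  apply: monic_eq_mup; rewrite ?monic_prod_XsubC ?mult_poly_monic // => x.
  rewrite mup_prod_XsubC cE mup_mult_poly.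
  have [xu|xu] := boolP (x \in u); last first.
    have : mup x q = 0%N by apply/eqP; rewrite -leqn0 leqNgt -uE.
    move=> ->; rewrite big1 // => i _; case: eqP => // wi.
    by move: xu; rewrite -wi mem_nth // lI.
  have : index x u \in Is by rewrite (perm_mem pI) mem_iota index_mem.
  set j := index x u => jI.
  have lj : (index j Is < size kappa)%N by rewrite sk -sI index_mem.
  rewrite (bigD1 (Ordinal lj)) //= nth_index // {1}/j nth_index // eqxx mul1n.
  rewrite big1 ?addn0 => [|i ij]; last first.
    case: eqP => // e; case/eqP: ij; apply: val_inj => /=.
    by rewrite /j -e index_uniq ?undup_uniq ?lI // index_uniq // sI -sk.
  have -> : nth 0%N kappa (index j Is) = nth 0%N [seq mup z q | z <- u] j.
    by rewrite [in LHS]kE (nth_map 0%N) ?index_mem // nth_index.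
  by apply/esym; exact: (nth_map_index (fun z => mup z q) xu).
case=> w iw qE.
have mE x : mup x q = mup x (mult_poly (fun i : 'I_(size kappa) => nth 0%N kappa i) w).
  by rewrite qE -mul_polyC mupMr // rootE hornerC lead_coef_eq0.
have pu : perm_eq u [seq w i | i <- enum 'I_(size kappa)].
  apply: uniq_perm; rewrite ?undup_uniq ?map_inj_uniq -?enumT ?enum_uniq // => x.
  rewrite uE mE -XsubC_dvd ?monic_neq0 ?mult_poly_monic // dvdp_XsubCl.
  rewrite root_mult_poly => [|i]; last by move/allP: kpos; apply; rewrite mem_nth.
  apply/existsP/mapP => [[i /eqP wi]|[i _ wi]]; exists i => //; rewrite ?mem_enum ?wi //.
apply: perm_trans (perm_map _ pu) _.
rewrite -map_comp (@eq_map _ _ _ (fun i : 'I_(size kappa) => nth 0%N kappa i)).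
  by rewrite (map_comp (nth 0%N kappa) val) val_enum_ord map_nth_iota0 // take_size.
by move=> i /=; rewrite mE mup_mult_poly_inj.
Qed.

(** A nonconstant [g] has a root [a] over the complex numbers, so a repeated factor can be replaced
    by [('X - a%:P) ^+ 2], and this divides [f] exactly when [a] is a common root of [f] and its
    derivative. *)
Lemma squarefreeP (f : {poly C}) : f != 0 ->
  squarefree f <-> (forall a, root f a -> ~~ root f^`() a).
Proof.
move=> f0; split=> [sf a fa|H g gf].
  apply/negP => dfa; have := sf ('X - a%:P); rewrite size_XsubC => H.
  suff : (2 <= 1)%N by []; apply: H.
  have [q qE] := factor_theorem _ _ fa; move: (fa) (dfa).
  rewrite qE derivM derivXsubC mulr1 !rootE hornerD !hornerM hornerXsubC subrr !mulr0 add0r.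
  move=> _ qa; by rewrite expr2 dvdp_mul2r ?polyXsubC_eq0 // dvdp_XsubCl.
rewrite leqNgt; apply/negP => sg.
have [a ga] : exists a, root g a.
  by apply/closed_rootP; rewrite neq_ltn sg orbT.
have : ('X - a%:P) ^+ 2 %| f by apply: dvdp_trans gf; rewrite dvdp_exp2r // dvdp_XsubCl.
case/dvdpP => r rE; have fa : root f a.
  by rewrite rE rootE hornerM horner_exp hornerXsubC subrr expr0n mulr0.
move/negP: (H a fa); apply.
have [t tE ta] : exists2 t, t = 'X - a%:P & t.[a] = 0.
  by exists ('X - a%:P) => //; rewrite hornerXsubC subrr.
by rewrite rE -tE expr2 rootE !derivM !(hornerD, hornerM) ta !(mulr0, mul0r, addr0).
Qed.

Lemma move_roots_perm (al : aff R) (s : seq C) :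
  move_roots al (\prod_(z <- s) ('X - z%:P)) =
  \prod_(z <- s) ('X - (aff_app al z)%:P).
Proof. exact: perm_big (root_seq_prod_XsubC s). Qed.

(** This is [a^n f((z - b)/a)], expanded so that no division by [a] remains. Its coefficients are
    polynomial in [a], [b] and those of [f], and it still makes sense at [a = 0]. *)
Definition move_poly (n : nat) (al : aff R) (f : {poly C}) : {poly C} :=
  \sum_(j < n.+1) (f`_j * al.1 ^+ (n - j)) *: ('X - al.2%:P) ^+ j.

Lemma move_poly_comp (n : nat) (al : aff R) (f : {poly C}) :
  al.1 != 0 -> (size f <= n.+1)%N ->
  move_poly n al f = al.1 ^+ n *: (f \Po (al.1^-1 *: ('X - al.2%:P))).
Proof.
move=> a0 sf; rewrite comp_polyE scaler_sumr (big_ord_widen _ (fun j => al.1 ^+ n *: (f`_j *: (al.1^-1 *: ('X - al.2%:P)) ^+ j)) sf).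
rewrite big_mkcond; apply: eq_bigr => j _; case: ltnP => [_|sj]; last first.
  by rewrite nth_default // mul0r scale0r.
rewrite exprZn !scalerA; congr (_ *: _).
have -> : al.1 ^+ n = al.1 ^+ (n - j) * al.1 ^+ j by rewrite -exprD subnK // -ltnS.
by rewrite exprVn; field; rewrite expf_neq0.
Qed.

(** Each factor satisfies [X - (a z + b) = a ((X - b)/a - z)]; the [n] factors absorb [a^n]. *)
Lemma move_rootsE (n : nat) (al : aff R) (f : {poly C}) :
  al.1 != 0 -> f \is monic -> size f = n.+1 ->
  move_roots al f = move_poly n al f.
Proof.
move=> a0 fm sf; rewrite move_poly_comp ?sf // {2}(monic_root_seqE fm).
rewrite /move_roots rmorph_prod /= -(size_root_seq sf).
elim: (root_seq f) => [|z s IH]; first by rewrite !big_nil expr0 scale1r.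
rewrite !big_cons IH /= exprS -scalerA scalerAr [in RHS]scalerAl; congr (_ * _).
rewrite comp_polyB comp_polyX comp_polyC /aff_app scalerBr scalerA mulfV // scale1r.
by rewrite -mul_polyC -polyCM polyCD opprD addrA addrAC.
Qed.

Lemma horner_move_poly (n : nat) (al : aff R) (f : {poly C}) (z : C) :
  al.1 != 0 -> (size f <= n.+1)%N ->
  (move_poly n al f).[z] = al.1 ^+ n * f.[aff_app (aff_inv al) z].
Proof.
move=> a0 sf; rewrite move_poly_comp // hornerZ horner_comp; congr (_ * f.[_]).
by rewrite hornerZ hornerXsubC /aff_app /= mulrBr.
Qed.

Lemma deriv_move_poly (n : nat) (al : aff R) (f : {poly C}) :
  al.1 != 0 -> (size f <= n.+2)%N ->
  (move_poly n.+1 al f)^`() = move_poly n al f^`().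
Proof.
move=> a0 sf; rewrite !move_poly_comp //; last first.
  by apply: leq_trans (size_poly _ _) _; case: (size f) sf.
by rewrite derivZ deriv_comp derivZ derivXsubC alg_polyC mulrC mul_polyC exprS scalerA mulrAC mulfV // mul1r.
Qed.

Lemma aff_app_inv (al : aff R) : al.1 != 0 ->
  cancel (aff_app al) (aff_app (aff_inv al)).
Proof. by move=> a0 z; rewrite /aff_app /=; field. Qed.

Lemma aff_app_invr (al : aff R) : al.1 != 0 ->
  cancel (aff_app (aff_inv al)) (aff_app al).
Proof. by move=> a0 z; rewrite /aff_app /=; field. Qed.

Lemma aff_app_mul (al be : aff R) z :
  aff_app (aff_mul al be) z = aff_app al (aff_app be z).
Proof. by rewrite /aff_app /=; ring. Qed.

Lemma move_roots_id (f : {poly C}) : f \is monic -> move_roots (aff_id R) f = f.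
Proof.
move=> fm; rewrite {2}(monic_root_seqE fm); apply: eq_bigr => z _.
by rewrite /aff_app /= mul1r addr0.
Qed.

Lemma move_roots_mul (al be : aff R) (f : {poly C}) :
  move_roots (aff_mul al be) f = move_roots al (move_roots be f).
Proof.
rewrite {3}/move_roots -(big_map (aff_app be) predT (fun z => 'X - z%:P)) move_roots_perm.
by rewrite big_map; apply: eq_bigr => z _; rewrite aff_app_mul.
Qed.

Lemma move_mult_poly p (k : 'I_p -> nat) (w : 'I_p -> C) (al : aff R) :
  al.1 != 0 ->
  move_poly (\sum_(i < p) k i) al (mult_poly k w) =
  mult_poly k (fun i => aff_app al (w i)).
Proof.
move=> a0; rewrite -move_rootsE ?mult_poly_monic ?size_mult_poly //.
apply: monic_eq_mup; rewrite ?mult_poly_monic ?monic_prod_XsubC // => x.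
rewrite mup_mult_poly /move_roots -(big_map (aff_app al) predT (fun z => 'X - z%:P)).
rewrite mup_prod_XsubC count_map -(aff_app_invr a0 x).
rewrite (@eq_count _ _ (pred1 (aff_app (aff_inv al) x))); last first.
  by move=> z /=; rewrite (can_eq (aff_app_inv a0)).
rewrite count_root_seq ?monic_neq0 ?mult_poly_monic // mup_mult_poly.
by apply: eq_bigr => i _; rewrite (can_eq (aff_app_inv a0)).
Qed.

End PolynomialAlgebra.

(** * Holomorphic maps *)

Section Differentiability.
Variables (K : numFieldType) (V : normedModType K).

Lemma differentiable_rowP (m : nat) (F : V -> 'rV[K]_m) (x : V) :
  (forall i, differentiable (fun v => F v 0 i : K^o) x) -> differentiable F x.
Proof.
move=> H; rewrite (_ : F = \sum_(i < m) (fun v => F v 0 i *: delta_mx 0 i)).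
  by apply: differentiable_sum => i; apply: differentiableZl.
by apply/funext => v; rewrite fct_sumE {1}[F v]row_sum_delta.
Qed.

Lemma differentiable_add (f g : V -> K^o) (x : V) :
  differentiable f x -> differentiable g x -> differentiable (fun v => f v + g v : K^o) x.
Proof. exact: differentiableD. Qed.

Lemma differentiable_mul (f g : V -> K^o) (x : V) :
  differentiable f x -> differentiable g x -> differentiable (fun v => f v * g v : K^o) x.
Proof. exact: differentiableM. Qed.

Lemma differentiable_const (a : K^o) (x : V) : differentiable (fun=> a) x.
Proof. exact: differentiable_cst. Qed.

Lemma differentiable_opp (f : V -> K^o) (x : V) :
  differentiable f x -> differentiable (fun v => - f v : K^o) x.
Proof. exact: differentiableN. Qed.

Lemma differentiable_exp (f : V -> K^o) (k : nat) (x : V) :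
  differentiable f x -> differentiable (fun v => f v ^+ k : K^o) x.
Proof.
move=> df; elim: k => [|k IH]; first exact: differentiable_const.
by under eq_fun do rewrite exprS; exact: differentiable_mul.
Qed.

Lemma differentiable_bigsum (I : Type) (r : seq I) (P : pred I) (f : I -> V -> K^o) (x : V) :
  (forall i, differentiable (f i) x) ->
  differentiable (fun v => \sum_(i <- r | P i) f i v : K^o) x.
Proof.
move=> H; elim: r => [|i r IH].
  by under eq_fun do rewrite big_nil; exact: differentiable_const.
under eq_fun do rewrite big_cons; case: (P i) => //.
exact: differentiable_add.
Qed.

(** Polynomials of unbounded degree lie in no finite-dimensional space, so holomorphic dependence is
    tested on each coefficient. *)
Definition coef_differentiable (P : V -> {poly K}) (x : V) :=
  forall i, differentiable (fun v => (P v)`_i : K^o) x.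

Lemma coef_differentiable_const (p : {poly K}) x : coef_differentiable (fun=> p) x.
Proof. by move=> i; apply: differentiable_const. Qed.

Lemma coef_differentiable_add P Q x : coef_differentiable P x ->
  coef_differentiable Q x -> coef_differentiable (fun v => P v + Q v) x.
Proof.
by move=> dP dQ i; under eq_fun do rewrite coefD; exact: differentiable_add.
Qed.

Lemma coef_differentiable_mul P Q x : coef_differentiable P x ->
  coef_differentiable Q x -> coef_differentiable (fun v => P v * Q v) x.
Proof.
move=> dP dQ i; under eq_fun do rewrite coefM.
by apply: differentiable_bigsum => j; exact: differentiable_mul.
Qed.

Lemma coef_differentiable_scale (c : V -> K^o) P x : differentiable c x ->
  coef_differentiable P x -> coef_differentiable (fun v => c v *: P v) x.
Proof.
by move=> dc dP i; under eq_fun do rewrite coefZ; exact: differentiable_mul.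
Qed.

Lemma coef_differentiable_XsubC (c : V -> K^o) x : differentiable c x ->
  coef_differentiable (fun v => 'X - (c v)%:P) x.
Proof.
move=> dc i; under eq_fun do rewrite coefB coefX coefC.
apply: differentiable_add; first exact: differentiable_const.
apply: differentiable_opp; case: eqP => // _; exact: differentiable_const.
Qed.

Lemma coef_differentiable_exp P k x : coef_differentiable P x ->
  coef_differentiable (fun v => P v ^+ k) x.
Proof.
move=> dP; elim: k => [|k IH]; first exact: coef_differentiable_const.
by under eq_fun do rewrite exprS; exact: coef_differentiable_mul.
Qed.

Lemma coef_differentiable_prod (I : Type) (r : seq I) (P : I -> V -> {poly K}) x :
  (forall i, coef_differentiable (P i) x) ->
  coef_differentiable (fun v => \prod_(i <- r) P i v) x.
Proof.
move=> H; elim: r => [|i r IH].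
  by under eq_fun do rewrite big_nil; exact: coef_differentiable_const.
by under eq_fun do rewrite big_cons; exact: coef_differentiable_mul.
Qed.

Lemma coef_differentiable_sum (I : Type) (r : seq I) (P : I -> V -> {poly K}) x :
  (forall i, coef_differentiable (P i) x) ->
  coef_differentiable (fun v => \sum_(i <- r) P i v) x.
Proof.
move=> H; elim: r => [|i r IH].
  by under eq_fun do rewrite big_nil; exact: coef_differentiable_const.
by under eq_fun do rewrite big_cons; exact: coef_differentiable_add.
Qed.

Lemma coef_differentiable_deriv P x : coef_differentiable P x ->
  coef_differentiable (fun v => (P v)^`()) x.
Proof.
move=> dP i; under eq_fun do rewrite coef_deriv -mulr_natr.
apply: differentiable_mul; [exact: dP|exact: differentiable_const].
Qed.

(** The degree bound [N], uniform in [v], turns evaluation into a finite sum with a fixed index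
    range. *)
Lemma differentiable_horner (N : nat) (P : V -> {poly K}) (c : V -> K^o) x :
  (forall v, size (P v) <= N)%N -> coef_differentiable P x -> differentiable c x ->
  differentiable (fun v => (P v).[c v] : K^o) x.
Proof.
move=> sP dP dc; under eq_fun do rewrite (horner_coef_wide _ (sP _)).
by apply: differentiable_bigsum => i; apply: differentiable_mul => //; exact: differentiable_exp.
Qed.

Lemma differentiable_fst_comp (U W : normedModType K) (f : V -> (U * W)%type) x :
  differentiable f x -> differentiable (fun v => (f v).1) x.
Proof.
move=> df; apply: (@differentiable_comp _ _ _ _ f fst) => //.
by apply: (@linear_differentiable _ _ _ fst) => p; apply: cvg_fst.
Qed.

Lemma differentiable_snd_comp (U W : normedModType K) (f : V -> (U * W)%type) x :
  differentiable f x -> differentiable (fun v => (f v).2) x.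
Proof.
move=> df; apply: (@differentiable_comp _ _ _ _ f snd) => //.
by apply: (@linear_differentiable _ _ _ snd) => p; apply: cvg_snd.
Qed.

Lemma differentiable_coord_comp m (f : V -> 'rV[K]_m) (i : 'I_m) x :
  differentiable f x -> differentiable (fun v => f v 0 i : K^o) x.
Proof.
move=> df; apply: (@differentiable_comp _ _ _ _ f (fun w : 'rV[K]_m => w 0 i : K^o)) => //.
exact: differentiable_coord.
Qed.

Lemma differentiable_idfun (x : V) : differentiable (fun v : V => v) x.
Proof. exact: ex_diff. Qed.

End Differentiability.

Section HolomorphicMaps.
Variable R : realType.
Implicit Types X Y Z : cspace R.

Lemma holo_ext X Y (F G : X -> Y) :
  (forall x, spt X x -> F x = G x) -> holo F -> holo G.
Proof.
move=> FG [FY hF]; split=> [x Xx|x Xx]; first by rewrite -FG //; exact: FY.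
have [Phi hPhi] := hF x Xx; exists Phi; apply: filterS hPhi => v [dPhi ev].
by split=> // y Xy yv; rewrite -FG //; exact: ev.
Qed.

Lemma holo_global X Y (F : X -> Y) (Phi : amb X -> amb Y) :
  (forall x, spt X x -> spt Y (F x)) ->
  (forall x, spt X x -> crd (F x) = Phi (crd x)) ->
  (forall x, spt X x -> \forall v \near crd x, differentiable Phi v) -> holo F.
Proof.
move=> FY FE dPhi; split=> // x Xx; exists Phi.
by apply: filterS (dPhi x Xx) => v dv; split=> // y Xy <-; exact: FE.
Qed.

Lemma holo_entire X Y (F : X -> Y) (Phi : amb X -> amb Y) :
  (forall x, spt X x -> spt Y (F x)) ->
  (forall x, spt X x -> crd (F x) = Phi (crd x)) ->
  (forall v, differentiable Phi v) -> holo F.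
Proof. by move=> FY FE dPhi; apply: holo_global FY FE _ => x _; apply: nearW. Qed.

Lemma holo_comp X Y Z (F : X -> Y) (G : Y -> Z) :
  holo F -> holo G -> holo (fun x => G (F x)).
Proof.
move=> [FY hF] [GZ hG]; split=> [x Xx|x Xx]; first exact/GZ/FY.
have [Phi hPhi] := hF x Xx; have [Psi hPsi] := hG _ (FY x Xx).
have [dPhix /(_ x Xx erefl) ePhix] := nbhs_singleton hPhi.
exists (Psi \o Phi).
have hPsi' : \forall v \near crd x, differentiable Psi (Phi v) /\
    (forall y, spt Y y -> crd y = Phi v -> crd (G y) = Psi (Phi v)).
  rewrite ePhix in hPsi; exact: (differentiable_continuous dPhix hPsi).
apply: filterS2 hPhi hPsi' => v [dv ev] [dPv ePv]; split.
  exact: differentiable_comp.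
by move=> y Xy yv; apply: ePv; [exact: FY|exact: ev].
Qed.

Lemma holo_id X : @holo R X X id.
Proof.
exact: (@holo_entire _ _ _ id).
Qed.

Lemma holo_const X Y (y : Y) : spt Y y -> @holo R X Y (fun=> y).
Proof.
move=> Yy; apply: (@holo_entire _ _ _ (fun=> crd y)) => //.
Qed.

Lemma holo_pair X Y Z (F : X -> Y) (G : X -> Z) :
  holo F -> holo G -> @holo R X (prodsp Y Z) (fun x => (F x, G x)).
Proof.
move=> [FY hF] [GZ hG]; split=> [x Xx|x Xx]; first by split; [exact: FY|exact: GZ].
have [Phi hPhi] := hF x Xx; have [Psi hPsi] := hG x Xx.
exists (fun v => (Phi v, Psi v)); apply: filterS2 hPhi hPsi => v [dv ev] [dPv ePv].
split; first exact: differentiable_pair.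
by move=> y Xy yv /=; rewrite (ev y) // (ePv y).
Qed.

Lemma holo_fst X Y : @holo R (prodsp X Y) X fst.
Proof.
apply: (@holo_entire (prodsp X Y) X fst (fun p : (amb X * amb Y)%type => p.1)) => [p []//|//|v].
exact: differentiable_fst_comp (differentiable_idfun v).
Qed.

Lemma holo_snd X Y : @holo R (prodsp X Y) Y snd.
Proof.
apply: (@holo_entire (prodsp X Y) Y snd (fun p : (amb X * amb Y)%type => p.2)) => [p []//|//|v].
exact: differentiable_snd_comp (differentiable_idfun v).
Qed.

Lemma holo_restr X Y (A : set X) (F : X -> Y) : holo F -> @holo R (restr A) Y F.
Proof.
move=> [FY hF]; split=> [x [Xx _]|x [Xx _]]; first exact: FY.
have [Phi hPhi] := hF x Xx; exists Phi; apply: filterS hPhi => v [dv ev].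
by split=> // y [Xy _]; exact: ev.
Qed.

Lemma holo_corestr X Y (A : set Y) (F : X -> Y) :
  (forall x, spt X x -> A (F x)) -> holo F -> @holo R X (restr A) F.
Proof. by move=> FA [FY hF]; split=> // x Xx; split; [exact: FY|exact: FA]. Qed.

Lemma holo_continuous X Y (F : X -> Y) x : holo F -> spt X x ->
  forall A : set (amb Y), nbhs (crd (F x)) A ->
  \forall v \near crd x, forall y, spt X y -> crd y = v -> A (crd (F y)).
Proof.
move=> [FY hF] Xx A nA; have [Phi hPhi] := hF x Xx.
have [dPhix /(_ x Xx erefl) ePhix] := nbhs_singleton hPhi.
have nA' : \forall v \near crd x, A (Phi v).
  rewrite ePhix in nA; exact: (differentiable_continuous dPhix nA).
by apply: filterS2 hPhi nA' => v [_ ev] Av y Xy yv; rewrite (ev y).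
Qed.

Lemma open_in_preimage X Y (F : X -> Y) (U : set Y) : holo F -> open_in U ->
  open_in (spt X `&` F @^-1` U).
Proof.
move=> hF [UY oU]; split=> [x []//|x [Xx Ux]].
have /= := holo_continuous hF Xx (oU _ Ux); apply: filterS => v H y Xy yv; split=> //.
by apply: (H y Xy yv) => //; apply hF.
Qed.

Lemma compact_in_image X Y (F : X -> Y) (K : set X) : holo F -> compact_in K ->
  compact_in (F @` K).
Proof.
move=> hF [KX cK]; split=> [_ [x Kx <-]|]; first by apply hF; exact: KX.
(* A local extension [Phi] computes the coordinate of [F x] from that of [x] alone, so any chosen
   preimage of [v] in [K] gives the same value. Hence [F] descends to a map of ambient spaces, to
   which preservation of compactness applies. *)
pose g (v : amb X) : amb Y :=
  if pselect (exists x, K x /\ crd x = v) is left h then crd (F (projT1 (cid h))) else 0.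
have gE x : K x -> g (crd x) = crd (F x).
  move=> Kx; rewrite /g; case: pselect => [h|[]]; last by exists x.
  case: (cid h) => y /= [Ky yx]; have [Phi hPhi] := hF.2 x (KX _ Kx).
  have [_ e] := nbhs_singleton hPhi.
  by rewrite (e y) ?(e x) //; exact: KX.
have -> : [set crd x | x in [set F x | x in K]] = g @` [set crd x | x in K].
  apply/seteqP; split=> [_ [_ [x Kx <-] <-]|_ [_ [x Kx <-] <-]].
    by exists (crd x); [exists x|exact: gE].
  by exists (F x); [exists x|rewrite gE].
apply: continuous_compact => //; apply/subspace_continuousP => _ [x Kx <-] A.
rewrite /from_subspace gE // => nA; have /= := holo_continuous hF (KX _ Kx) nA.
rewrite /within /=; apply: filterS => v H [y Ky yv].
have : A (g (crd y)) by rewrite gE //; apply: H => //; exact: KX.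
by rewrite yv.
Qed.

Lemma open_in_spt X : open_in (spt X).
Proof. by split=> // x _; apply: nearW. Qed.

Lemma biholo_sym X Y (F : X -> Y) (G : Y -> X) : holo F -> holo G ->
  (forall x, spt X x -> G (F x) = x) -> (forall y, spt Y y -> F (G y) = y) ->
  biholo F.
Proof. by move=> hF hG GF FG; split=> //; exists G. Qed.

Lemma biholo_manifold X Y (F : X -> Y) : {in spt Y &, injective (@crd R Y)} ->
  biholo F -> complex_manifold X -> complex_manifold Y.
Proof.
move=> iY [hF [G [hG [GF FG]]]] [iX [d hd]]; split=> //; exists d => y Yy.
have [U [W [phi [oU Uy oW [hphi [psi [hpsi [psiphi phipsi]]]]]]]] := hd (G y) (hG.1 y Yy).
exists (spt Y `&` G @^-1` U), W, (phi \o G); split=> //.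
  exact: open_in_preimage.
have UX : U `<=` spt X by case: oU.
split.
  apply: (@holo_comp (restr (spt Y `&` G @^-1` U)) (restr U) (open_model W) G phi) => //.
  by apply: holo_corestr => [x [_ []]//|]; exact: holo_restr.
exists (F \o psi); split; last first.
  split=> [x [Yx [_ Ux]]|w Ww] /=.
    by rewrite psiphi ?FG //; split=> //; exact: UX.
  by have [/= ? ?] := hpsi.1 w Ww; rewrite GF // phipsi.
apply: holo_corestr => [w Ww|] /=.
  have [/= Xw Uw] := hpsi.1 w Ww.
  by split; [exact: hF.1 | rewrite /= GF].
apply: (@holo_comp (open_model W) (restr U) Y psi F) => //.
exact: holo_restr.
Qed.

Lemma prodsp_manifold X Y : complex_manifold X -> complex_manifold Y ->
  complex_manifold (prodsp X Y).
Proof.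
move=> [iX [d1 h1]] [iY [d2 h2]]; split.
  move=> [x y] [x' y'] /[!inE] -[/= Xx Yy] [/= Xx' Yy'] [ex ey].
  by congr (_, _); [apply: iX|apply: iY]; rewrite ?inE.
exists (d1 + d2)%N => -[x y] [/= Xx Yy].
have [U1 [W1 [phi1 [oU1 U1x oW1 [hphi1 [psi1 [hpsi1 [pp1 pp1']]]]]]]] := h1 x Xx.
have [U2 [W2 [phi2 [oU2 U2y oW2 [hphi2 [psi2 [hpsi2 [pp2 pp2']]]]]]]] := h2 y Yy.
have U1X : U1 `<=` spt X by case: oU1.
have U2Y : U2 `<=` spt Y by case: oU2.
pose U : set (prodsp X Y) := U1 `*` U2.
pose W : set (Cn R (d1 + d2)) := lsubmx @^-1` W1 `&` rsubmx @^-1` W2.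
have hr1 : @holo R (restr U) (restr U1) fst.
  apply: holo_corestr => [p [_ []]//|]; apply: holo_restr; exact: holo_fst.
have hr2 : @holo R (restr U) (restr U2) snd.
  apply: holo_corestr => [p [_ []]//|]; apply: holo_restr; exact: holo_snd.
have hl1 : @holo R (open_model W) (open_model W1) lsubmx.
  apply: (@holo_entire (open_model W) (open_model W1) lsubmx (fun w : Cn R (d1 + d2) => lsubmx w : Cn R d1)) => [p []//|//|v].
  exact: differentiable_lsubmx.
have hl2 : @holo R (open_model W) (open_model W2) rsubmx.
  apply: (@holo_entire (open_model W) (open_model W2) rsubmx (fun w : Cn R (d1 + d2) => rsubmx w : Cn R d2)) => [p []//|//|v].
  exact: differentiable_rsubmx.
exists U, W, (fun p => row_mx (phi1 p.1) (phi2 p.2)); split=> //.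
- have := open_in_preimage (@holo_fst X Y) oU1.
  have := open_in_preimage (@holo_snd X Y) oU2.
  move=> [_ o2] [_ o1]; split=> [p [/U1X ? /U2Y ?]//|p [Up1 Up2]].
  have Sp : spt (prodsp X Y) p by split; [exact: U1X|exact: U2Y].
  have := o1 p (conj Sp Up1); have := o2 p (conj Sp Up2).
  apply: filterS2 => v H2 H1 q Sq qv; split.
    by case: (H1 q Sq qv).
  by case: (H2 q Sq qv).
- apply: openI; apply: open_comp => // w _; [exact: continuous_lsubmx|exact: continuous_rsubmx].
split.
  have hp : @holo R (restr U) (prodsp (open_model W1) (open_model W2)) (fun p => (phi1 p.1, phi2 p.2)).
    apply: holo_pair; [exact: (holo_comp hr1)|exact: (holo_comp hr2)].
  pose rw (p : prodsp (open_model W1) (open_model W2)) : open_model W := row_mx p.1 p.2.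
  apply: (@holo_comp _ _ _ _ rw hp).
  apply: (@holo_entire _ _ rw (fun p : (Cn R d1 * Cn R d2)%type => row_mx p.1 p.2)).
  - by move=> [p q] [/= ? ?]; split; rewrite /= ?row_mxKl ?row_mxKr.
  - by [].
  move=> v; apply: differentiable_rowP => i.
  rewrite -(splitK i); case: (fintype.split i) => j /=.
    under eq_fun do rewrite row_mxEl.
    by apply: differentiable_coord_comp; apply: differentiable_fst_comp; exact: differentiable_idfun.
  under eq_fun do rewrite row_mxEr.
  by apply: differentiable_coord_comp; apply: differentiable_snd_comp; exact: differentiable_idfun.
exists (fun w => (psi1 (lsubmx w), psi2 (rsubmx w))); split; last first.
  split=> [p [_ [Up1 Up2]]|w [Ww1 Ww2]] /=.
    rewrite row_mxKl row_mxKr pp1 ?pp2; [by case: p {Up1 Up2}| |];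
    by split=> //; [exact: U2Y + exact: U1X].
  by rewrite pp1' // pp2' // hsubmxK.
apply: holo_corestr => [w [Ww1 Ww2]|].
  by split; [case: (hpsi1.1 _ Ww1)|case: (hpsi2.1 _ Ww2)].
have h1' := holo_comp hl1 hpsi1; have h2' := holo_comp hl2 hpsi2.
have i1 := holo_restr U1 (@holo_id X); have i2 := holo_restr U2 (@holo_id Y).
by apply: holo_pair; [exact: (holo_comp h1' i1)|exact: (holo_comp h2' i2)].
Qed.

End HolomorphicMaps.

(** * Laurent expansions *)

Section GeometricSeries.
Variable R : realType.
Local Notation C := R[i].

(** In the partial order of [R[i]] positive elements are real, so a complex epsilon can be traded
    for a real one. *)
Lemma complex_gt0P (e : C) : 0 < e -> exists2 x : R, 0 < x & e = (x%:C)%C.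
Proof. by case: e => x y; rewrite ltcE /= => /andP[/eqP -> x0]; exists x. Qed.

Lemma expr_half_lt (e : C) : 0 < e -> exists N, forall j, (N <= j)%N -> 2^-1 ^+ j < e.
Proof.
move=> /complex_gt0P[x x0 ->].
exists (Num.bound x^-1) => j Nj.
have x2 : x^-1 < 2%:R ^+ j by apply: upper_nthrootP.
have -> : (2^-1 : C) ^+ j = ((2^-1 ^+ j : R)%:C)%C by rewrite rmorphXn /= fmorphV rmorph_nat.
by rewrite ltcR exprVn invf_plt // ?posrE // exprn_gt0.
Qed.

Lemma cvg0_geometric (u : nat -> C) (B x : C) : 0 <= B -> 0 <= x -> x <= 2^-1 ->
  (forall j, `|u j| <= B * x ^+ j) -> (u : nat -> C^o) @ \oo --> (0 : C^o).
Proof.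
move=> B0 x0 x2 ux; apply/cvgr0Pnorm_lt => e e0.
have B1 : 0 < B + 1 by rewrite ltr_wpDl.
have [N hN] := expr_half_lt (divr_gt0 e0 B1).
exists N => // j /= Nj; apply: le_lt_trans (ux j) _.
apply: (@le_lt_trans _ _ ((B + 1) * 2^-1 ^+ j)).
  apply: ler_pM => //; rewrite ?exprn_ge0 ?lerDl //.
  by rewrite lerXn2r ?nnegrE ?invr_ge0.
by rewrite mulrC -ltr_pdivlMr // hN.
Qed.

Lemma sum_geometric_le (x : C) (m i : nat) : 0 <= x -> x <= 2^-1 ->
  \sum_(0 <= j < i) x ^+ (m + j) <= 2 * x ^+ m.
Proof.
move=> x0 x2.
(* The subtracted term makes the bound inductive: passing from [i] to [i + 1] only needs
   [2 x <= 1]. *)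
suff : \sum_(0 <= j < i) x ^+ (m + j) <= 2 * x ^+ m - 2 * x ^+ (m + i).
  by move=> /le_trans; apply; rewrite gerBl mulr_ge0 ?exprn_ge0.
elim: i => [|i IH]; first by rewrite big_nil addn0 subrr.
rewrite big_nat_recr //=; apply: le_trans (lerD IH (lexx _)) _.
rewrite -addrA lerD2l addnS exprS mulrA.
have -> : - (2 * x ^+ (m + i)) + x ^+ (m + i) = - 1 * x ^+ (m + i) by ring.
rewrite -mulNr ler_wpM2r ?exprn_ge0 // lerN2.
by apply: le_trans (ler_wpM2l _ x2) _ => //; rewrite mulfV ?pnatr_eq0.
Qed.

End GeometricSeries.

Section PuncturedNeighbourhoods.
Variable R : realType.
Local Notation C := R[i].

Lemma near_dnbhsP (a : C) (P : C -> Prop) :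
  (\forall z \near (a : C^o)^', P z) <->
  exists2 e : C, 0 < e & forall z, z != a -> `|z - a| < e -> P z.
Proof.
split.
  rewrite /dnbhs /within => /nbhs_ballP[e /= e0 H]; exists e => // z za ze.
  by apply: H => //; rewrite -ball_normE /= distrC.
move=> [e e0 H]; rewrite /dnbhs /within; apply/nbhs_ballP; exists e => // z /=.
by rewrite -ball_normE /= distrC => ze za; exact: H.
Qed.

Lemma near_dnbhs_lt (a e : C) : 0 < e ->
  \forall z \near (a : C^o)^', z != a /\ `|z - a| < e.
Proof. by move=> e0; apply/near_dnbhsP; exists e. Qed.

Lemma dnbhs_ex (a : C) (P : C -> Prop) :
  (\forall z \near (a : C^o)^', P z) -> exists2 z, z != a & P z.
Proof.
move=> /near_dnbhsP[e e0 H]; have e2 : 0 < e / 2 by rewrite divr_gt0.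
have ha : a + e / 2 != a by rewrite -subr_eq0 addrC addKr gt_eqF.
exists (a + e / 2) => //; apply: H => //.
by rewrite addrC addKr gtr0_norm // gtr_pMr // invf_lt1 ?ltr1n.
Qed.

Lemma near_norm_le_eq0 (a x B : C) : 0 <= B ->
  (\forall z \near (a : C^o)^', `|x| <= B * `|z - a|) -> x = 0.
Proof.
move=> B0 H; apply/eqP/negP => /negP x0.
have nx : 0 < `|x| by rewrite normr_gt0.
have B1 : 0 < B + 1 by rewrite ltr_wpDl.
have [z za [h1 [_ h2]]] := dnbhs_ex (filterI H (near_dnbhs_lt a (divr_gt0 nx B1))).
move: h2; rewrite ltr_pdivlMr // => h2; have := lt_le_trans h2 h1.
by rewrite mulrDr mulr1 [B * _]mulrC gtrDl normr_lt0.
Qed.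

End PuncturedNeighbourhoods.

Section Laurent.
Variable R : realType.
Local Notation C := R[i].
Implicit Types (g h : C -> C) (a : C) (k : int) (c d : nat -> C).

Lemma laurent_ext g h a k c : (\forall z \near (a : C^o)^', g z = h z) ->
  laurent_at g a k c -> laurent_at h a k c.
Proof. by rewrite /laurent_at; apply: filterS2 => z ->. Qed.

(** Convergence at a single point [t != 0] already bounds the terms [c j * t ^ (k + j)], hence
    bounds [c j] by a constant times [|t|^-j]. *)
Lemma laurent_geometric g a k c : laurent_at g a k c ->
  exists2 K : C, 1 <= K & forall j, `|c j| <= K ^+ j.+1.
Proof.
move=> /dnbhs_ex[z za]; set t := z - a => cz.
have t0 : t != 0 by rewrite subr_eq0.
have /cvg_seq_bounded [M [Mr hM]] : cvgn (fun j => c j * t ^ (k + j%:Z) : C^o).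
  by apply/cvg_ex; exists 0; apply: cvg_series_cvg_0; apply/cvg_ex; exists (g z).
have hB j : `|c j * t ^ (k + j%:Z)| <= `|M| + 1.
  apply: (hM (`|M| + 1)) => //.
  by rewrite (le_lt_trans (real_ler_norm Mr)) // ltrDl.
(* The three summands make [K] dominate the constant factor, the geometric ratio and 1. *)
pose K := (`|M| + 1) * `|t ^ k|^-1 + `|t|^-1 + 1.
have K1 : 0 <= (`|M| + 1) * `|t ^ k|^-1 by rewrite mulr_ge0 ?invr_ge0 // addr_ge0.
have K2 : 0 <= `|t|^-1 by rewrite invr_ge0.
exists K; first by rewrite lerDr addr_ge0.
move=> j; have tk0 : `|t ^ k| != 0 by rewrite normr_eq0 expfz_neq0.
have tj0 : `|t| ^+ j != 0 by rewrite expf_neq0 // normr_eq0.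
have := hB j; rewrite normrM expfzDr // normrM -exprnP normrX mulrA => hj.
have -> : `|c j| = (`|c j| * `|t ^ k| * `|t| ^+ j) * (`|t ^ k|^-1 * `|t|^-1 ^+ j).
  by rewrite exprVn; field; rewrite tk0 tj0.
apply: (@le_trans _ _ ((`|M| + 1) * (`|t ^ k|^-1 * `|t|^-1 ^+ j))).
  by rewrite ler_wpM2r // mulr_ge0 ?invr_ge0 // exprn_ge0 // invr_ge0.
rewrite mulrA exprS; apply: ler_pM; rewrite ?exprn_ge0 //.
  by rewrite /K -addrA lerDl addr_ge0.
rewrite lerXn2r ?nnegrE //; first by rewrite /K !addr_ge0.
by rewrite /K addrAC lerDr addr_ge0.
Qed.

(** On [|z - a| < 1/(2K)], with [K] the growth rate of the coefficients, the terms from index [m] on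
    are dominated by a geometric series of ratio at most [1/2]. The estimate is made for a partial
    sum within [e] of [g z], with [e] arbitrary. The bound is the source of all later local
    information. *)
Lemma laurent_asymptotics g a k c (m : nat) : laurent_at g a k c ->
  exists2 B : C, 0 <= B & \forall z \near (a : C^o)^',
    `|g z - \sum_(0 <= j < m) c j * (z - a) ^ (k + j%:Z)| <=
      B * `|(z - a) ^ (k + m%:Z)|.
Proof.
move=> lg; have [K K1 hK] := laurent_geometric lg.
have K0 : 0 < K by apply: lt_le_trans K1.
exists (K ^+ m.+1 * 2); first by rewrite mulr_ge0 ?exprn_ge0 // ltW.
have e0 : 0 < (2 * K)^-1 by rewrite invr_gt0 mulr_gt0.
apply: filterS2 lg (near_dnbhs_lt a e0) => z; set t := z - a => cz [za te].
have t0 : t != 0 by rewrite subr_eq0.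
have Kt : K * `|t| <= 2^-1.
  by rewrite mulrC -ler_pdivlMr // -invfM ltW.
have Kt0 : 0 <= K * `|t| by rewrite mulr_ge0 // ltW.
apply/ler_addgt0Pr => e egt0.
have /cvgr_dist_lt /(_ e egt0)[N _ hN] := cz.
have /= hN' := hN (N + m)%N (leq_addr _ _).
set S := \sum_(0 <= j < m) _.
set T := series (fun j : nat => c j * t ^ (k + j%:Z)) (N + m)%N in hN' *.
rewrite (_ : g z - S = (T - S) + (g z - T)); last by rewrite [RHS]addrC addrA subrK.
apply: le_trans (ler_normD _ _) _; apply: lerD; last exact: ltW.
rewrite /T /series /S /= (big_cat_nat (n := m)) ?leq_addl //= [X in `|X|]addrAC subrr add0r.
rewrite -{1}[m]add0n big_addn addnK.
apply: le_trans (ler_norm_sum _ _ _) _.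
apply: (@le_trans _ _ (\sum_(0 <= j < N) K * `|t ^ k| * (K * `|t|) ^+ (m + j))).
  apply: ler_sum => j _; rewrite normrM expfzDr // normrM -exprnP normrX.
  rewrite exprMn mulrACA -exprS [`|t ^ k| * _]mulrC mulrCA [X in _ <= X]mulrC mulrA.
  by rewrite [(m + j)%N]addnC !ler_wpM2r ?exprn_ge0.
rewrite -mulr_sumr; apply: le_trans (ler_wpM2l _ (sum_geometric_le m N Kt0 Kt)) _.
  by rewrite mulr_ge0 // ltW.
by rewrite expfzDr // normrM -exprnP normrX exprMn exprS [X in X <= _](_ : _ = K * K ^+ m * 2 * (`|t ^ k| * `|t| ^+ m)) //; ring.
Qed.

Lemma laurent_sub g h a k c d : laurent_at g a k c -> laurent_at h a k d ->
  laurent_at (fun z => g z - h z) a k (fun j => c j - d j).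
Proof.
rewrite /laurent_at; apply: filterS2 => z gz hz.
have -> : series (fun j : nat => (c j - d j) * (z - a) ^ (k + j%:Z) : C^o) =
    series (fun j : nat => c j * (z - a) ^ (k + j%:Z) : C^o) -
    series (fun j : nat => d j * (z - a) ^ (k + j%:Z) : C^o).
  apply/funext => N; rewrite /series /= -[RHS]sumrB.
  by apply: eq_bigr => j _; rewrite mulrBl.
exact: cvgB gz hz.
Qed.

Lemma laurent_shift g a k c : laurent_at g a (k + 1) c <->
  laurent_at g a k (fun j => if j is i.+1 then c i else 0).
Proof.
rewrite /laurent_at; set d := (fun j : nat => if j is i.+1 then c i else 0).
have E z N : series (fun j => d j * (z - a) ^ (k + j%:Z) : C^o) N.+1 =
    series (fun j => c j * (z - a) ^ (k + 1 + j%:Z) : C^o) N.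
  rewrite /series /= big_nat_recl // /d mul0r add0r; apply: eq_bigr => j _.
  by rewrite -addrA -PoszD.
have E2 z : (series (fun j => d j * (z - a) ^ (k + j%:Z) : C^o) @ \oo --> (g z : C^o)) <->
    (series (fun j => c j * (z - a) ^ (k + 1 + j%:Z) : C^o) @ \oo --> (g z : C^o)).
  by rewrite -[X in X <-> _]cvg_shiftS (_ : (fun n => _) = 
    (series (fun j => c j * (z - a) ^ (k + 1 + j%:Z) : C^o))) //; apply/funext => N; exact: E.
by split; apply: filterS => z; [case: (E2 z)|case: (E2 z)].
Qed.

Lemma laurent_shiftn g a k c (l : nat) : laurent_at g a (k + l%:Z) c ->
  laurent_at g a k (fun j => if (j < l)%N then 0 else c (j - l)%N).
Proof.
elim: l k c => [|l IH] k c.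
  by rewrite addr0 (_ : (fun j => _) = c) //; apply/funext => j; rewrite subn0.
rewrite intS addrA => /IH /laurent_shift; congr laurent_at.
by apply/funext => -[|j].
Qed.

(** Once the earlier coefficients agree, the expansion of the zero difference bounds [|c j - d j|]
    by a multiple of [|z - a|], after division by [(z - a) ^ (k + j)]. *)
Lemma laurent_unique g a k c d : laurent_at g a k c -> laurent_at g a k d -> c =1 d.
Proof.
move=> lc ld j; elim/ltn_ind: j => j IH.
have := laurent_sub lc ld => /(laurent_asymptotics j.+1)[B B0 hB].
apply/eqP; rewrite -subr_eq0; apply/eqP; apply: (@near_norm_le_eq0 _ a _ B B0).
apply: filterS2 hB (near_dnbhs_lt a ltr01) => z hz [za _].
have t0 : z - a != 0 by rewrite subr_eq0.
move: hz; rewrite subrr sub0r normrN big_nat_recr //= big_nat_cond big1 ?add0r; last first.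
  by move=> i /andP[/andP[_ ij] _]; rewrite IH // subrr mul0r.
rewrite intS [k + (1 + _)]addrCA [_ ^ (1 + _)]expfzDr // expr1z !normrM mulrA ler_pM2r //.
by rewrite normr_gt0 expfz_neq0.
Qed.

Lemma laurent_mulz g a k c (l : int) : laurent_at g a k c ->
  laurent_at (fun z => g z * (z - a) ^ l) a (k + l) c.
Proof.
move=> lc; rewrite /laurent_at; apply: filterS2 lc (near_dnbhs_lt a ltr01) => z cz [za _].
have t0 : z - a != 0 by rewrite subr_eq0.
have -> : series (fun j : nat => c j * (z - a) ^ (k + l + j%:Z) : C^o) =
    (fun N => series (fun j : nat => c j * (z - a) ^ (k + j%:Z) : C^o) N * (z - a) ^ l).
  apply/funext => N; rewrite /series /= mulr_suml; apply: eq_bigr => j _.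
  by rewrite addrAC expfzDr // mulrA.
exact: cvgMr_tmp cz.
Qed.

Lemma laurent_poly (p : {poly C}) a :
  laurent_at (horner p) a 0 (fun j => (p \Po ('X + a%:P))`_j).
Proof.
set q := p \Po _; rewrite /laurent_at; apply: filterS (near_dnbhs_lt a ltr01) => z _.
apply: cvg_near_cst; exists (size q) => // N /= sN.
rewrite /series /= big_mkord -[z in RHS](subrK a).
have -> : p.[z - a + a] = q.[z - a] by rewrite horner_comp !hornerE.
rewrite (horner_coef_wide _ sN).
by apply: eq_bigr => j _; rewrite add0r -exprnP.
Qed.

(** Formal division by [t - s], where [t = z - a] and [s = r - a]: comparing coefficients in
    [(t - s) * sum d_j t^j = sum c_j t^j] gives the recursion for [d], whose growth is again
    geometric. *)
Lemma laurent_divXsubC g a c (r : C) : r != a -> laurent_at g a 0 c ->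
  exists2 d, d 0%N = c 0%N / (a - r) & laurent_at (fun z => g z / (z - r)) a 0 d.
Proof.
move=> ra lc; set s := r - a; have s0 : s != 0 by rewrite subr_eq0.
have [K K1 hK] := laurent_geometric lc.
pose d := fix d j := if j is i.+1 then (d i - c j) / s else - c 0%N / s.
(* The term [2 / |s|] gives [1 / |s| <= K' / 2], so that dividing a difference of two terms bounded
   by [K' ^+ j.+2] by [s] costs just one more factor [K']. *)
pose K' := K + 2 * `|s|^-1.
have is0 : 0 <= `|s|^-1 by rewrite invr_ge0.
have K0 : 0 < K by apply: lt_le_trans K1.
have KK' : K <= K' by rewrite lerDl mulr_ge0.
have K'0 : 0 < K' by apply: lt_le_trans KK'.
have sK' : `|s|^-1 <= K' / 2 by rewrite ler_pdivlMr // mulrC lerDr ltW.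
have cK' j : `|c j| <= K' ^+ j.+1.
  by apply: le_trans (hK j) _; rewrite lerXn2r ?nnegrE ?(ltW K0) ?(ltW K'0).
have K'1 : 1 <= K' by apply: le_trans KK'.
have hd j : `|d j| <= K' ^+ j.+2.
  elim: j => [|j IH] /=.
    rewrite normrM normrN normfV expr2; apply: ler_pM => //.
    apply: le_trans sK' _; by rewrite ler_pdivrMr // ler_peMr ?ler1n // ltW.
  rewrite normrM normfV exprSr.
  have -> : K' ^+ j.+2 * K' = (K' ^+ j.+2 + K' ^+ j.+2) * (K' / 2) by field.
  apply: ler_pM => //; apply: le_trans (ler_normB _ _) _; apply: lerD => //.
exists d => [|]; first by rewrite /= -opprB invrN mulrN mulNr.
have e0 : 0 < (2 * K')^-1 by rewrite invr_gt0 mulr_gt0.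
have e1 : 0 < `|s| by rewrite normr_gt0.
rewrite /laurent_at; apply: filterS3 lc (near_dnbhs_lt a e0) (near_dnbhs_lt a e1) => z.
set t := z - a => cz [za te] [_ ts].
have tms : t - s != 0 by rewrite subr_eq0; apply: contraTneq ts => ->; rewrite ltxx.
have zr : z - r = t - s by rewrite /t /s opprB addrA subrK.
have Kt : K' * `|t| <= 2^-1.
  by rewrite mulrC -ler_pdivlMr // -invfM ltW.
have Kt0 : 0 <= K' * `|t| by rewrite mulr_ge0 // ltW.
(* Truncating the division leaves exactly the error [d N * t ^+ N.+1], which tends to 0 because
   [K' |t| <= 1/2]. *)
have E N : series (fun j => d j * t ^ (0 + j%:Z) : C^o) N.+1 =
    (series (fun j => c j * t ^ (0 + j%:Z) : C^o) N.+1 + d N * t ^+ N.+1) / (t - s).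
  apply: (canRL (mulfK tms)); elim: N => [|N IH].
    by rewrite /series /= !big_nat1 add0r expr0z /=; field.
  rewrite seriesSr mulrDl {}IH [in RHS]seriesSr !add0r -!exprnP /= !exprS; field.
  exact: s0.
rewrite zr -cvg_shiftS.
rewrite (_ : (fun N => _) = (fun N => (series (fun j => c j * t ^ (0 + j%:Z) : C^o) N.+1
  + d N * t ^+ N.+1) / (t - s) : C^o)); last by apply/funext => N; exact: E.
apply: cvgMr_tmp; rewrite -[g z]addr0; apply: cvgD.
  by rewrite (cvg_shiftS (series (fun j => c j * t ^ (0 + j%:Z) : C^o))).
apply: (@cvg0_geometric _ _ (K' * K' * `|t|) (K' * `|t|)) => //.
  by rewrite !mulr_ge0 // ltW.
move=> j; rewrite normrM normrX exprMn.
rewrite [X in _ <= X](_ : _ = K' ^+ j.+2 * `|t| ^+ j.+1); last by rewrite !exprS; ring.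
by rewrite ler_wpM2r ?exprn_ge0.
Qed.

(** The denominator is divided out one linear factor at a time; none of its roots equals [a]. *)
Lemma laurent_ratio (p q : {poly C}) a : q.[a] != 0 ->
  exists2 c, c 0%N = p.[a] / q.[a] & laurent_at (fun z => p.[z] / q.[z]) a 0 c.
Proof.
move=> qa; have q0 : q != 0 by apply: contra_neq qa => ->; rewrite horner0.
pose q1 (s : seq C) := lead_coef q *: \prod_(r <- s) ('X - r%:P).
have qE : q = q1 (root_seq q) by exact: root_seqE.
rewrite qE in qa *; elim: (root_seq q) qa => [|r s IH].
  rewrite /q1 big_nil alg_polyC hornerC => lq.
  exists (fun j => ((lead_coef q)^-1 *: p \Po ('X + a%:P))`_j).
    by rewrite -horner_coef0 horner_comp !hornerE mulrC.
  apply: laurent_ext (laurent_poly ((lead_coef q)^-1 *: p) a).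
  by apply: filterS (near_dnbhs_lt a ltr01) => z _; rewrite hornerZ hornerC mulrC.
have e z : (q1 (r :: s)).[z] = (q1 s).[z] * (z - r).
  by rewrite /q1 big_cons !hornerZ hornerM hornerXsubC; ring.
rewrite e mulf_eq0 negb_or => /andP[sa ra]; have [c c0 lc] := IH sa.
have [|d d0 ld] := laurent_divXsubC _ lc (r := r).
  by rewrite eq_sym -subr_eq0.
exists d; first by rewrite d0 c0 invfM mulrA.
apply: laurent_ext ld; apply: filterS (near_dnbhs_lt a ltr01) => z _.
by rewrite e invfM mulrA.
Qed.

(** An expansion of higher order, rewritten from the lower exponent, starts with a zero coefficient;
    uniqueness then contradicts the nonzero leading coefficient of the other expansion. *)
Lemma has_order_unique g a k l : has_order g a k -> has_order g a l -> k = l.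
Proof.
have W (k' l' : int) : (k' < l')%R -> has_order g a k' -> has_order g a l' -> False.
  move=> kl [c c0 lc] [d d0 ld]; case/negP: c0; apply/eqP.
  have [m lE] : exists m : nat, l' = k' + m.+1%:Z.
    by exists (absz (l' - k' - 1)%R); lia.
  rewrite lE in ld; have := laurent_shiftn ld => ld'.
  by rewrite (laurent_unique lc ld' 0%N).
by move=> hk hl; case: (ltgtP k l) => // kl; [case: (W _ _ kl hk hl)|case: (W _ _ kl hl hk)].
Qed.

Lemma has_order_ratio (p q : {poly C}) a : p != 0 -> q != 0 ->
  has_order (fun z => p.[z] / q.[z]) a ((mup a p)%:Z - (mup a q)%:Z).
Proof.
move=> p0 q0; have mupE (f : {poly C}) : f != 0 ->
    exists2 g, g.[a] != 0 & f = g * ('X - a%:P) ^+ mup a f.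
  move=> f0; have [m [g]] := multiplicity_XsubC f a; rewrite f0 /= => ga fE.
  have g0 : g != 0 by apply: contraNneq ga => ->; rewrite root0.
  have mm : mup a f = m by rewrite fE mupMr // mup_XsubCX eqxx.
  by exists g => //; rewrite mm.
have [p1 p1a pE] := mupE p p0; have [q1 q1a qE] := mupE q q0.
have [c c0 lc] := laurent_ratio p1 q1a.
exists c; first by rewrite c0 mulf_neq0 // invr_eq0.
have := laurent_mulz ((mup a p)%:Z - (mup a q)%:Z) lc; rewrite add0r.
apply: laurent_ext; apply: filterS (near_dnbhs_lt a ltr01) => z [za _].
have t0 : z - a != 0 by rewrite subr_eq0.
rewrite [in RHS]pE [in RHS]qE !hornerM !horner_exp !hornerXsubC expfzDr // -exprnN -exprnP.
by rewrite invfM mulrACA.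
Qed.

Lemma laurent_cvg g a c : laurent_at g a 0 c ->
  forall e : C, 0 < e -> \forall z \near (a : C^o)^', `|g z - c 0%N| < e.
Proof.
move=> lg e e0; have [B B0 hB] := laurent_asymptotics 1 lg.
have B1 : 0 < B + 1 by rewrite ltr_wpDl.
apply: filterS2 hB (near_dnbhs_lt a (divr_gt0 e0 B1)) => z hz [za ze].
move: hz; rewrite big_nat1 !add0r expr0z mulr1 expr1z => /le_lt_trans; apply.
apply: (@le_lt_trans _ _ ((B + 1) * `|z - a|)); first by rewrite ler_wpM2r // lerDl.
by rewrite mulrC -ltr_pdivlMr.
Qed.

(** [has_residue] may use an expansion starting well below exponent -1. Padding the simple-pole
    expansion with zeros identifies its leading coefficient with the [m]-th one there. *)
Lemma laurent_simple_pole g a (r : C) : has_order g a (- 1) -> has_residue g a r ->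
  exists2 c, c 0%N = r & laurent_at g a (- 1) c.
Proof.
move=> [c c0 lc] [m [d [ld dm]]]; exists c => //.
have : laurent_at g a (- m.+1%:Z + m%:Z) c.
  by rewrite (_ : - m.+1%:Z + m%:Z = -1) //; lia.
by move=> /laurent_shiftn lc'; rewrite -dm (laurent_unique ld lc') ltnn subnn.
Qed.

End Laurent.

Lemma nbhs_neq0 (K : numFieldType) (a : K^o) : a != 0 -> \forall y \near a, y != 0.
Proof.
move=> a0; apply/nbhs_ballP; exists `|a|; first by rewrite /= normr_gt0.
by move=> y; rewrite -ball_normE /=; apply: contraTneq => ->; rewrite subr0 ltxx.
Qed.

Lemma near_neq0 (K : numFieldType) (V : topologicalType) (f : V -> K^o) (x : V) :
  {for x, continuous f} -> f x != 0 -> \forall v \near x, f v != 0.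
Proof. by move=> cf fx; exact: (cf _ (nbhs_neq0 fx)). Qed.

(** * Quotients by the affine group *)

Section AffineGroup.
Variable R : realType.
Local Notation C := R[i].

Lemma aff_mulVg (al : aff R) : al.1 != 0 -> aff_mul (aff_inv al) al = aff_id R.
Proof. by case: al => a b /= a0; congr (_, _) => /=; field. Qed.

Lemma aff_mulgV (al : aff R) : al.1 != 0 -> aff_mul al (aff_inv al) = aff_id R.
Proof. by case: al => a b /= a0; congr (_, _) => /=; field. Qed.

Lemma aff_inv_neq0 (al : aff R) : al.1 != 0 -> (aff_inv al).1 != 0.
Proof. by move=> a0; rewrite /= invr_eq0. Qed.

Lemma aff_mulA (al be ga : aff R) :
  aff_mul al (aff_mul be ga) = aff_mul (aff_mul al be) ga.
Proof. by congr (_, _) => /=; ring. Qed.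

Lemma aff_mulg1 (al : aff R) : aff_mul al (aff_id R) = al.
Proof. by case: al => a b; congr (_, _) => /=; ring. Qed.

Lemma aff_mul1g (al : aff R) : aff_mul (aff_id R) al = al.
Proof. by case: al => a b; congr (_, _) => /=; ring. Qed.

Lemma differentiable_aff_fst (V : normedModType C) (f : V -> (C^o * C^o)%type) v :
  differentiable f v -> differentiable (fun v => (f v).1 : C^o) v.
Proof. exact: differentiable_fst_comp. Qed.

Lemma differentiable_aff_snd (V : normedModType C) (f : V -> (C^o * C^o)%type) v :
  differentiable f v -> differentiable (fun v => (f v).2 : C^o) v.
Proof. exact: differentiable_snd_comp. Qed.

Lemma holo_aff_inv : @holo R (Aff R) (Aff R) (@aff_inv R).
Proof.
apply: (@holo_global R (Aff R) (Aff R) _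
  (fun v : (C^o * C^o)%type => (v.1^-1 : C^o, - (v.1^-1 * v.2) : C^o))) => //.
  by move=> al; exact: aff_inv_neq0.
move=> al a0; have d1 v : differentiable (fun v : (C^o * C^o)%type => v.1) v.
  exact: differentiable_aff_fst (differentiable_idfun v).
have d2 v : differentiable (fun v : (C^o * C^o)%type => v.2) v.
  exact: differentiable_aff_snd (differentiable_idfun v).
have := near_neq0 (differentiable_continuous (d1 al)) a0.
apply: filterS => v v0; apply: differentiable_pair; first exact: differentiableV.
apply: differentiable_opp; apply: differentiable_mul => //; exact: differentiableV.
Qed.

Lemma holo_aff_mul :
  @holo R (prodsp (Aff R) (Aff R)) (Aff R) (fun p => aff_mul p.1 p.2).
Proof.
apply: (@holo_entire R (prodsp (Aff R) (Aff R)) (Aff R) _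
  (fun v : ((C^o * C^o) * (C^o * C^o))%type =>
     (v.1.1 * v.2.1 : C^o, v.1.1 * v.2.2 + v.1.2 : C^o))) => //.
  by move=> [al be] [/= a0 b0]; rewrite mulf_neq0.
move=> v; have d1 := differentiable_fst_comp (differentiable_idfun v).
have d2 := differentiable_snd_comp (differentiable_idfun v).
apply: differentiable_pair.
  by apply: differentiable_mul; exact: differentiable_aff_fst.
by apply: differentiable_add; [apply: differentiable_mul; [exact: differentiable_aff_fst|exact: differentiable_aff_snd]|exact: differentiable_aff_snd].
Qed.

Lemma Aff_manifold : complex_manifold (Aff R).
Proof.
split; first by move=> [a b] [a' b'] _ _.
exists 2%N => al a0.
pose W : set (Cn R 2) := [set w | w 0 0 != 0].
exists (spt (Aff R)), W, (fun al : Aff R => \row_(i < 2) (if i == 0 then al.1 else al.2)).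
have cW : forall w : Cn R 2, {for w, continuous (fun w : Cn R 2 => w 0 0 : C^o)}.
  move=> w; apply: differentiable_continuous.
  exact: differentiable_coord_comp (differentiable_idfun w).
split=> //; first exact: open_in_spt.
  by rewrite openE => w w0; exact: (near_neq0 (cW w) w0).
apply: (@biholo_sym R (restr (spt (Aff R))) (open_model W) _ (fun w : Cn R 2 => (w 0 0, w 0 1))).
- apply: (@holo_entire R (restr (spt (Aff R))) (open_model W) _
    (fun al : (C^o * C^o)%type => \row_(i < 2) (if i == 0 then al.1 else al.2) : Cn R 2)) => //.
    by move=> [a b] [/= ? _]; rewrite /W /= mxE.
  move=> v; apply: differentiable_rowP => i; under eq_fun do rewrite mxE.
  by case: eqP => _; [apply: differentiable_aff_fst|apply: differentiable_aff_snd]; exact: differentiable_idfun.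
- apply: (@holo_entire R (open_model W) (restr (spt (Aff R))) _
    (fun w : Cn R 2 => (w 0 0 : C^o, w 0 1 : C^o))) => // v.
  by apply: differentiable_pair; apply: differentiable_coord_comp; exact: differentiable_idfun.
- by move=> [a b] _; rewrite !mxE.
move=> w _; apply/rowP => i; rewrite mxE.
by case: (i =P 0) => [->//|]; case: i => -[|[|//]] hi ni; [case: ni; exact: val_inj|congr (w 0 _); exact: val_inj].
Qed.

End AffineGroup.

(** * Action groupoids of the affine group *)

Section ActionGroupoid.
Variables (R : realType) (X : cspace R) (act : aff R -> X -> X).
Hypothesis X_manifold : complex_manifold X.
Hypothesis holo_act : @holo R (prodsp (Aff R) X) X (fun p => act p.1 p.2).
Hypothesis act1 : forall x, spt X x -> act (aff_id R) x = x.
Hypothesis actM : forall al be x, al.1 != 0 -> be.1 != 0 -> spt X x ->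
  act (aff_mul al be) x = act al (act be x).

Lemma act_spt al x : al.1 != 0 -> spt X x -> spt X (act al x).
Proof. by move=> a0 Xx; exact: (holo_act.1 (al, x)). Qed.

Lemma actK al x : al.1 != 0 -> spt X x -> act (aff_inv al) (act al x) = x.
Proof. by move=> a0 Xx; rewrite -actM ?aff_mulVg ?act1 //; exact: aff_inv_neq0. Qed.

Lemma actVK al x : al.1 != 0 -> spt X x -> act al (act (aff_inv al) x) = x.
Proof. by move=> a0 Xx; rewrite -actM ?aff_mulgV ?act1 //; exact: aff_inv_neq0. Qed.

Lemma holo_act_const al : al.1 != 0 -> holo (act al).
Proof.
move=> a0; have hc := @holo_const R X (Aff R) al a0.
exact: (holo_comp (holo_pair hc (@holo_id R X)) holo_act).
Qed.

Let arr := prodsp (Aff R) X.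
Let hfst : holo (fst : arr -> Aff R) := @holo_fst R (Aff R) X.
Let hsnd : holo (snd : arr -> X) := @holo_snd R (Aff R) X.

(** Source and target are submersions through global sections that keep the affine map fixed: [y]
    goes to [(al, y)] for the source and to [(al, al^-1 y)] for the target. *)
Lemma aff_quotient_holomorphic : holomorphic_groupoid (aff_quotient act).
Proof.
have id0 : spt (Aff R) (aff_id R) by rewrite /= oner_neq0.
split.
- by split=> //; apply: prodsp_manifold => //; exact: Aff_manifold.
- split; split=> //= -[al x] [/= a0 Xx].
    exists (spt X), (fun y => (al, y)); split=> //; first exact: open_in_spt.
    by apply: holo_restr; apply: holo_pair; [exact: holo_const|exact: holo_id].
  exists (spt X), (fun y => (al, act (aff_inv al) y)); split=> //=.
  + exact: open_in_spt.
  + exact: act_spt.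
  + apply: holo_restr; apply: holo_pair; first exact: holo_const.
    by apply: holo_act_const; exact: aff_inv_neq0.
  + by rewrite actK.
  + by move=> y Xy; rewrite actVK.
- split; first by apply: holo_pair; [exact: holo_const|exact: holo_id].
  apply: holo_pair => //; exact: (holo_comp hfst (@holo_aff_inv R)).
- apply: holo_restr; apply: holo_pair; last first.
    exact: (holo_comp (@holo_snd R arr arr) hsnd).
  have h1 := holo_comp (@holo_fst R arr arr) hfst.
  have h2 := holo_comp (@holo_snd R arr arr) hfst.
  exact: (holo_comp (holo_pair h1 h2) (@holo_aff_mul R)).
split.
- by move=> x Xx /=; rewrite act1.
- by move=> [al x] [/= a0 Xx]; rewrite actK.
- move=> [al x] [be y] [[[/= a0 Xx] [/= b0 Yy]] /= xy]; split=> //.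
  by rewrite actM // xy.
- by move=> [al x] [be y] [ga z] _ _ /=; rewrite aff_mulA.
move=> [al x] [/= a0 Xx]; rewrite /cmp /=.
by rewrite aff_mulg1 aff_mul1g aff_mulVg // aff_mulgV.
Qed.

End ActionGroupoid.

(** * Transfer of the orbifold structure along an equivariant biholomorphism *)

Section ActionTransfer.
Variables (R : realType) (X Y : cspace R).
Variables (actX : aff R -> X -> X) (actY : aff R -> Y -> Y).
Variables (D : X -> Y) (E : Y -> X).
Hypothesis X_manifold : complex_manifold X.
Hypothesis holo_actX : @holo R (prodsp (Aff R) X) X (fun p => actX p.1 p.2).
Hypothesis actX1 : forall x, spt X x -> actX (aff_id R) x = x.
Hypothesis actXM : forall al be x, al.1 != 0 -> be.1 != 0 -> spt X x ->
  actX (aff_mul al be) x = actX al (actX be x).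
Hypothesis properX : @proper_map R (prodsp (Aff R) X) (prodsp X X)
  (fun ax => (ax.2, actX ax.1 ax.2)).
Hypothesis finX : forall x, spt X x ->
  finite_set [set al : Aff R | al.1 != 0 /\ actX al x = x].
Hypothesis injY : {in spt Y &, injective (@crd R Y)}.
Hypothesis hD : holo D.
Hypothesis hE : holo E.
Hypothesis DK : forall x, spt X x -> E (D x) = x.
Hypothesis EK : forall y, spt Y y -> D (E y) = y.
Hypothesis actD : forall al x, al.1 != 0 -> spt X x -> actY al (D x) = D (actX al x).

Let actXs al x : al.1 != 0 -> spt X x -> spt X (actX al x).
Proof. exact: act_spt. Qed.

Let actYE al y : al.1 != 0 -> spt Y y -> actY al y = D (actX al (E y)).
Proof. by move=> a0 Yy; rewrite -{1}(EK Yy) actD //; exact: hE.1. Qed.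

Let holo_actY : @holo R (prodsp (Aff R) Y) Y (fun p => actY p.1 p.2).
Proof.
have h1 := @holo_fst R (Aff R) Y; have h2 := holo_comp (@holo_snd R (Aff R) Y) hE.
have := holo_comp (holo_comp (holo_pair h1 h2) holo_actX) hD.
by apply: holo_ext => -[al y] [/= a0 Yy]; rewrite actYE.
Qed.

Lemma aff_quotient_orbifold : complex_orbifold (aff_quotient actX).
Proof.
split; [exact: aff_quotient_holomorphic|exact: properX|move=> x Xx].
apply: (@sub_finite_set _ _ ((fun al => (al, x)) @` [set al : Aff R | al.1 != 0 /\ actX al x = x])).
  by move=> [al z] [[/= a0 Xz] [/= zx]]; rewrite zx => e; exists al.
by apply: finite_image; exact: finX.
Qed.

Lemma aff_quotient_orbifold_transfer : complex_orbifold (aff_quotient actY).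
Proof.
have Yman : complex_manifold Y.
  by apply: biholo_manifold injY _ X_manifold; exact: (biholo_sym hD hE).
split.
- apply: aff_quotient_holomorphic => //.
    by move=> y Yy; rewrite actYE ?actX1 ?EK //= ?oner_neq0 //; exact: hE.1.
  move=> al be y a0 b0 Yy; have Ey := hE.1 y Yy.
  rewrite !(actYE _ Yy) ?mulf_neq0 // actXM // actYE ?DK //; first exact: actXs.
  by apply: hD.1; exact: actXs.
(* The part of [Aff x Y] lying over [K] is the image under [(id, D)] of the part of [Aff x X] lying
   over [(E x E)(K)], and holomorphic maps preserve compactness. *)
- move=> K cK.
  have hEE : @holo R (prodsp Y Y) (prodsp X X) (fun p => (E p.1, E p.2)).
    by apply: holo_pair; [exact: (holo_comp (@holo_fst R Y Y))|exact: (holo_comp (@holo_snd R Y Y))].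
  have hID : @holo R (prodsp (Aff R) X) (prodsp (Aff R) Y) (fun p => (p.1, D p.2)).
    by apply: holo_pair; [exact: holo_fst|exact: (holo_comp (@holo_snd R (Aff R) X))].
  have := compact_in_image hID (properX (compact_in_image hEE cK)).
  congr compact_in; apply/seteqP; split.
    move=> _ [[al x] [[/= a0 Xx] [[y1 y2] Ky [/= e1 e2]]] <-] /=.
    have [/= Yy1 Yy2] := cK.1 _ Ky.
    split; first by split=> //; exact: hD.1.
    by rewrite /= actD // -e2 -e1 !EK.
  move=> [al y] [[/= a0 Yy] /= Ky]; exists (al, E y) => /=; last by rewrite EK.
  split; first by split=> //; exact: hE.1.
  exists (y, actY al y) => //=; rewrite actYE // DK //.
  by apply: actXs => //; exact: hE.1.
move=> y Yy; have Ey := hE.1 y Yy.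
apply: (@sub_finite_set _ _ ((fun al => (al, y)) @` [set al : Aff R | al.1 != 0 /\ actX al (E y) = E y])).
  move=> [al z] [[/= a0 Yz] [/= zy]]; rewrite zy => e; exists al => //; split=> //.
  by rewrite -[RHS](congr1 E e) actYE // DK //; exact: actXs.
by apply: finite_image; exact: finX.
Qed.

Lemma aff_quotient_isomorphism :
  @orbifold_isomorphism R (aff_quotient actX) (aff_quotient actY) D
    (fun af => (af.1, D af.2)).
Proof.
split; [exact: aff_quotient_orbifold|exact: aff_quotient_orbifold_transfer|].
have id0 : (aff_id R).1 != 0 by rewrite /= oner_neq0.
have h1X := @holo_fst R (Aff R) X; have h2X := @holo_snd R (Aff R) X.
have hF1 : @holo R (prodsp (Aff R) X) (prodsp (Aff R) Y) (fun p => (p.1, D p.2)).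
  by apply: holo_pair => //; exact: (holo_comp h2X).
split.
- split=> // -[al x] [/= a0 Xx]; by rewrite actD.
- pose A := prodsp (Aff R) Y.
  have ha : @holo R (prodsp A X) Y (fun gx => actY gx.1.1 gx.1.2).
    exact: (holo_comp (@holo_fst R A X) holo_actY).
  split; last first.
    move=> y Yy; exists ((aff_id R, y), E y) => /=.
      by split; [split; [split|exact: hE.1]|rewrite /= EK].
    by rewrite actYE // actX1 ?EK //; exact: hE.1.
  split; first exact: holo_restr.
  move=> [[al y] x] [[[/= a0 Yy] Xx] /= yx].
  (* Keeping [al] fixed, an arrow with target [z] must start at [al^-1 z], and the fibre product
     condition forces the last component to be its preimage under [D]. *)
  exists (spt Y), (fun z => ((al, actY (aff_inv al) z), E (actY (aff_inv al) z))).
  have a0' := aff_inv_neq0 a0.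
  have hc : @holo R Y Y (actY (aff_inv al)) by exact: holo_act_const.
  split=> //=.
  + exact: open_in_spt.
  + exact: (holo_actY.1 (al, y)).
  + apply: holo_restr; apply: holo_corestr.
      by move=> z Yz /=; rewrite EK //; exact: hc.1.
    apply: holo_pair; last exact: (holo_comp hc hE).
    by apply: holo_pair => //; exact: holo_const.
  + have -> : actY (aff_inv al) (actY al y) = y.
      by rewrite yx actD // actD // ?actK //; exact: actXs.
    by rewrite yx DK.
  + move=> z Yz; have Ez := hE.1 z Yz.
    by rewrite (actYE a0' Yz) actD // ?actVK ?EK //; exact: actXs.
(* An arrow upstairs is recovered from its affine part and its source; the target [x'] is then
   determined because [E] inverts [D]. *)
pose T := ff_target (H := aff_quotient actX) (G := aff_quotient actY) D.
apply: (@biholo_sym R (arr (aff_quotient actX)) T _ (fun p : T => (p.2.1, p.1.1))).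
- apply: holo_corestr => [[al x] [/= a0 Xx]|]; first by rewrite actD.
  by apply: holo_pair => //; apply: holo_pair.
- apply: holo_restr; pose A := prodsp (Aff R) Y; pose B := prodsp X X.
  apply: holo_pair.
    exact: (holo_comp (@holo_snd R B A) (@holo_fst R (Aff R) Y)).
  exact: (holo_comp (@holo_fst R B A) (@holo_fst R X X)).
- by move=> [al x] _.
move=> [[x x'] [al y]] [[[/= Xx Xx'] [/= a0 Yy]] [/= e1 e2]].
by rewrite e1 actD // in e2 *; rewrite -[x']DK // -e2 DK //; exact: actXs.
Qed.

End ActionTransfer.

(** * Holomorphic dependence of simple roots *)

Section LittleO.
Variables (R : realType) (V : normedModType R[i]).
Local Notation C := R[i].

(** The order of [R[i]] is only partial; [d e / (d + e)] serves as an explicit positive lower bound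
    of both. *)
Lemma gt0_min (d e : C) : 0 < d -> 0 < e -> exists2 m, 0 < m & m <= d /\ m <= e.
Proof.
move=> d0 e0; have de0 : 0 < d + e by rewrite addr_gt0.
exists (d * e / (d + e)); first by rewrite divr_gt0 // mulr_gt0.
rewrite !ler_pdivrMr //; split; first by rewrite ler_wpM2l ?lerDr ?(ltW d0) ?(ltW e0).
by rewrite mulrC ler_wpM2l ?lerDl ?(ltW d0) ?(ltW e0).
Qed.

Lemma near_shift0 (v : V) (A : V -> Prop) :
  (\forall u \near v, A u) -> \forall h \near (0 : V), A (h + v).
Proof. by rewrite (near_shift 0) /= subr0. Qed.

(** The estimate at [h = 0] forces [g v = 0], so [g] is its own remainder and its differential at
    [v] is zero. *)
Lemma differentiable_littleo (g : V -> C^o) (v : V) :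
  (forall e : C, 0 < e -> \forall h \near (0 : V), `|g (h + v)| <= e * `|h|) ->
  differentiable g v.
Proof.
move=> H; have gv : g v = 0.
  have := nbhs_singleton (H 1 ltr01); rewrite add0r normr0 mulr0 normr_le0.
  by move/eqP.
have c0 : continuous (\0 : V -> C^o) by move=> x; exact: cvg_cst.
have E : g \o shift v = cst (g v) + (\0 : {linear V -> C^o}) +o_ 0 id.
  apply/eqaddoP => e e0; apply: filterS (H e e0) => h.
  by rewrite -[X in _ -> `|X| <= _]/(g (h + v) - (g v + 0)) gv addr0 subr0.
by apply/diff_locallyP; rewrite (diff_unique c0 E).
Qed.

Lemma differentiable_lipschitz (f : V -> C^o) (v : V) : differentiable f v ->
  exists2 B : C, 0 < B & \forall h \near (0 : V), `|f (h + v) - f v| <= B * `|h|.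
Proof.
move=> df; have /eqaddoP/(_ 1 ltr01) H := diff_locally df.
have [k k0 hk] := linear_lipschitz (diff_continuous df).
exists (1 + k); first by rewrite addr_gt0.
apply: filterS H => h /= H; rewrite mulrDl.
rewrite (_ : f (h + v) - f v = (f (h + v) - (f v + 'd f v h)) + 'd f v h); last first.
  by rewrite opprD addrA subrK.
exact: le_trans (ler_normD _ _) (lerD H (hk h)).
Qed.

Lemma continuous_at_comp (f : V -> C^o) (F : C^o -> C^o) (v : V) :
  {for v, continuous f} -> differentiable F (f v) ->
  {for v, continuous (fun u => F (f u))}.
Proof. by move=> cf dF; exact: (cvg_comp _ _ cf (differentiable_continuous dF)). Qed.

(** Replacing [k u] by [k v] changes the product by [O(h) o(1)], so mere continuity of [k] suffices.
    It will be applied to a [k] built from a root that is so far only known to be continuous. *)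
Lemma differentiable_caratheodory (f k : V -> C^o) (v : V) :
  differentiable f v -> {for v, continuous k} ->
  differentiable (fun u => (f u - f v) * k u : C^o) v.
Proof.
move=> df ck.
rewrite (_ : (fun u => _) = (fun u => (f u - f v) * k v + (f u - f v) * (k u - k v) : C^o)); last first.
  by apply/funext => u; rewrite -mulrDr [k v + _]addrC subrK.
apply: differentiable_add.
  apply: differentiable_mul; last exact: differentiable_const.
  by apply: differentiable_add => //; exact: differentiable_const.
apply: differentiable_littleo => e e0.
have [B B0 hB] := differentiable_lipschitz df.
have ck' : \forall h \near (0 : V), `|k (h + v) - k v| < e / B.
  have /cvgr_dist_lt /(_ _ (divr_gt0 e0 B0)) H := ck.
  by have := near_shift0 H; apply: filterS => h; rewrite distrC.
apply: filterS2 hB ck' => h h1 h2; rewrite normrM.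
apply: le_trans (ler_pM _ _ h1 (ltW h2)) _ => //.
by rewrite mulrC mulrA divfK // gt_eqF.
Qed.

End LittleO.

Section SimpleRoots.
Variables (R : realType) (V : normedModType R[i]).
Local Notation C := R[i].
Variables (P : V -> {poly C}) (N : nat) (l : C).
Hypothesis size_P : forall v, (size (P v) <= N.+1)%N.
Hypothesis lead_P : forall v, (P v)`_N = l.
Hypothesis l_neq0 : l != 0.
Hypothesis dP : forall v, coef_differentiable P v.

Let size_PE v : size (P v) = N.+1.
Proof.
apply/eqP; rewrite eqn_leq size_P ltnNge; apply/negP => s.
by move: l_neq0; rewrite -(lead_P v) nth_default ?eqxx.
Qed.

Let lead_PE v : lead_coef (P v) = l.
Proof. by rewrite lead_coefE size_PE lead_P. Qed.

(** If all roots of [P v] were at distance at least [e] from [a], the factorisation would give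
    [|P_v(a)| >= |l| e^N], whereas [P_v(a)] tends to 0. *)
Lemma root_near (v0 : V) (a : C) : root (P v0) a -> forall e : C, 0 < e ->
  \forall v \near v0, exists2 r, root (P v) r & `|a - r| < e.
Proof.
move=> ra e e0; have c : {for v0, continuous (fun v => (P v).[a] : C^o)}.
  apply: differentiable_continuous.
  exact: (differentiable_horner (N := N.+1) size_P (dP v0) (differentiable_const _ _)).
have d0 : 0 < `|l| * e ^+ N by rewrite mulr_gt0 ?normr_gt0 // exprn_gt0.
have /cvgr_dist_lt /(_ _ d0) := c; apply: filterS => v.
rewrite (eqP ra) sub0r normrN => hv; apply: contrapT => nr.
suff : `|l| * e ^+ N <= `|(P v).[a]|.
  by move=> /le_lt_trans /(_ hv); rewrite ltxx.
rewrite (root_seqE (P v)) hornerZ normrM lead_PE ler_pM2l ?normr_gt0 //.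
rewrite horner_prod normr_prod -(size_root_seq (size_PE v)).
have H : forall r, r \in root_seq (P v) -> e <= `|a - r|.
  move=> r rs; rewrite real_leNgt ?(gtr0_real e0) ?normr_real //; apply/negP => ar.
  apply: nr; exists r => //; rewrite (root_seqE (P v)) rootZ ?lead_coef_eq0; last first.
    by rewrite -size_poly_eq0 size_PE.
  by rewrite root_prod_XsubC.
elim: (root_seq (P v)) H => [|r s IH] H; first by rewrite big_nil.
rewrite big_cons exprS hornerXsubC; apply: ler_pM; rewrite ?exprn_ge0 ?(ltW e0) //.
  by apply: H; rewrite mem_head.
by apply: IH => r' rs; apply: H; rewrite inE rs orbT.
Qed.

(** The divided difference of [P v], written without a quotient so that it extends to the diagonal,
    where it is the derivative. For [i = 0] the inner sum is empty. *)
Let Q (v : V) (x y : C) :=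
  \sum_(i < N.+1) (P v)`_i * \sum_(j < i) x ^+ (i.-1 - j) * y ^+ j.

Let QE v x y : (P v).[x] - (P v).[y] = (x - y) * Q v x y.
Proof.
rewrite !(horner_coef_wide _ (size_P v)) -sumrB mulr_sumr; apply: eq_bigr => i _.
by rewrite -mulrBr subrXX mulrCA.
Qed.

Let Qdiag v x : Q v x x = (P v)^`().[x].
Proof.
have sd : (size (P v)^`() <= N)%N.
  by apply: leq_trans (size_poly _ _) _; rewrite size_PE.
rewrite (horner_coef_wide _ sd) /Q big_ord_recl big_ord0 mulr0 add0r.
apply: eq_bigr => i _; rewrite coef_deriv /= /bump /= add1n.
rewrite (eq_bigr (fun=> x ^+ i)); last first.
  by move=> j _; rewrite -exprD subnK // -ltnS.
by rewrite sumr_const card_ord mulrnAr mulrnAl.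
Qed.

(** Joint continuity at [(v0, a, a)]. The common radius [e] gives both uniqueness of the root in the
    disc and a nonzero denominator later. *)
Lemma Q_neq0 (v0 : V) (a : C) : (P v0)^`().[a] != 0 ->
  exists2 e : C, 0 < e & \forall v \near v0, forall x y,
    `|x - a| < e -> `|y - a| < e -> Q v x y != 0.
Proof.
rewrite -Qdiag => Qa.
pose G (p : (V * (C^o * C^o))%type) : C^o := Q p.1 p.2.1 p.2.2.
have d1 p : differentiable (fun p : (V * (C^o * C^o))%type => p.1) p.
  exact: differentiable_fst_comp (differentiable_idfun p).
have d2 p : differentiable (fun p : (V * (C^o * C^o))%type => p.2) p.
  exact: differentiable_snd_comp (differentiable_idfun p).
have cG : {for (v0, (a, a)), continuous G}.
  apply: (@differentiable_continuous _ (V * (C^o * C^o))%type C^o (v0, (a, a)) G).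
  apply: differentiable_bigsum => i; apply: differentiable_mul.
    exact: (differentiable_comp (f := fun p : (V * (C^o * C^o))%type => p.1)
      (g := fun v => (P v)`_i : C^o) (d1 _) (dP _ i)).
  apply: differentiable_bigsum => j.
  by apply: differentiable_mul; apply: differentiable_exp;
    [exact: differentiable_fst_comp|exact: differentiable_snd_comp].
have [[A B] [/= nA nB] AB] := near_neq0 (f := G) cG Qa.
have [[B1 B2] [/= nB1 nB2] B12] := nB.
have /nbhs_ballP[e1 /= e10 he1] := nB1; have /nbhs_ballP[e2 /= e20 he2] := nB2.
have [e e0 [ee1 ee2]] := gt0_min e10 e20; exists e => //.
apply: filterS nA => v Av x y xe ye; apply: (AB (v, (x, y))); split=> //=.
apply: B12; split=> /=.
  by apply: he1; rewrite -ball_normE /= distrC; exact: lt_le_trans ee1.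
by apply: he2; rewrite -ball_normE /= distrC; exact: lt_le_trans ee2.
Qed.

(* The divided difference [Q v (rho u) (rho v)] turns
   [P_u(rho u) = P_v(rho v) = 0] into a formula for [rho u - rho v] that is
   linear in the coefficients of [P_u - P_v]. *)
Lemma simple_root_section (v0 : V) (a : C) :
  root (P v0) a -> (P v0)^`().[a] != 0 ->
  exists (rho : V -> C^o) (e : C), 0 < e /\
    \forall v \near v0, differentiable rho v /\
      forall x, `|x - a| < e -> root (P v) x -> x = rho v.
Proof.
move=> ra dra; have [e e0 he] := Q_neq0 dra.
pose good v := (forall x y, `|x - a| < e -> `|y - a| < e -> Q v x y != 0) /\
  (exists2 r, root (P v) r & `|a - r| < e).
pose rho v := xget 0 [set r | root (P v) r /\ `|r - a| < e].
have ngood : \forall v \near v0, good v.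
  by apply: filterI; [exact: he|exact: root_near].
have rhoP v : good v -> root (P v) (rho v) /\ `|rho v - a| < e.
  move=> [_ [r rr ar]]; rewrite /rho; case: xgetP => [y -> //|/(_ r) H].
  by case: H; split=> //; rewrite distrC.
have rhoU v x : good v -> `|x - a| < e -> root (P v) x -> x = rho v.
  move=> gv xe rx; have [rr re] := rhoP v gv.
  have /eqP := QE v x (rho v); rewrite (eqP rx) (eqP rr) subrr eq_sym mulf_eq0.
  by rewrite (negPf (gv.1 _ _ xe re)) orbF subr_eq0 => /eqP.
exists rho, e; split=> //.
(* Differentiability is claimed at every [v] near [v0], so goodness is needed on a neighbourhood of
   each such [v]. *)
have := near_join ngood; apply: filterS => v gv_near.
have gv : good v := nbhs_singleton gv_near; split; last by move=> x; exact: rhoU.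
have [rr re] := rhoP v gv; set r := rho v in rr re *.
(* [root_near] yields a root of [P u] close to [r]; the radius [m <= e - |r - a|] keeps it in the
   disc around [a], where it must be [rho u]. *)
have crho : {for v, continuous (rho : V -> C^o)}.
  apply/cvgrPdist_lt => d d0.
  have re' : 0 < e - `|r - a| by rewrite subr_gt0.
  have [m m0 [md me]] := gt0_min d0 re'.
  apply: filterS2 gv_near (root_near rr m0) => u gu [r' rr' rm].
  rewrite -(rhoU u r' gu _ rr'); first exact: lt_le_trans md.
  have := lt_le_trans rm me; rewrite ltrBrDr; apply: le_lt_trans.
  by rewrite [`|r - r'|]distrC; exact: ler_distD.
pose k i (u : V) : C^o := - (rho u) ^+ i / Q v (rho u) r.
have ck i : {for v, continuous (k i)}.
  have cQ : {for v, continuous (fun u => Q v (rho u) r : C^o)}.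
    have dQ : differentiable (fun x : C^o => Q v x r : C^o) (rho v : C^o).
      apply: differentiable_bigsum => i'.
      apply: differentiable_mul; first exact: differentiable_const.
      apply: differentiable_bigsum => j; apply: differentiable_mul; last exact: differentiable_const.
      exact: differentiable_exp (differentiable_idfun _).
    exact: continuous_at_comp crho dQ.
  apply: continuousM; last by apply: continuousV => //; exact: (gv.1 _ _ re re).
  have dX : differentiable (fun x : C^o => - x ^+ i : C^o) (rho v : C^o).
    by apply: differentiable_opp; exact: differentiable_exp (differentiable_idfun _).
  exact: continuous_at_comp crho dX.
(* [rho] agrees with [G] only near [v]. The difference [rho - G] vanishes there and is
   differentiable by [differentiable_littleo], while [G] is handled by the Caratheodory
   criterion. *)
pose G u : C^o := r + \sum_(i < N.+1) ((P u)`_i - (P v)`_i) * k i u.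
rewrite (_ : rho = fun u => G u + (rho u - G u)); last first.
  by apply/funext => u; rewrite addrC subrK.
apply: differentiable_add.
  apply: differentiable_add; first exact: differentiable_const.
  apply: differentiable_bigsum => i.
  exact: (@differentiable_caratheodory R V (fun u => (P u)`_i : C^o) (k i) v (dP v i) (ck i)).
apply: differentiable_littleo => d d0.
have := near_shift0 gv_near; apply: filterS => h gu.
rewrite [_ - _](_ : _ = 0) ?normr0 ?mulr_ge0 ?(ltW d0) //.
have [ru ue] := rhoP _ gu; have Qu := gv.1 _ _ ue re.
apply/eqP; rewrite subr_eq0 /G [r + _]addrC -subr_eq; apply/eqP.
have := QE v (rho (h + v)) r; rewrite (eqP rr) subr0 => QEu.
apply: (mulIf Qu); rewrite -QEu.
have -> : (P v).[rho (h + v)] = (P v).[rho (h + v)] - (P (h + v)).[rho (h + v)].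
  by rewrite (eqP ru) subr0.
rewrite !(horner_coef_wide _ (size_P _)) -sumrB mulr_suml; apply: eq_bigr => i _.
by rewrite /k mulrA divfK // mulrN mulrBl opprB.
Qed.

End SimpleRoots.

(** * Charts of configuration spaces *)

Section Multiplicities.
Variable R : realType.
Local Notation C := R[i].

(** Each derivative lowers the exponent by one and multiplies the value of the cofactor at [a] by
    the old exponent, a nonzero number in characteristic 0. *)
Lemma derivn_mult (h : {poly C}) (a : C) (k j : nat) : (j <= k)%N -> h.[a] != 0 ->
  exists2 h1 : {poly C}, h1.[a] != 0 &
    (('X - a%:P) ^+ k * h)^`(j) = ('X - a%:P) ^+ (k - j) * h1.
Proof.
elim: j => [|j IH] jk ha; first by exists h => //; rewrite subn0.
have [h1 h1a E] := IH (ltnW jk) ha.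
rewrite derivnS E; have -> : (k - j = (k - j.+1).+1)%N by rewrite -subSn.
set m := (k - j.+1)%N.
exists (h1 *+ m.+1 + ('X - a%:P) * h1^`()).
  rewrite hornerD hornerMn hornerM hornerXsubC subrr mul0r addr0.
  by rewrite -mulr_natr mulf_neq0 // pnatr_eq0.
rewrite derivM deriv_exp derivXsubC mul1r /= exprSr; ring.
Qed.

Lemma mup_split (q : {poly C}) (a : C) : q != 0 ->
  exists2 h : {poly C}, h.[a] != 0 & q = ('X - a%:P) ^+ mup a q * h.
Proof.
move=> q0; have [m [g]] := multiplicity_XsubC q a; rewrite q0 /= => ga qE.
by exists g => //; rewrite {2}qE mupMr // mup_XsubCX eqxx mulrC.
Qed.

Lemma root_derivn_mup (q : {poly C}) (a : C) (j : nat) : q != 0 ->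
  (j < mup a q)%N -> root q^`(j) a.
Proof.
move=> q0 jm; have [h ha qE] := mup_split a q0.
have [h1 h1a E] := derivn_mult (ltnW jm) ha; rewrite qE E rootE hornerM horner_exp.
by rewrite hornerXsubC subrr expr0n subn_eq0 leqNgt jm mul0r.
Qed.

Lemma nroot_derivn_mup (q : {poly C}) (a : C) : q != 0 -> ~~ root q^`(mup a q) a.
Proof.
move=> q0; have [h ha qE] := mup_split a q0.
have [h1 h1a E] := derivn_mult (leqnn (mup a q)) ha.
by rewrite {2}qE E subnn mul1r.
Qed.

End Multiplicities.

Section NearFamilies.
Variables (R : realType) (V : normedModType R[i]).
Local Notation C := R[i].

Lemma gt0_min_seq (I : eqType) (s : seq I) (F : I -> C) (e : C) : 0 < e ->
  (forall i, 0 < F i) -> exists2 m, 0 < m & m <= e /\ forall i, i \in s -> m <= F i.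
Proof.
move=> e0 F0; elim: s => [|i s [m m0 [me ms]]]; first by exists e.
have [d d0 [dm dF]] := gt0_min m0 (F0 i); exists d => //; split.
  exact: le_trans me.
by move=> j; rewrite inE => /orP[/eqP ->//|/ms]; exact: le_trans.
Qed.

Lemma near_dist_lt (x a e : C) : `|x - a| < e ->
  \forall y \near (x : C^o), `|y - a| < e.
Proof.
move=> xe; have d0 : 0 < e - `|x - a| by rewrite subr_gt0.
apply/nbhs_ballP; exists (e - `|x - a|) => // y; rewrite -ball_normE /= => xy.
apply: le_lt_trans (ler_distD x _ _) _; rewrite distrC.
by rewrite -ltrBrDr.
Qed.

Lemma near_horner_neq0 (P : V -> {poly C}) (N : nat) (v0 : V) (a : C) :
  (forall v, (size (P v) <= N)%N) -> coef_differentiable P v0 -> (P v0).[a] != 0 ->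
  exists2 e : C, 0 < e & \forall v \near v0, forall x, `|x - a| < e -> (P v).[x] != 0.
Proof.
move=> sP dP Pa.
pose G (p : (V * C^o)%type) : C^o := (P p.1).[p.2].
have cG : {for (v0, a), continuous G}.
  apply: (@differentiable_continuous _ (V * C^o)%type C^o (v0, a) G).
  apply: (differentiable_horner (N := N)) => //.
    move=> i; exact: (differentiable_comp (f := fun p : (V * C^o)%type => p.1)
      (g := fun v => (P v)`_i : C^o)
      (differentiable_fst_comp (differentiable_idfun (v0, a : C^o))) (dP i)).
  exact: differentiable_snd_comp (differentiable_idfun (v0, a : C^o)).
have [[A B] [/= nA nB] AB] := near_neq0 (f := G) cG Pa.
have /nbhs_ballP[e /= e0 he] := nB; exists e => //.
apply: filterS nA => v Av x xe; apply: (AB (v, x)); split=> //=.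
by apply: he; rewrite -ball_normE /= distrC.
Qed.

Lemma near_forall_ord (p : nat) (A : 'I_p -> V -> Prop) (v0 : V) :
  (forall i, \forall v \near v0, A i v) -> \forall v \near v0, forall i, A i v.
Proof. by move=> H; exact: filter_forall. Qed.

End NearFamilies.

Section ConfigurationChart.
Variables (R : realType) (n : nat) (kappa : seq nat).
Hypothesis n_ge2 : (2 <= n)%N.
Hypothesis kappaP : is_partition kappa n.-1.
Local Notation C := R[i].
Local Notation p := (size kappa).

Definition mults : 'I_p -> nat := fun i => nth 0%N kappa i.
Local Notation k := mults.

Lemma mults_gt0 i : (0 < k i)%N.
Proof. by case: kappaP => /allP + _; apply; exact: mem_nth. Qed.

Lemma sum_mults : (\sum_(i < p) k i = n.-1)%N.
Proof. by rewrite sum_nth_ord; case: kappaP. Qed.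

Lemma mults_lt i : (k i < n)%N.
Proof.
rewrite -(prednK (ltnW n_ge2)) ltnS -sum_mults (bigD1 i) //=; exact: leq_addr.
Qed.

Lemma size_mult_poly_mults (w : 'I_p -> C) : size (mult_poly k w) = n.
Proof. by rewrite size_mult_poly sum_mults prednK // ltnW. Qed.

Definition crit (f : {poly C}) (w : 'I_p -> C) := f^`() = n%:R *: mult_poly k w.

Lemma natn_neq0 : (n%:R : C) != 0.
Proof. by rewrite pnatr_eq0 -lt0n ltnW. Qed.

Lemma monic_deriv_neq0 (f : {poly C}) : f \is monic -> size f = n.+1 ->
  f^`() != 0 /\ lead_coef f^`() = n%:R.
Proof.
move=> fm sf; have c : f^`()`_n.-1 = n%:R.
  rewrite coef_deriv prednK ?(ltnW n_ge2) //.
  by move/monicP: fm; rewrite lead_coefE sf /= => ->.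
have s : size f^`() = n.
  apply/eqP; rewrite eqn_leq; apply/andP; split.
    by apply: leq_trans (size_poly _ _) _; rewrite sf.
  rewrite leqNgt; apply/negP => s; move: natn_neq0.
  by rewrite -c nth_default ?eqxx // -ltnS prednK // ltnW.
by rewrite lead_coefE s c -size_poly_eq0 s -lt0n ltnW.
Qed.

(** Restates the stratum through labelled critical points: squarefreeness becomes nonvanishing of
    the critical values. *)
Lemma Conf_critP (f : {poly C}) : Conf_set n kappa f <->
  [/\ f \is monic, size f = n.+1 & exists2 w, injective w &
      crit f w /\ forall i, f.[w i] != 0].
Proof.
split.
  move=> [fm sf sq rm]; split=> //; have [d0 dl] := monic_deriv_neq0 fm sf.
  have f0 := monic_neq0 fm; case: (kappaP) => kp _.
  have [w iw E] := (root_multsP d0 kp).1 rm; exists w => //; split.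
    by rewrite /crit E dl.
  move=> i; have /contraL := (squarefreeP f0).1 sq (w i); apply.
  rewrite E rootZ ?lead_coef_eq0 // root_mult_poly; last exact: mults_gt0.
  by apply/existsP; exists i.
move=> [fm sf [w iw [cw fw]]]; have [d0 dl] := monic_deriv_neq0 fm sf.
have f0 := monic_neq0 fm; case: (kappaP) => kp _; split=> //.
  apply/(squarefreeP f0) => a fa; rewrite cw rootZ ?natn_neq0 //.
  rewrite root_mult_poly; last exact: mults_gt0.
  by apply/existsP => -[i /eqP wi]; have := fw i; rewrite wi (eqP fa) eqxx.
by apply/(root_multsP d0 kp); exists w => //; rewrite dl cw.
Qed.

(** Restores the leading term dropped by [crd]. It is defined at every ambient point, which is where
    holomorphic extensions live. *)
Definition poly_of (v : Cn R n) : {poly C} := 'X^n + rVpoly v.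

Lemma coef_poly_of v i : (poly_of v)`_i =
  if (i < n)%N =P true is ReflectT h then v 0 (Ordinal h) else (i == n)%:R.
Proof.
rewrite coefD coefXn; case: eqP => [h|h].
  by rewrite (coef_rVpoly_ord v (Ordinal h)) ltn_eqF // add0r.
rewrite coef_rVpoly; case: insubP => [j ij _|_]; first by case: h.
by rewrite addr0.
Qed.

Lemma poly_of_differentiable v : coef_differentiable poly_of v.
Proof.
move=> i; under eq_fun do rewrite coef_poly_of.
case: eqP => h; last exact: differentiable_const.
exact: differentiable_coord_comp (differentiable_idfun v).
Qed.

Lemma size_poly_of v : (size (poly_of v) <= n.+1)%N.
Proof.
apply/leq_sizeP => j nj; rewrite coef_poly_of.
by case: eqP => [h|_]; [move: (ltn_trans nj h); rewrite ltnn|rewrite gtn_eqF].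
Qed.

Lemma lead_poly_of v : (poly_of v)`_n = 1.
Proof. by rewrite coef_poly_of; case: eqP => [h|_]; rewrite ?eqxx //; exfalso; have := h; rewrite ltnn. Qed.

Lemma monic_poly_of (f : {poly C}) : f \is monic -> size f = n.+1 ->
  poly_of (\row_(i < n) f`_i) = f.
Proof.
move=> fm sf; apply/polyP => i; rewrite coef_poly_of; case: eqP => [h|/negP h].
  by rewrite mxE.
move: h; rewrite -leqNgt leq_eqVlt => /orP[/eqP <-|h].
  by rewrite eqxx; move/monicP: fm; rewrite lead_coefE sf /= => ->.
by rewrite gtn_eqF // nth_default // sf.
Qed.

Lemma Conf_poly_of (f : Conf R n kappa) : spt (Conf R n kappa) f ->
  poly_of (crd f) = f.
Proof. by move=> [fm sf _ _]; exact: monic_poly_of. Qed.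

Lemma derivn_differentiable (P : Cn R n -> {poly C}) j v : coef_differentiable P v ->
  coef_differentiable (fun v => (P v)^`(j)) v.
Proof.
move=> dP; elim: j => [|j IH]; first by under eq_fun do rewrite derivn0.
by under eq_fun do rewrite derivnS; exact: coef_differentiable_deriv.
Qed.

Lemma size_derivn_poly_of j v : (size (poly_of v)^`(j) <= (n - j).+1)%N.
Proof.
apply/leq_sizeP => i ni; rewrite coef_derivn nth_default ?mul0rn //.
by apply: leq_trans (size_poly_of v) _; lia.
Qed.

Lemma lead_derivn_poly_of j v : (j <= n)%N -> (poly_of v)^`(j)`_(n - j) = (n ^_ j)%:R.
Proof. by move=> jn; rewrite coef_derivn subnKC // lead_poly_of. Qed.

Lemma ffact_neq0 j : (j <= n)%N -> ((n ^_ j)%:R : C) != 0.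
Proof. by move=> jn; rewrite pnatr_eq0 -lt0n ffact_gt0. Qed.

Lemma separation (w : 'I_p -> C) (e : C) : 0 < e -> injective w ->
  exists2 d, 0 < d & d <= e /\ forall i j, i != j -> d + d <= `|w i - w j|.
Proof.
move=> e0 iw.
pose F (ij : 'I_p * 'I_p) := if ij.1 == ij.2 then e else `|w ij.1 - w ij.2| / 2.
have F0 ij : 0 < F ij.
  rewrite /F; case: eqP => // /eqP ne.
  by rewrite divr_gt0 // normr_gt0 subr_eq0 (inj_eq iw).
have [d d0 [de dF]] := gt0_min_seq (enum {: 'I_p * 'I_p}) e0 F0.
exists d => //; split=> // i j ij; have := dF (i, j); rewrite mem_enum => /(_ isT).
by rewrite /F /= (negPf ij) ler_pdivlMr // mulr_natr mulr2n.
Qed.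

(* Each old critical point attracts at least one new one; there are as many new
   ones as old ones, and multiplicities can only drop, so they are preserved. *)
Lemma crit_near (f : Conf R n kappa) (w : 'I_p -> C) (e : C) :
  spt (Conf R n kappa) f -> injective w -> crit f w -> 0 < e ->
  \forall v \near crd f, forall y : Conf R n kappa, spt (Conf R n kappa) y -> crd y = v ->
    exists2 w', injective w' & crit y w' /\ forall i, `|w' i - w i| < e.
Proof.
move=> Sf iw cw e0.
have fE := Conf_poly_of Sf; have [fm sf _ _] := Sf.
have [d0 dl] := monic_deriv_neq0 fm sf.
have mupf i : mup (w i) f^`() = k i.
  rewrite cw -mul_polyC mupMr ?mup_mult_poly_inj //.
  by rewrite rootE hornerC natn_neq0.
(* The [k i]-th derivative of [f'], of order [(k i).+1] for [f], does not vanish at [w i]. This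
   persists nearby and caps by [k i] the multiplicity of any new critical point close to [w i]. *)
have He i : exists2 ei : C, 0 < ei & \forall v \near crd f, forall x,
    `|x - w i| < ei -> (poly_of v)^`((k i).+1).[x] != 0.
  apply: (near_horner_neq0 (N := (n - (k i).+1).+1)).
  - exact: size_derivn_poly_of.
  - by apply: derivn_differentiable; exact: poly_of_differentiable.
  - rewrite fE derivSn -(mupf i); exact: nroot_derivn_mup.
pose ei i := projT1 (cid2 (He i)).
have ei0 i : 0 < ei i by rewrite /ei; case: cid2.
have eiP i : \forall v \near crd f, forall x,
    `|x - w i| < ei i -> (poly_of v)^`((k i).+1).[x] != 0.
  by rewrite /ei; case: cid2.
have [e1 e10 [e1e e1s]] := separation e0 iw.
have [d dgt0 [de1 dei]] := gt0_min_seq (enum 'I_p) e10 ei0.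
have dei' i : d <= ei i by apply: dei; rewrite mem_enum.
have near_root i : \forall v \near crd f,
    exists2 r, root (poly_of v)^`(1) r & `|w i - r| < d.
  apply: (root_near (N := (n - 1)%N) (l := (n ^_ 1)%:R)) => //.
  - exact: size_derivn_poly_of.
  - by move=> v; apply: lead_derivn_poly_of; exact: ltnW.
  - by apply: ffact_neq0; exact: ltnW.
  - by move=> v; apply: derivn_differentiable; exact: poly_of_differentiable.
  - rewrite fE derivn1 cw rootZ ?natn_neq0 // root_mult_poly; last exact: mults_gt0.
    by apply/existsP; exists i.
apply: filterS2 (near_forall_ord near_root) (near_forall_ord eiP) => v hr hn y Sy yv.
have yE := Conf_poly_of Sy; rewrite yv in yE; rewrite yE in hr hn.
have [ym sy [w2 iw2 [cw2 _]]] := (Conf_critP y).1 Sy.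
have [dy0 _] := monic_deriv_neq0 ym sy.
have Hs i : exists j, `|w2 j - w i| < d.
  have [r] := hr i; rewrite derivn1 cw2 rootZ ?natn_neq0 // root_mult_poly; last exact: mults_gt0.
  by move=> /existsP[j /eqP <-] wr; exists j; rewrite distrC.
pose s i := projT1 (cid (Hs i)).
have sP i : `|w2 (s i) - w i| < d by rewrite /s; case: cid.
have is_ : injective s.
  move=> i j sij; apply/eqP; rewrite -[_ == _]negbK; apply/negP => ij.
  have := e1s i j ij; have si := sP i; have sj := sP j; rewrite -sij in sj.
  move=> /(le_trans (lerD de1 de1)) /le_lt_trans.
  move=> /(_ _ (le_lt_trans (ler_distD (w2 (s i)) _ _) (ltrD _ sj))).
  by rewrite distrC => /(_ _ si); rewrite ltxx.
have ks i : (k (s i) <= k i)%N.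
  rewrite -(mup_mult_poly_inj k (s i) iw2) leqNgt; apply/negP => lt.
  have /negP := hn i _ (lt_le_trans (sP i) (dei' i)); apply.
  rewrite derivSn; apply: (root_derivn_mup (a := w2 (s i)) dy0).
  by rewrite cw2 -mul_polyC mupMr // rootE hornerC natn_neq0.
have kse i : k (s i) = k i.
  have sumE : (\sum_(i < p) k (s i) = \sum_(i < p) k i)%N by rewrite [RHS](reindex_inj is_).
  have [_ ] := leqif_sum (fun i (_ : true) => leqif_eq (ks i)).
  by rewrite sumE eqxx => /esym/forallP/(_ i)/eqP.
exists (w2 \o s); first exact: inj_comp.
split; last by move=> i; apply: lt_le_trans (sP i) _; exact: le_trans e1e.
rewrite /crit cw2; congr (_ *: _); rewrite /mult_poly (reindex_inj is_).
by apply: eq_bigr => i _; rewrite kse.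
Qed.

Definition chart_roots (u : Cn R p.+1) (i : 'I_p) : C := u 0 (lift ord0 i).

(* The primitive of [n%:R *: mult_poly k (chart_roots u)] with value [u 0 ord0]
   at 0. *)
Definition chart_poly (u : Cn R p.+1) : {poly C} :=
  \poly_(i < n.+1) (if i is j.+1 then n%:R * (mult_poly k (chart_roots u))`_j / j.+1%:R
                    else u 0 ord0).

Lemma chart_poly_crit u : crit (chart_poly u) (chart_roots u).
Proof.
apply/polyP => j; rewrite coef_deriv coef_poly coefZ ltnS.
case: ltnP => [_|nj]; last by rewrite mul0rn nth_default ?mulr0 // size_mult_poly_mults.
by rewrite -[LHS]mulr_natr divfK // pnatr_eq0.
Qed.

Lemma chart_poly_lead u : (chart_poly u)`_n = 1.
Proof.
rewrite coef_poly leqnn -(prednK (ltnW n_ge2)) /= mulrC -(size_mult_poly_mults (chart_roots u)).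
have /monicP := mult_poly_monic k (chart_roots u); rewrite lead_coefE => ->.
by rewrite mulr1 size_mult_poly_mults prednK ?(ltnW n_ge2) // mulVf // natn_neq0.
Qed.

Lemma size_chart_poly u : size (chart_poly u) = n.+1.
Proof.
apply/eqP; rewrite eqn_leq size_poly ltnNge; apply/negP => s.
by have /eqP := chart_poly_lead u; rewrite nth_default // eq_sym oner_eq0.
Qed.

Lemma chart_poly_monic u : chart_poly u \is monic.
Proof. by apply/monicP; rewrite lead_coefE size_chart_poly chart_poly_lead. Qed.

Lemma chart_poly_differentiable u : coef_differentiable chart_poly u.
Proof.
have cd i v : differentiable (fun u : Cn R p.+1 => u 0 i : C^o) v.
  exact: differentiable_coord_comp (differentiable_idfun v).
move=> i; under eq_fun do rewrite coef_poly.
case: ltnP => _; last exact: differentiable_const.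
case: i => [|j]; first exact: cd.
apply: differentiable_mul; last exact: differentiable_const.
apply: differentiable_mul; first exact: differentiable_const.
suff H : coef_differentiable (fun u => mult_poly k (chart_roots u)) u by exact: H.
apply: coef_differentiable_prod => i; apply: coef_differentiable_exp.
by apply: coef_differentiable_XsubC; exact: cd.
Qed.

Lemma chart_poly_of (y : {poly C}) (w : 'I_p -> C) (u : Cn R p.+1) :
  size y = n.+1 -> crit y w -> chart_roots u = w -> u 0 ord0 = y`_0 ->
  chart_poly u = y.
Proof.
move=> sy cy uw u0; apply/polyP => i; rewrite coef_poly ltnS.
case: leqP => [|ni]; last by rewrite nth_default // sy.
case: i => [_|j jn] //; have := congr1 (fun q : {poly C} => q`_j) cy.
rewrite /= coef_deriv coefZ uw => <-.
by rewrite -[X in X / _]mulr_natr mulfK // pnatr_eq0.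
Qed.

Section AroundPoint.
Variables (f0 : Conf R n kappa) (w0 : 'I_p -> C) (e0 : C).
Hypothesis Sf0 : spt (Conf R n kappa) f0.
Hypothesis iw0 : injective w0.
Hypothesis cf0 : crit f0 w0.
Hypothesis e0_gt0 : 0 < e0.
Hypothesis sep0 : forall i j, i != j -> e0 + e0 <= `|w0 i - w0 j|.

(** The disjoint discs around the [w0 i] fix the labelling of the critical points, which makes
    [chart_poly] injective on [W]; nonzero critical values keep it squarefree. *)
Let W : set (Cn R p.+1) := [set u |
  (forall i, `|chart_roots u i - w0 i| < e0) /\
  forall i, (chart_poly u).[chart_roots u i] != 0].

Let close_eq (x : C) i j : `|x - w0 i| < e0 -> `|x - w0 j| < e0 -> i = j.
Proof.
move=> xi xj; apply/eqP; rewrite -[_ == _]negbK; apply/negP => ij.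
have := le_lt_trans (le_trans (sep0 ij) (ler_distD x _ _)) (ltrD _ xj).
by rewrite distrC => /(_ _ xi); rewrite ltxx.
Qed.

Let W_inj u : W u -> injective (chart_roots u).
Proof. by move=> [h _] i j e; apply: (close_eq (h i)); rewrite e. Qed.

Let W_Conf u : W u -> Conf_set n kappa (chart_poly u).
Proof.
move=> Wu; apply/Conf_critP; split; rewrite ?chart_poly_monic ?size_chart_poly //.
exists (chart_roots u); first exact: W_inj.
by split; [exact: chart_poly_crit|case: Wu].
Qed.

Let chart_poly_inj u u' : W u -> W u' -> chart_poly u = chart_poly u' -> u = u'.
Proof.
move=> [Wu _] [Wu' _] E.
have E0 : u 0 ord0 = u' 0 ord0.
  by have := congr1 (fun q : {poly C} => q`_0) E; rewrite !coef_poly.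
have Er i : chart_roots u i = chart_roots u' i.
  have : root (chart_poly u')^`() (chart_roots u i).
    rewrite -E chart_poly_crit rootZ ?natn_neq0 // root_mult_poly; last exact: mults_gt0.
    by apply/existsP; exists i.
  rewrite chart_poly_crit rootZ ?natn_neq0 // root_mult_poly; last exact: mults_gt0.
  case/existsP => j /eqP ji; rewrite -ji; congr chart_roots.
  by apply: (close_eq (Wu' j)); rewrite ji.
apply/rowP => i; case: (unliftP ord0 i) => [j ->|-> //].
exact: Er.
Qed.

Let W_open : open W.
Proof.
rewrite openE => u [Wu1 Wu2]; rewrite /interior.
have cd i v : {for v, continuous (fun u : Cn R p.+1 => u 0 i : C^o)}.
  apply: differentiable_continuous.
  exact: differentiable_coord_comp (differentiable_idfun v).
have H1 : \forall v \near u, forall i, `|chart_roots v i - w0 i| < e0.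
  apply: near_forall_ord => i; exact: (cd (lift ord0 i) u _ (near_dist_lt (Wu1 i))).
have H2 : \forall v \near u, forall i, (chart_poly v).[chart_roots v i] != 0.
  apply: near_forall_ord => i; apply: (near_neq0 (f := fun v => (chart_poly v).[chart_roots v i] : C^o)) => //.
  apply: differentiable_continuous; apply: (differentiable_horner (N := n.+1)).
  - by move=> v; rewrite size_chart_poly.
  - exact: chart_poly_differentiable.
  - exact: differentiable_coord_comp (differentiable_idfun u).
by apply: filterS2 H1 H2 => v; split.
Qed.

Let U : set (Conf R n kappa) := chart_poly @` W.

Let phi (y : Conf R n kappa) : Cn R p.+1 := xget 0 [set u | W u /\ chart_poly u = y].

Let phiP y u : W u -> chart_poly u = y -> phi y = u.
Proof.
move=> Wu E; rewrite /phi; case: xgetP => [u' -> [Wu' E']|/(_ u)/= H]; last by case: H.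
by apply: chart_poly_inj => //; rewrite E' E.
Qed.

Let row_of (w : 'I_p -> C) (c : C) : Cn R p.+1 :=
  \row_i (if unlift ord0 i is Some j then w j else c).

Let row_of_roots w c : chart_roots (row_of w c) = w.
Proof. by apply/funext => i; rewrite /chart_roots mxE liftK. Qed.

Let row_of0 w c : row_of w c 0 ord0 = c.
Proof. by rewrite mxE unlift_none. Qed.

(** [crit_near] labels the critical points of a nearby [y] compatibly with those of [chart_poly u].
    A radius below the slack left in the discs around [w0] keeps the parameters of [y] inside
    [W]. *)
Let phi_near u (e : C) : W u -> 0 < e ->
  \forall v \near crd (chart_poly u : Conf R n kappa),
    forall y : Conf R n kappa, spt (Conf R n kappa) y -> crd y = v ->
    exists w', [/\ forall i, `|w' i - chart_roots u i| < e, crit y w',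
                   W (row_of w' y`_0) & chart_poly (row_of w' y`_0) = y].
Proof.
move=> Wu e_gt0; have Sf := W_Conf Wu.
have F0 i : 0 < e0 - `|chart_roots u i - w0 i| by rewrite subr_gt0; exact: Wu.1.
have [d d0 [de dF]] := gt0_min_seq (enum 'I_p) e_gt0 F0.
have := crit_near (f := chart_poly u) Sf (W_inj Wu) (chart_poly_crit u) d0.
apply: filterS => v H y Sy yv; have [w' iw' [cw' ww']] := H y Sy yv.
have [ym sy [_ _ _]] := (Conf_critP y).1 Sy.
have E : chart_poly (row_of w' y`_0) = y.
  by apply: (chart_poly_of sy cw'); rewrite ?row_of_roots ?row_of0.
exists w'; split=> //.
  by move=> i; apply: lt_le_trans (ww' i) _.
split; rewrite ?E row_of_roots => i.
  apply: le_lt_trans (ler_distD (chart_roots u i) _ _) _.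
  by rewrite -ltrBrDr; apply: lt_le_trans (ww' i) _; apply: dF; rewrite mem_enum.
have [_ _ sq _] := Sy; have /contraL := (squarefreeP (monic_neq0 ym)).1 sq (w' i); apply.
rewrite cw' rootZ ?natn_neq0 // root_mult_poly; last exact: mults_gt0.
by apply/existsP; exists i.
Qed.

Let U_open : open_in U.
Proof.
split=> [_ [u Wu <-]|_ [u Wu <-]]; first exact: W_Conf.
have := phi_near Wu ltr01; apply: filterS => v H y Sy yv.
by have [w' [_ _ Ww' E]] := H y Sy yv; exists (row_of w' y`_0).
Qed.

(** The ambient extension of the [i]-th coordinate is the simple root [rho i] of the [k i]-th
    derivative of [poly_of v], meaningful also off the stratum. On the stratum the [i]-th critical
    point is such a root, so local uniqueness identifies the two. *)
Let holo_phi : @holo R (restr U) (open_model W) phi.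
Proof.
split=> [y [_ [u Wu <-]]|y [_ [u Wu <-]]].
  by rewrite (phiP Wu erefl).
have Sf := W_Conf Wu; have fE := Conf_poly_of (f := chart_poly u) Sf.
have d0 : (chart_poly u)^`() != 0.
  by have [] := monic_deriv_neq0 (chart_poly_monic u) (size_chart_poly u).
have mupf i : mup (chart_roots u i) (chart_poly u)^`() = k i.
  rewrite chart_poly_crit -mul_polyC mupMr ?mup_mult_poly_inj //; first exact: W_inj.
  by rewrite rootE hornerC natn_neq0.
have Hrho i : exists re : (Cn R n -> C^o) * C, 0 < re.2 /\
    \forall v \near crd (chart_poly u : Conf R n kappa), differentiable re.1 v /\
      forall x, `|x - chart_roots u i| < re.2 -> root (poly_of v)^`(k i) x -> x = re.1 v.
  have ki : (k i).-1.+1 = k i by rewrite prednK // mults_gt0.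
  have kn : (k i <= n)%N by rewrite ltnW // mults_lt.
  suff [r [e [e_gt0 H]]] : exists (r : Cn R n -> C^o) (e : C), 0 < e /\
      \forall v \near crd (chart_poly u : Conf R n kappa), differentiable r v /\
      forall x, `|x - chart_roots u i| < e -> root (poly_of v)^`(k i) x -> x = r v.
    by exists (r, e).
  apply: (simple_root_section (P := fun v => (poly_of v)^`(k i)) (N := (n - k i)%N)
    (l := (n ^_ (k i))%:R)).
  - exact: size_derivn_poly_of.
  - by move=> v; exact: lead_derivn_poly_of.
  - exact: ffact_neq0.
  - by move=> v; apply: derivn_differentiable; exact: poly_of_differentiable.
  - rewrite fE -ki derivSn; apply: root_derivn_mup => //; by rewrite mupf ki.
  - rewrite fE -derivnS derivSn -{1}(mupf i); exact: nroot_derivn_mup.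
pose rho i := (projT1 (cid (Hrho i))).1; pose ei i := (projT1 (cid (Hrho i))).2.
have ei0 i : 0 < ei i by rewrite /ei; case: cid => -[? ?] /= [].
have rhoP i : \forall v \near crd (chart_poly u : Conf R n kappa),
    differentiable (rho i) v /\
    forall x, `|x - chart_roots u i| < ei i -> root (poly_of v)^`(k i) x -> x = rho i v.
  by rewrite /ei /rho; case: cid => -[? ?] /= [].
have [e e_gt0 [_ ee]] := gt0_min_seq (enum 'I_p) ltr01 ei0.
exists (fun v => row_of (fun i => rho i v) (poly_of v)`_0).
apply: filterS2 (near_forall_ord rhoP) (phi_near Wu e_gt0) => v h1 h2; split.
  apply: differentiable_rowP => i; under eq_fun do rewrite mxE.
  case: (unlift ord0 i) => [j|]; first by case: (h1 j).
  exact: poly_of_differentiable.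
move=> {}y [Sy _] yv; have [w' [ww' cw' Ww' E]] := h2 y Sy yv.
have pv : poly_of v = y by rewrite -yv; exact: Conf_poly_of.
rewrite pv /= (phiP Ww' E); congr row_of; apply/funext => i.
apply: (h1 i).2; first by apply: lt_le_trans (ww' i) _; apply: ee; rewrite mem_enum.
have [ym sy _] := (Conf_critP y).1 Sy; have [dy0 _] := monic_deriv_neq0 ym sy.
rewrite pv -[k i](@prednK (k i)) ?mults_gt0 // derivSn.
apply: root_derivn_mup => //; rewrite cw' -mul_polyC mupMr; last by rewrite rootE hornerC natn_neq0.
rewrite mup_mult_poly_inj ?prednK ?mults_gt0 //.
by have := W_inj Ww'; rewrite row_of_roots.
Qed.

Lemma Conf_chart : exists (U : set (Conf R n kappa)) (W : set (Cn R p.+1)) phi,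
  [/\ open_in U, U f0, open W & @biholo R (restr U) (open_model W) phi].
Proof.
exists U, W, phi; split; [exact: U_open| |exact: W_open|].
  have [fm sf _] := (Conf_critP f0).1 Sf0.
  have E : chart_poly (row_of w0 f0`_0) = f0.
    by apply: (chart_poly_of sf cf0); rewrite ?row_of_roots ?row_of0.
  exists (row_of w0 f0`_0) => //; split; rewrite ?E row_of_roots => i.
    by rewrite subrr normr0.
  have [_ _ sq _] := Sf0; have /contraL := (squarefreeP (monic_neq0 fm)).1 sq (w0 i); apply.
  rewrite cf0 rootZ ?natn_neq0 // root_mult_poly; last exact: mults_gt0.
  by apply/existsP; exists i.
apply: (@biholo_sym R (restr U) (open_model W) _ chart_poly); first exact: holo_phi.
- apply: (@holo_entire R (open_model W) (restr U) _
    (fun u => \row_(i < n) (chart_poly u)`_i : Cn R n)) => //.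
    by move=> u Wu; split; [exact: W_Conf|exists u].
  move=> u; apply: differentiable_rowP => i; under eq_fun do rewrite mxE.
  exact: chart_poly_differentiable.
- by move=> _ [_ [u Wu <-]]; rewrite (phiP Wu erefl).
- by move=> u Wu; exact: phiP.
Qed.

End AroundPoint.

Lemma Conf_crd_inj : {in spt (Conf R n kappa) &, injective (@crd R (Conf R n kappa))}.
Proof.
move=> f g; rewrite !inE => Sf Sg fg.
by rewrite -(Conf_poly_of Sf) fg Conf_poly_of.
Qed.

Lemma Conf_manifold : complex_manifold (Conf R n kappa).
Proof.
split; first exact: Conf_crd_inj.
exists p.+1 => f Sf; have [_ _ [w iw [cw _]]] := (Conf_critP f).1 Sf.
have [e e0 [_ es]] := separation ltr01 iw.
exact: (Conf_chart Sf cw e0 es).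
Qed.

End ConfigurationChart.

(** * Properness of the affine action *)

Section ComplexTopology.
Variable R : realType.
Local Notation C := R[i].

Lemma continuous_dist (K : numFieldType) (T : topologicalType) (W : normedModType K)
  (f : T -> W) (x : T) : (forall e : K, 0 < e -> \forall y \near x, `|f x - f y| < e) ->
  {for x, continuous f}.
Proof. by move=> H; apply/cvgrPdist_lt. Qed.

Lemma continuous_norm_pow (V : normedModType C) (f : V -> C^o) (v : V) (m : nat) :
  {for v, continuous f} -> {for v, continuous (fun u => `|f u| ^+ m : C^o)}.
Proof.
move=> cf; apply: (continuous_at_comp (f := fun u => `|f u| : C^o) (F := fun x : C^o => x ^+ m)).
  exact: cvg_norm cf.
exact: differentiable_exp (differentiable_idfun _).
Qed.

Lemma continuous_bigsum (T : topologicalType) (I : Type) (r : seq I)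
  (f : I -> T -> C^o) (x : T) : (forall i, {for x, continuous (f i)}) ->
  {for x, continuous (fun y => \sum_(i <- r) f i y : C^o)}.
Proof.
move=> H; elim: r => [|i r IH].
  rewrite (_ : (fun y => _) = (fun=> 0 : C^o)); first exact: cvg_cst.
  by apply/funext => y; rewrite big_nil.
rewrite (_ : (fun y => _) = (fun y => f i y + \sum_(i <- r) f i y : C^o)).
  exact: (cvgD (H i) IH).
by apply/funext => y; rewrite big_cons.
Qed.

Lemma continuous_Re : continuous (fun z : C^o => complex.Re z : R).
Proof.
move=> z; apply: continuous_dist => e e0.
apply/nbhs_ballP; exists (e%:C)%C; first by rewrite /= ltcR.
move=> y; rewrite -ball_normE /= => zy.
have := le_lt_trans (normc_ge_Re (z - y)) zy.
by rewrite ltcR raddfB.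
Qed.

Lemma continuous_Re_norm (V : normedModType C) (f : V -> C^o) (v : V) :
  {for v, continuous f} -> {for v, continuous (fun u => complex.Re `|f u| : R)}.
Proof.
move=> cf; have c : {for v, continuous (fun u => `|f u| : C^o)} by exact: cvg_norm cf.
exact: (cvg_comp _ _ c (@continuous_Re (`|f v| : C^o))).
Qed.

Lemma continuous_complex : continuous (fun xy : R * R => (xy.1 +i* xy.2)%C : C^o).
Proof.
move=> [x y]; apply: continuous_dist => e /complex_gt0P[d d0 ->].
have d2 : 0 < d / 2 by rewrite divr_gt0.
apply/nbhs_ballP; exists (d / 2) => // -[x' y'] [/=].
rewrite -!ball_normE /= => hx hy.
have -> : (x +i* y)%C - (x' +i* y')%C = ((x - x')%:C + 'i * (y - y')%:C)%C.
  by rewrite [LHS]complexE.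
apply: le_lt_trans (ler_normD _ _) _.
have nR (t : R) : `|(t%:C)%C| = (`|t|%:C)%C.
  by rewrite normc_def /= expr0n /= addr0 sqrtr_sqr.
rewrite normrM !nR (_ : `|'i%C| = 1 :> C); last by rewrite complexiE normCi.
rewrite mul1r -rmorphD /= ltcR [d]splitr; exact: ltrD.
Qed.

(** The box is the continuous image of a product of two real segments. *)
Lemma complex_box_compact (M : R) :
  compact [set z : C^o | `|complex.Re z| <= M /\ `|complex.Im z| <= M].
Proof.
have := continuous_compact (continuous_subspaceT continuous_complex)
  (compact_setX (@segment_compact _ (- M) M) (@segment_compact _ (- M) M)).
congr compact; apply/seteqP; split.
  move=> _ [[x y] [/= hx hy] <-] /=; move: hx hy; rewrite !in_itv /=.
  by rewrite -!ler_norml.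
by case=> x y [/= hx hy]; exists (x, y) => //=; split; rewrite /= in_itv /= -ler_norml.
Qed.

Lemma normc_ge_Im (z : C) : (`|complex.Im z|%:C)%C <= `|z|.
Proof.
have := normc_ge_Re (z * 'i%C); rewrite ReiNIm normrN normrM.
by rewrite (_ : `|'i%C| = 1 :> C) ?mulr1 // complexiE normCi.
Qed.

Lemma norm_ReE (z : C) : `|z| = ((complex.Re `|z|)%:C)%C.
Proof. by rewrite normc_def. Qed.

End ComplexTopology.

(** * The affine action on configurations: holomorphy, properness, stabilisers *)

Section ConfigurationAction.
Variables (R : realType) (n : nat) (kappa : seq nat).
Hypothesis n_ge2 : (2 <= n)%N.
Hypothesis kappaP : is_partition kappa n.-1.
Local Notation C := R[i].
Local Notation Cf := (Conf R n kappa).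

Lemma move_poly_scale m (al : aff R) (c : C) (f : {poly C}) :
  move_poly m al (c *: f) = c *: move_poly m al f.
Proof.
rewrite /move_poly scaler_sumr; apply: eq_bigr => j _.
by rewrite coefZ scalerA mulrA.
Qed.

Lemma Conf_move_rootsE (al : aff R) (f : {poly C}) : al.1 != 0 -> Conf_set n kappa f ->
  move_roots al f = move_poly n al f.
Proof. by move=> a0 [fm sf _ _]; exact: move_rootsE. Qed.

Lemma deriv_move_roots (al : aff R) (f : {poly C}) : al.1 != 0 -> Conf_set n kappa f ->
  (move_roots al f)^`() = move_poly n.-1 al f^`().
Proof.
move=> a0 Cff; rewrite Conf_move_rootsE //; have [_ sf _ _] := Cff.
have nE : n = n.-1.+1 by rewrite prednK // ltnW.
by rewrite {1}nE deriv_move_poly // -nE sf.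
Qed.

Lemma move_roots_Conf (al : aff R) (f : {poly C}) : al.1 != 0 ->
  Conf_set n kappa f -> Conf_set n kappa (move_roots al f).
Proof.
move=> a0 Cff; have := (Conf_critP n_ge2 kappaP f).1 Cff => -[fm sf [w iw [cw fw]]].
apply/(Conf_critP n_ge2 kappaP); split.
- exact: monic_prod_XsubC.
- by rewrite size_prod_XsubC (size_root_seq sf).
exists (fun i => aff_app al (w i)).
  by move=> i j /(can_inj (aff_app_inv a0)) /iw.
split.
  rewrite /crit deriv_move_roots // cw move_poly_scale -(sum_mults kappaP).
  by rewrite move_mult_poly.
move=> i; rewrite Conf_move_rootsE // horner_move_poly ?sf // aff_app_inv //.
by rewrite mulf_neq0 // expf_neq0.
Qed.

Definition move_crd (q : ((C^o * C^o) * Cn R n)%type) : Cn R n :=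
  \row_(i < n) (move_poly n q.1 (poly_of q.2))`_i.

Lemma move_crdE (al : aff R) (f : Cf) : al.1 != 0 -> spt Cf f ->
  crd (move_roots al f : Cf) = move_crd (al, crd f).
Proof.
move=> a0 Sf; rewrite /move_crd (Conf_poly_of Sf) -Conf_move_rootsE //.
Qed.

Lemma move_crd_differentiable q : differentiable move_crd q.
Proof.
have d1 := differentiable_fst_comp (differentiable_idfun q).
have d2 := differentiable_snd_comp (differentiable_idfun q).
apply: differentiable_rowP => i; under eq_fun do rewrite mxE.
suff H : coef_differentiable (fun q : ((C^o * C^o) * Cn R n)%type =>
    move_poly n q.1 (poly_of q.2)) q by exact: H.
apply: coef_differentiable_sum => j; apply: coef_differentiable_scale.
  apply: differentiable_mul; last by apply: differentiable_exp; exact: differentiable_aff_fst.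
  exact: (differentiable_comp (f := fun q : ((C^o * C^o) * Cn R n)%type => q.2)
    (g := fun v => (poly_of v)`_j : C^o) d2 (poly_of_differentiable q.2 j)).
apply: coef_differentiable_exp; apply: coef_differentiable_XsubC.
exact: differentiable_aff_snd.
Qed.

Lemma holo_move_roots :
  @holo R (prodsp (Aff R) Cf) Cf (fun p => move_roots p.1 p.2).
Proof.
apply: (@holo_entire R (prodsp (Aff R) Cf) Cf _ move_crd).
- by move=> [al f] [/= a0 Sf]; exact: move_roots_Conf.
- by move=> [al f] [/= a0 Sf]; exact: move_crdE.
- exact: move_crd_differentiable.
Qed.

(* Translating the centroid of the roots to the origin leaves coefficients that
   an affine map multiplies by powers of its linear part. *)
Definition centroid (v : Cn R n) : C := - (poly_of v)`_n.-1 / n%:R.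

Definition centred (v : Cn R n) : {poly C} := poly_of v \Po ('X + (centroid v)%:P).

Lemma centroid_move (al : aff R) (f : Cf) : al.1 != 0 -> spt Cf f ->
  centroid (crd (move_roots al f : Cf)) = al.1 * centroid (crd f) + al.2.
Proof.
move=> a0 Sf; have n0 := natn_neq0 R n_ge2.
have Sh : spt Cf (move_roots al f) := move_roots_Conf a0 Sf.
rewrite /centroid (Conf_poly_of Sf) (Conf_poly_of Sh).
have [fm sf _ _] := Sf; have sr := size_root_seq sf.
have rn0 : size (root_seq f) != 0%N by rewrite sr -lt0n ltnW.
have -> : f`_n.-1 = - \sum_(z <- root_seq f) z.
  by rewrite -(coefPn_prod_XsubC rn0) -monic_root_seqE // sr.
rewrite /move_roots -(big_map (aff_app al) predT (fun z => 'X - z%:P)).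
have -> : (\prod_(z <- [seq aff_app al z | z <- root_seq f]) ('X - z%:P))`_n.-1 =
    - (al.1 * (\sum_(z <- root_seq f) z) + n%:R * al.2).
  rewrite -sr -[in LHS](size_map (aff_app al)) coefPn_prod_XsubC ?size_map // big_map.
  congr (- _); elim: (root_seq f) => [|z s IH].
    by rewrite !big_nil mulr0 mul0r addr0.
  rewrite !big_cons IH /aff_app /= -natr1; ring.
by field.
Qed.

(** The centroid moves with the roots, so after centring the translation cancels and the action
    becomes [g |-> a^n g(X / a)]. *)
Lemma coef_centred_move (al : aff R) (f : Cf) j : al.1 != 0 -> spt Cf f ->
  (j <= n)%N ->
  (centred (crd (move_roots al f : Cf)))`_j = al.1 ^+ (n - j) * (centred (crd f))`_j.
Proof.
move=> a0 Sf jn; have Sh : spt Cf (move_roots al f) := move_roots_Conf a0 Sf.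
rewrite /centred centroid_move // (Conf_poly_of Sf) (Conf_poly_of Sh).
have [_ sf _ _] := Sf.
rewrite Conf_move_rootsE // move_poly_comp ?sf // comp_polyZ -comp_polyA.
rewrite comp_polyZ comp_polyB comp_polyX comp_polyC.
set t := centroid _.
have -> : al.1^-1 *: ('X + (al.1 * t + al.2)%:P - (al.2)%:P) =
    ('X + t%:P) \Po (al.1^-1 *: 'X).
  rewrite comp_polyD comp_polyX comp_polyC polyCD addrA addrK scalerDr; congr (_ + _).
  by rewrite -mul_polyC -polyCM mulrA mulVf // mul1r.
rewrite comp_polyA coefZ; set g := f \Po _.
have -> : (g \Po (al.1^-1 *: 'X))`_j = g`_j * al.1^-1 ^+ j.
  rewrite comp_polyE coef_sum.
  have [jg|gj] := ltnP j (size g); last first.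
    rewrite nth_default // mul0r big1 // => i _.
    rewrite coefZ exprZn coefZ coefXn gtn_eqF ?mulr0 //.
    exact: leq_trans (ltn_ord i) gj.
  rewrite (bigD1 (Ordinal jg)) //= big1 ?addr0 => [|i ij].
    by rewrite coefZ exprZn coefZ coefXn eqxx mulr1.
  rewrite coefZ exprZn coefZ coefXn; case: eqP => [e|]; rewrite ?mulr0 //.
  by case/eqP: ij; exact: val_inj.
have -> : al.1 ^+ n = al.1 ^+ (n - j) * al.1 ^+ j by rewrite -exprD subnK.
by rewrite exprVn; field; rewrite expf_neq0.
Qed.

(** Since [n >= 2], such a power has a multiple root. This excludes both the vanishing of all lower
    centred coefficients and the degeneration [a = 0]. *)
Lemma Conf_not_power (f : {poly C}) t : Conf_set n kappa f -> f <> ('X - t%:P) ^+ n.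
Proof.
move=> [fm sf sq _] fX; have := (squarefreeP (monic_neq0 fm)).1 sq t.
have n1 : (0 < n.-1)%N by rewrite -ltnS prednK // ltnW.
rewrite fX rootE horner_exp hornerXsubC subrr expr0n gtn_eqF ?eqxx ?(ltnW n_ge2) //= => /(_ isT).
rewrite deriv_exp derivXsubC mul1r rootE hornerMn horner_exp hornerXsubC subrr.
by rewrite expr0n gtn_eqF // mul0rn eqxx.
Qed.

Lemma centred_neq0 (f : Cf) : spt Cf f -> exists2 j, (j < n)%N & (centred (crd f))`_j != 0.
Proof.
move=> Sf; apply: contrapT => nex; have [fm sf sq _] := Sf.
have fE := Conf_poly_of Sf; set t := centroid (crd f).
have gE : centred (crd f) = 'X^n.
  have sX : size ('X + t%:P : {poly C}) = 2 by rewrite size_XaddC.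
  have sg : size (centred (crd f)) = n.+1.
    by rewrite /centred size_comp_poly2 // fE.
  have lg : (centred (crd f))`_n = 1.
    have : lead_coef (centred (crd f)) = 1.
      by rewrite /centred lead_coef_comp ?sX // fE (monicP fm) lead_coefXaddC expr1n mulr1.
    by rewrite lead_coefE sg.
  apply/polyP => j; rewrite coefXn; case: ltngtP => [jn|nj|->] //.
    by apply/eqP; rewrite -[_ == _]negbK; apply/negP => cj; case: nex; exists j.
  by rewrite nth_default // sg.
apply: (@Conf_not_power f t Sf).
have : centred (crd f) \Po ('X - t%:P) = f.
  rewrite /centred fE -comp_polyA comp_polyD comp_polyX comp_polyC subrK.
  exact: comp_polyXr.
by move=> <-; rewrite gE comp_Xn_poly.
Qed.

(** The [j]-th centred coefficient scales by [a^(n - j)], and [n - j] divides [n!]; these exponents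
    make every term homogeneous of the same degree [n!] in [|a|]. *)
Definition size_inv (v : Cn R n) : C :=
  \sum_(j < n) `|(centred v)`_j| ^+ (n`! %/ (n - j)).

Lemma size_inv_move (al : aff R) (f : Cf) : al.1 != 0 -> spt Cf f ->
  size_inv (crd (move_roots al f : Cf)) = `|al.1| ^+ n`! * size_inv (crd f).
Proof.
move=> a0 Sf; rewrite /size_inv mulr_sumr; apply: eq_bigr => j _.
rewrite coef_centred_move ?(ltnW (ltn_ord j)) // normrM exprMn normrX -exprM.
by rewrite mulnC divnK // dvdn_fact // subn_gt0 ltn_ord leq_subr.
Qed.

Lemma size_inv_gt0 (f : Cf) : spt Cf f -> 0 < size_inv (crd f).
Proof.
move=> Sf; have [j jn cj] := centred_neq0 Sf.
rewrite /size_inv (bigD1 (Ordinal jn)) //=; apply: ltr_wpDr.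
  by apply: sumr_ge0 => i _; rewrite exprn_ge0.
by rewrite exprn_gt0 // normr_gt0.
Qed.

Lemma centroid_differentiable v : differentiable (centroid : Cn R n -> C^o) v.
Proof.
apply: differentiable_mul; last exact: differentiable_const.
by apply: differentiable_opp; exact: poly_of_differentiable.
Qed.

Lemma centred_differentiable v : coef_differentiable centred v.
Proof.
rewrite /coef_differentiable => i.
have E u : centred u = \sum_(j < n.+1) (poly_of u)`_j *: ('X + (centroid u)%:P) ^+ j.
  rewrite /centred comp_polyE (big_ord_widen _ (fun j => (poly_of u)`_j *: ('X + (centroid u)%:P) ^+ j) (size_poly_of u)).
  rewrite big_mkcond; apply: eq_bigr => j _; case: ltnP => // sj.
  by rewrite nth_default // scale0r.
under eq_fun do rewrite E.
suff H : coef_differentiable (fun u => \sum_(j < n.+1) (poly_of u)`_j *: ('X + (centroid u)%:P) ^+ j) v.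
  exact: H.
apply: coef_differentiable_sum => j; apply: coef_differentiable_scale.
  exact: poly_of_differentiable.
apply: coef_differentiable_exp.
have := @coef_differentiable_XsubC _ _ (fun u => - centroid u : C^o) v
  (differentiable_opp (centroid_differentiable v)).
by under eq_fun do rewrite polyCN opprK.
Qed.

Lemma size_inv_continuous : continuous (fun v => complex.Re (size_inv v) : R).
Proof.
move=> v; have c : {for v, continuous (size_inv : Cn R n -> C^o)}.
  apply: continuous_bigsum => j; apply: continuous_norm_pow.
  exact: (differentiable_continuous (centred_differentiable v j)).
exact: (cvg_comp _ _ c (@continuous_Re R (size_inv v : C^o))).
Qed.

Let V := (C^o * (Cn R n * Cn R n))%type.

(** The triple is [(a, (f, h))]. By [centroid_move], an affine map with linear part [a] carrying [f]
    to [h] must have this translation part. *)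
Let shift_of (q : V) : C^o := centroid q.2.2 - q.1 * centroid q.2.1.

Let pair_of (q : V) : ((C^o * C^o) * Cn R n)%type := ((q.1, shift_of q), q.2.1).

Let pair_of_differentiable q : differentiable pair_of q.
Proof.
have d1 := differentiable_fst_comp (differentiable_idfun (q : V)).
have d2 := differentiable_snd_comp (differentiable_idfun (q : V)).
have d21 := differentiable_fst_comp d2; have d22 := differentiable_snd_comp d2.
apply: differentiable_pair; last exact: d21.
apply: differentiable_pair; first exact: d1.
apply: differentiable_add.
  exact: (differentiable_comp (f := fun q : V => q.2.2) (g := centroid : _ -> C^o) d22
    (centroid_differentiable _)).
apply: differentiable_opp; apply: differentiable_mul; first exact: d1.
exact: (differentiable_comp (f := fun q : V => q.2.1) (g := centroid : _ -> C^o) d21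
  (centroid_differentiable _)).
Qed.

(** The relation that the move of [f] is [h], imposed on all ambient triples, [a = 0] included, so
    that it is closed. *)
Let Z : set V := [set q | forall i, move_crd (pair_of q) 0 i = q.2.2 0 i].

Let Z_closed : closed Z.
Proof.
have -> : Z = \bigcap_(i in [set: 'I_n]) [set q : V | move_crd (pair_of q) 0 i = q.2.2 0 i].
  by apply/seteqP; split=> [q H i _|q H i]; exact: H.
apply: closed_bigI => i _; rewrite -openC openE => q /= Fq.
have d2 := differentiable_snd_comp (differentiable_snd_comp (differentiable_idfun (q : V))).
have cF : {for q, continuous (fun q : V => move_crd (pair_of q) 0 i - q.2.2 0 i : C^o)}.
  apply: differentiable_continuous; apply: differentiable_add.
    apply: differentiable_coord_comp.
    exact: (differentiable_comp (pair_of_differentiable q) (move_crd_differentiable _)).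
  by apply: differentiable_opp; exact: differentiable_coord_comp.
have := near_neq0 cF; rewrite subr_eq0 => /(_ _)/filterS; apply; last exact/eqP.
by move=> y /=; rewrite subr_eq0 => /eqP.
Qed.

(** At [a = 0] only the top term of [move_poly] survives, and it is [('X - b%:P) ^+ n]. *)
Let linear_part_neq0 a (f h : Cf) : spt Cf h -> Z (a, (crd f, crd h)) -> a != 0.
Proof.
move=> Sh Zq; apply/negP => /eqP a0.
pose b := shift_of (a, (crd f, crd h)); apply: (@Conf_not_power h b Sh).
have mE : move_poly n (a, b) (poly_of (crd f)) = ('X - b%:P) ^+ n.
  rewrite /move_poly big_ord_recr /= big1 ?add0r => [|j _].
    by rewrite subnn expr0 mulr1 lead_poly_of scale1r.
  by rewrite a0 expr0n subn_eq0 leqNgt ltn_ord mulr0 scale0r.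
have [hm sh _ _] := Sh.
have sX : size (('X - b%:P : {poly C}) ^+ n) = n.+1 by rewrite size_exp_XsubC.
have lX : (('X - b%:P : {poly C}) ^+ n)`_n = 1.
  by have /monicP := monic_exp n (monicXsubC b); rewrite lead_coefE sX.
apply/polyP => i; case: (ltngtP i n) => [ni|ni|->].
- have := Zq (Ordinal ni); rewrite mxE mE /= => ->.
  by rewrite mxE.
- by rewrite !nth_default ?sX ?sh.
- by rewrite lX; move/monicP: hm; rewrite lead_coefE sh.
Qed.

(** Either [r <= 1], or [r <= r ^+ d <= M / m]; the sum covers both cases. *)
Lemma linear_part_bound (r m M x y : R) (d : nat) : (0 < d)%N -> 0 <= r -> 0 < m ->
  m <= x -> y <= M -> r ^+ d * x = y -> r <= 1 + M / m.
Proof.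
move=> d0 r0 m0 mx yM E; have rd : r ^+ d * m <= M.
  by apply: le_trans yM; rewrite -E ler_wpM2l // exprn_ge0.
have Mm : 0 <= M / m.
  by rewrite divr_ge0 ?(ltW m0) //; apply: le_trans rd; rewrite mulr_ge0 ?exprn_ge0 // ltW.
have [r1|r1] := lerP r 1; first by rewrite (le_trans r1) // lerDl.
have : r ^+ d <= M / m by rewrite ler_pdivlMr.
have : r <= r ^+ d by rewrite -{1}[r]expr1 ler_weXn2l // ltW.
lra.
Qed.

(** The preimage of [K] is the image under [pair_of] of the triples in [Z] with [a] in a bounded box
    and [(f, h)] in [K]: a closed part of a compact set. *)
Lemma move_roots_proper : @proper_map R (prodsp (Aff R) Cf) (prodsp Cf Cf)
  (fun ax => (ax.2, move_roots ax.1 ax.2)).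
Proof.
move=> K [KS cK]; set P := _ `&` _.
have PS : P `<=` spt (prodsp (Aff R) Cf) by move=> p [].
split=> //; set K1 := [set crd x | x in K] in cK.
have [K1n|nK] := pselect (K1 !=set0); last first.
  suff -> : P = set0 by rewrite image_set0; exact: compact0.
  rewrite -subset0 => p [_ Kp]; case: nK.
  by exists (crd ((p.2, move_roots p.1 p.2) : prodsp Cf Cf)); exists (p.2, move_roots p.1 p.2).
have c1 : continuous (fun q : (Cn R n * Cn R n)%type => complex.Re (size_inv q.1) : R).
  by move=> q; exact: (@continuous_comp (Cn R n * Cn R n)%type (Cn R n) R fst _ q cvg_fst (@size_inv_continuous q.1)).
have c2 : continuous (fun q : (Cn R n * Cn R n)%type => complex.Re (size_inv q.2) : R).
  by move=> q; exact: (@continuous_comp (Cn R n * Cn R n)%type (Cn R n) R snd _ q cvg_snd (@size_inv_continuous q.2)).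
(* The least size [m] of a source and the greatest size [M] of a target over [K]. Since [m] is
   attained at an actual configuration, it is positive, and the scaling law of [size_inv] bounds
   [|a|]. *)
have [q1 q1K m1] := compact_EVT_min K1n cK (continuous_subspaceT c1).
have [q2 q2K m2] := compact_EVT_max K1n cK (continuous_subspaceT c2).
pose m := complex.Re (size_inv q1.1); pose M := complex.Re (size_inv q2.2).
have m0 : 0 < m.
  move: q1K; rewrite inE => -[[f h] /KS[/= Sf _] fh].
  have := size_inv_gt0 Sf; rewrite /m -fh /=.
  by rewrite ltcE /= => /andP[].
pose B := [set z : C^o | `|complex.Re z| <= 1 + M / m /\ `|complex.Im z| <= 1 + M / m].
have cBK : compact ((B `*` K1) `&` Z).
  apply: compact_closedI Z_closed; apply: compact_setX => //; exact: complex_box_compact.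
have -> : [set crd x | x in P] = pair_of @` ((B `*` K1) `&` Z).
  apply/seteqP; split.
    move=> _ [[al f] [[/= a0 Sf] /= Kp] <-].
    have Sh : spt Cf (move_roots al f) := move_roots_Conf a0 Sf.
    have sh : shift_of (al.1, (crd f, crd (move_roots al f : Cf))) = al.2.
      by rewrite /shift_of /= centroid_move // addrC addKr.
    exists (al.1, (crd f, crd (move_roots al f : Cf))); last first.
      by rewrite /pair_of sh /=; case: (al).
    split; last first.
      move=> i; rewrite /pair_of sh /= -[(al.1, al.2)]surjective_pairing.
      by rewrite -(move_crdE a0 Sf).
    have Kfh : K1 (crd f, crd (move_roots al f : Cf)) by exists (f, move_roots al f).
    split=> //=.
    have rB : complex.Re `|al.1| <= 1 + M / m.
      apply: (@linear_part_bound _ m M (complex.Re (size_inv (crd f)))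
        (complex.Re (size_inv (crd (move_roots al f : Cf)))) n`!).
      - exact: fact_gt0.
      - by have := normr_ge0 al.1; rewrite lecE /= => /andP[].
      - exact: m0.
      - by have := m1 (crd f, crd (move_roots al f : Cf)); apply; rewrite inE.
      - by have := m2 (crd f, crd (move_roots al f : Cf)); apply; rewrite inE.
      rewrite size_inv_move // norm_ReE -rmorphXn /=; set s := size_inv _.
      by case: s => u v /=; rewrite mul0r subr0.
    split; apply: le_trans rB; rewrite -lecR -norm_ReE; [exact: normc_ge_Re|exact: normc_ge_Im].
  (* Conversely, a triple in [Z] over [K] has [a != 0], so it defines an affine map, and equality of
     coordinates shows that it carries [f] to [h]. *)
  move=> _ [[a [_ _]] [[/= _ [[f h] Kfh [<- <-]]] Zq] <-].
  have [/= Sf Sh] := KS _ Kfh; have a0 := linear_part_neq0 Sh Zq.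
  exists ((a, shift_of (a, (crd f, crd h))), f) => //; split=> //=.
  suff -> : move_roots (a, shift_of (a, (crd f, crd h))) f = h by [].
  apply: (@Conf_crd_inj R n kappa); rewrite ?inE //.
    exact: move_roots_Conf.
  rewrite move_crdE //; apply/rowP => i; exact: Zq.
apply: continuous_compact cBK; apply: continuous_subspaceT => q.
exact: (differentiable_continuous (pair_of_differentiable q)).
Qed.

(** A nonzero centred coefficient of index [j < n] forces [a^(n - j) = 1], and fixing the centroid
    [t] forces [b = t - a t]. *)
Lemma move_roots_isotropy (f : Cf) : spt Cf f ->
  finite_set [set al : Aff R | al.1 != 0 /\ move_roots al f = f].
Proof.
move=> Sf; have [j jn cj] := centred_neq0 Sf; set t := centroid (crd f).
pose s := root_seq ('X^(n - j) - 1 : {poly C}).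
apply: (@sub_finite_set _ _ ((fun a : C => (a, t - a * t) : aff R) @` [set` s])).
  move=> al [a0 E]; have := centroid_move a0 Sf; rewrite E -/t => tE.
  have := coef_centred_move a0 Sf (ltnW jn); rewrite E => /eqP.
  rewrite -subr_eq0 -{1}[_`_j]mul1r -mulrBl mulf_eq0 (negPf cj) orbF subr_eq0 => /eqP aE.
  exists al.1 => /=; last by rewrite {1}tE addrC addKr; case: (al).
  have p0 : ('X^(n - j) - 1 : {poly C}) != 0.
    by rewrite -size_poly_eq0 size_XnsubC ?subn_gt0.
  rewrite /s /= mem_root_seq // rootE hornerD hornerN hornerC hornerXn -aE subrr.
  exact: eqxx.
by apply: finite_image; exact: finite_seq.
Qed.

End ConfigurationAction.

(** * Logarithmic derivatives *)

Section Liouville.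
Variable R : realType.
Local Notation C := R[i].

Definition entire (h : C -> C) := forall a, exists2 c, laurent_at h a 0 c & h a = c 0%N.

Lemma near_of_dnbhs (a : C) (A : C -> Prop) : A a -> (\forall z \near (a : C^o)^', A z) ->
  \forall z \near (a : C^o), A z.
Proof.
move=> Aa /near_dnbhsP[e e0 H]; apply/nbhs_ballP; exists e => // z.
rewrite -ball_normE /= distrC; have [->//|za] := eqVneq z a; exact: H.
Qed.

Lemma entire_continuous h : entire h -> forall a, {for a, continuous (h : C^o -> C^o)}.
Proof.
move=> eh a; have [c lc ha] := eh a; apply: continuous_dist => e e0.
apply: (@near_of_dnbhs a (fun z => `|h a - h z| < e)); first by rewrite subrr normr0.
by apply: filterS (laurent_cvg lc e0) => z; rewrite ha distrC.
Qed.

Lemma laurent_constant h a c : laurent_at h a 0 c -> (forall j, c j.+1 = 0) ->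
  \forall z \near (a : C^o)^', h z = c 0%N.
Proof.
move=> lc c0; apply: filterS lc => z cz.
have cc : series (fun j : nat => c j * (z - a) ^ (0 + j%:Z) : C^o) @ \oo --> (c 0%N : C^o).
  apply: cvg_near_cst; exists 1%N => // -[//|N] _ /=.
  rewrite /series /= big_nat_recl // big1 ?addr0 => [|j _]; last by rewrite c0 mul0r.
  by rewrite expr0z mulr1.
exact: (cvg_unique (@norm_hausdorff _ C^o) cz cc).
Qed.

(* If the first nonzero coefficient after c_0 is c_m, moving from a in the
   direction u with c_m u^m = c_0 increases |h|. *)
Lemma entire_local_max h a : entire h -> h a != 0 ->
  (forall z, `|h z| <= `|h a|) -> \forall z \near (a : C^o), h z = h a.
Proof.
move=> eh ha0 hmax; have [c lc ha] := eh a.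
apply: near_of_dnbhs => //; rewrite ha; apply: (laurent_constant lc).
apply: contrapT => nc.
have exm : exists m, c m.+1 != 0.
  apply: contrapT => nm; apply: nc => j; apply/eqP; rewrite -[_ == _]negbK.
  by apply/negP => cj; apply: nm; exists j.
case: (ex_minnP exm) => m0; set m := m0.+1 => cm minm.
have [B B0 hB] := laurent_asymptotics m.+1 lc.
pose u := m.-root (c 0%N / c m).
have um : u ^+ m = c 0%N / c m by rewrite rootCK.
have c00 : c 0%N != 0 by rewrite -ha.
have u0 : u != 0.
  by have := mulf_neq0 c00 (invr_neq0 cm); rewrite -um expf_eq0.
have [e e0 he] := (near_dnbhsP a _).1 hB.
suff : c 0%N = 0 by move/eqP: c00.
(* The auxiliary variable [x] enters only through its modulus [s], the step length in [a + s u].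
   Maximality gives [s^m |c_0| <= B (s |u|)^(m+1)], and dividing by [s^m] bounds [|c_0|] by a
   multiple of [s]. *)
apply: (@near_norm_le_eq0 R 0 _ (B * `|u| ^+ m.+1)).
  by rewrite mulr_ge0 ?exprn_ge0.
have d0 : 0 < e / `|u| by rewrite divr_gt0 // normr_gt0.
apply: filterS (near_dnbhs_lt 0 d0) => x; rewrite subr0 => -[x0 xe].
set s := `|x|; have s0 : 0 < s by rewrite normr_gt0.
have tE : a + s * u - a = s * u by rewrite addrC addKr.
have sn : `|s * u| = s * `|u| by rewrite normrM normr_id.
have ta : a + s * u != a by rewrite -subr_eq0 tE mulf_neq0 // gt_eqF.
have := he _ ta; rewrite tE sn -ltr_pdivlMr ?normr_gt0 // => /(_ xe).
rewrite big_nat_recl //= big_nat_recr //= big1_seq ?add0r; last first.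
  move=> j /andP[_]; rewrite mem_index_iota => /andP[_ jm].
  have [-> |cj] := eqVneq (c j.+1) 0; first by rewrite mul0r.
  by have := minm j cj; rewrite leqNgt jm.
rewrite expr0z mulr1 -!exprnP exprMn um.
have -> : c m * (s ^+ m * (c 0%N / c m)) = s ^+ m * c 0%N by field.
rewrite normrX sn exprMn => hle.
have h1 : `|c 0%N| + s ^+ m * `|c 0%N| <= `|c 0%N| + B * (s ^+ m.+1 * `|u| ^+ m.+1).
  have -> : `|c 0%N| + s ^+ m * `|c 0%N| = `|c 0%N + s ^+ m * c 0%N|.
    have -> : c 0%N + s ^+ m * c 0%N = (1 + s ^+ m) * c 0%N by ring.
    rewrite normrM ger0_norm; first by ring.
    by rewrite addr_ge0 ?exprn_ge0 // ltW.
  rewrite -[c 0%N + _](subKr (h (a + s * u))).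
  apply: le_trans (ler_normB _ _) _; apply: lerD => //.
  by have := hmax (a + s * u); rewrite ha.
move: h1; rewrite lerD2l exprS => h1.
have sm : 0 < s ^+ m by rewrite exprn_gt0.
rewrite -(ler_pM2l sm); apply: le_trans h1 _.
by rewrite [X in X <= _](_ : _ = s ^+ m * (B * `|u| ^+ m.+1 * s)) //; ring.
Qed.

(** If [h z0 != 0], decay at infinity confines the maximum of [|h|] to a compact box. The maximum
    points in it form a compact set, and at the one with greatest real part local constancy produces
    another maximum point further to the right. This replaces a connectedness argument. *)
Lemma liouville0 h : entire h ->
  (forall e : C, 0 < e -> exists rho : R, forall z, (rho%:C)%C < `|z| -> `|h z| < e) ->
  forall z, h z = 0.
Proof.
move=> eh h_infty z0; apply/eqP; rewrite -[_ == _]negbK; apply/negP => hz0.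
have e0 : 0 < `|h z0| by rewrite normr_gt0.
have [rho hrho] := h_infty _ e0.
pose D := [set z : C^o | `|complex.Re z| <= rho /\ `|complex.Im z| <= rho].
have cD : compact D := @complex_box_compact R rho.
have nD z : ~ D z -> `|h z| < `|h z0|.
  move=> nDz; apply: hrho; have [Rz|Rz] := lerP `|complex.Re z| rho; last first.
    by apply: lt_le_trans (normc_ge_Re z); rewrite ltcR.
  have [Iz|Iz] := lerP `|complex.Im z| rho; first by case: nDz.
  by apply: lt_le_trans (normc_ge_Im z); rewrite ltcR.
have Dz0 : D z0 by apply: contrapT => /nD; rewrite ltxx.
pose F (z : C^o) : R := complex.Re `|h z|.
have leF z z' : (`|h z| <= `|h z'|) = (F z <= F z').
  by rewrite (norm_ReE (h z)) (norm_ReE (h z')) lecR.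
have cF : continuous F.
  move=> z; have cz := @entire_continuous h eh z.
  exact: (@continuous_Re_norm R C^o h z cz).
have [a1 a1D max1] : exists2 a, a \in D & forall t, t \in D -> F t <= F a.
  by apply: compact_EVT_max => //; [exists z0|exact: continuous_subspaceT].
rewrite inE in a1D.
have z0a1 : `|h z0| <= `|h a1| by rewrite leF; apply: max1; rewrite inE.
have gmax z : `|h z| <= `|h a1|.
  have [Dz|/nD hz] := pselect (D z); first by rewrite leF; apply: max1; rewrite inE.
  by apply: le_trans (ltW hz) _.
pose S := D `&` [set z | F a1 <= F z].
have cS : compact S.
  apply: compact_closedI => //.
  rewrite (_ : [set z | _] = F @^-1` [set x | F a1 <= x]) //.
  by apply: preimage_closed; [move=> z _; exact: cF|exact: closed_ge].
have [a2 a2S max2] : exists2 a, a \in S &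
    forall t, t \in S -> complex.Re t <= complex.Re a.
  apply: (@compact_EVT_max _ R (fun z : C^o => complex.Re z) S) => //.
    exists a1; split; [exact: a1D|exact: lexx].
  apply: continuous_subspaceT; exact: continuous_Re.
move: a2S; rewrite inE => -[a2D a2F].
have hmax z : `|h z| <= `|h a2| by apply: le_trans (gmax z) _; rewrite leF.
have ha2 : h a2 != 0 by rewrite -normr_gt0; apply: lt_le_trans e0 (hmax z0).
have := entire_local_max eh ha2 hmax.
move=> /nbhs_ballP[d /= /complex_gt0P[x x0 ->] hd].
pose z := a2 + ((x / 2)%:C)%C.
have x2 : 0 < x / 2 by rewrite divr_gt0.
have hz : h z = h a2.
  apply: hd; rewrite -ball_normE /= /z opprD addNKr normrN.
  rewrite normc_def /= expr0n /= addr0 sqrtr_sqr ltcR gtr0_norm //.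
  by rewrite ltr_pdivrMr // ltr_pMr // ltr1n.
have Sz : z \in S.
  rewrite inE; split; last by rewrite /= /F hz.
  apply: contrapT => /nD; rewrite hz => /lt_le_trans /(_ (hmax z0)).
  by rewrite ltxx.
by have := max2 z Sz; rewrite /z raddfD /= gerDl leNgt x2.
Qed.

End Liouville.

(** * Local expansions and divisors of the logarithmic derivative *)

Section LogarithmicDerivative.
Variable R : realType.
Local Notation C := R[i].

Lemma has_order_dlog (f : {poly C}) a : f != 0 -> f^`() != 0 ->
  has_order (dlog f) a ((mup a f^`())%:Z - (mup a f)%:Z).
Proof. by move=> f0 d0; exact: has_order_ratio. Qed.

Lemma mup_simple_root (f : {poly C}) a : f != 0 -> root f a -> ~~ root f^`() a ->
  mup a f = 1%N.
Proof.
move=> f0 fa dfa; apply/eqP; rewrite eqn_leq.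
rewrite -XsubC_dvd // dvdp_XsubCl fa andbT leqNgt; apply/negP => lt.
by move/negP: dfa; apply; rewrite -derivn1; exact: root_derivn_mup.
Qed.

(** With [f = q (X - a)] one has [q(a) = f'(a)], so [f'/f] is [f'/q] divided by [X - a], and [f'/q]
    takes the value 1 at [a]. *)
Lemma dlog_simple_pole (f : {poly C}) a : f != 0 -> root f a -> ~~ root f^`() a ->
  exists2 c, c 0%N = 1 & laurent_at (dlog f) a (- 1) c.
Proof.
move=> f0 fa dfa; have [q fE] := factor_theorem _ _ fa.
have dq : f^`().[a] = q.[a].
  rewrite fE derivM derivXsubC mulr1 hornerD hornerM hornerXsubC subrr mulr0.
  by rewrite add0r.
have qa : q.[a] != 0 by rewrite -dq.
have [c c0 lc] := laurent_ratio f^`() qa.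
exists c; first by rewrite c0 dq divff.
have := laurent_mulz (- 1) lc; rewrite add0r; apply: laurent_ext.
apply: filterS (near_dnbhs_lt a ltr01) => z _.
by rewrite /dlog {3}fE hornerM hornerXsubC invfM mulrA exprN1.
Qed.

Lemma laurent_neg_order g (a : C) (m : nat) : has_order g a (- m.+1%:Z) ->
  ~ exists c, laurent_at g a 0 c.
Proof.
move=> [c c0 lc] [d ld]; have ld' : laurent_at g a (- m.+1%:Z + m.+1%:Z) d.
  by rewrite addNr.
have := laurent_unique lc (laurent_shiftn ld') 0%N => /= E.
by rewrite E eqxx in c0.
Qed.

Lemma dlog_normalized (f : {poly C}) : f != 0 ->
  (forall a, root f a -> ~~ root f^`() a) -> normalized (dlog f).
Proof.
move=> f0 sf a; have [fa|fa] := boolP (root f a).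
  have [c c0 lc] := dlog_simple_pole f0 fa (sf a fa).
  have ho : has_order (dlog f) a (- 1%:Z) by exists c; rewrite ?c0 ?oner_neq0.
  split=> [d ld|_]; first by case: (laurent_neg_order ho); exists d.
  by rewrite /dlog (eqP fa) invr0 mulr0.
have [c c0 lc] := laurent_ratio f^`() fa.
split=> [d ld|]; first by rewrite -(laurent_unique lc ld 0%N) c0.
by case; exists c.
Qed.

(** The polynomial [w^m p(1/w)], which brings behaviour at infinity to [w = 0]. *)
Definition reversal (m : nat) (p : {poly C}) : {poly C} := \poly_(i < m.+1) p`_(m - i).

Lemma horner_reversal (m : nat) (p : {poly C}) (w : C) : w != 0 ->
  (size p <= m.+1)%N -> p.[w^-1] = (reversal m p).[w] / w ^+ m.
Proof.
move=> w0 sp; rewrite (horner_coef_wide _ sp) horner_poly mulr_suml.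
rewrite (reindex_inj rev_ord_inj) /=; apply: eq_bigr => i _.
rewrite subSS exprVn -mulrA; congr (_ * _).
have im : (i <= m)%N by rewrite -ltnS.
have -> : w ^+ m = w ^+ (m - i) * w ^+ i by rewrite -exprD subnK.
by field; rewrite !expf_neq0.
Qed.

(** Reversing [f'] in degree [n - 1] and [f] in degree [n], the powers of [w] combine with [w^2] to
    leave one factor [1/w]. The constant terms are the leading coefficients [n] and 1. *)
Lemma dlog_infty (f : {poly C}) (n : nat) : f \is monic -> size f = n.+1 -> (0 < n)%N ->
  exists2 c, c 0%N = - n%:R & laurent_at (chart_infty (dlog f)) 0 (- 1) c.
Proof.
move=> fm sf n0; have nE : n = n.-1.+1 by rewrite prednK.
have sd : (size f^`() <= n.-1.+1)%N.
  by apply: leq_trans (size_poly _ _) _; rewrite sf -nE.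
set p := - reversal n.-1 f^`(); set q := reversal n f.
have fn : f`_n = 1 by move/monicP: fm; rewrite lead_coefE sf.
have q0 : q.[0] = 1 by rewrite horner_coef0 coef_poly /= subn0.
have p0 : p.[0] = - n%:R.
  by rewrite hornerN horner_coef0 coef_poly /= subn0 coef_deriv -nE fn.
have [|c c0 lc] := @laurent_ratio R p q 0; first by rewrite q0 oner_neq0.
exists c; first by rewrite c0 p0 q0 divr1.
have := laurent_mulz (- 1) lc; rewrite add0r; apply: laurent_ext.
apply: filterS (near_dnbhs_lt 0 ltr01) => w [w0 _].
rewrite /chart_infty /dlog (horner_reversal w0 sd) (horner_reversal w0 (m := n)) ?sf //.
have wn : w ^+ n = w ^+ n.-1 * w by rewrite {1}nE exprSr.
have X0 : w ^+ n.-1 != 0 by rewrite expf_neq0.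
rewrite subr0 exprN1 hornerN -/q wn invf_div.
move: (w ^+ n.-1) X0 (q.[w]^-1) => X X0 y; field; exact/andP.
Qed.

Lemma divisor_orderE g (a : C) (k : int) : has_order g a k -> divisor_order g a = k.
Proof. by move=> ho; apply: xget_unique => // l hl; exact: has_order_unique hl ho. Qed.

Lemma fsbig_mup (f : {poly C}) : f \is monic ->
  \big[*%R/1]_(a \in [set: C]) ('X - a%:P) ^+ mup a f = f.
Proof.
move=> fm; have f0 := monic_neq0 fm.
rewrite (@fsbigE _ _ _ _ _ (undup (root_seq f))) ?undup_uniq //; last first.
  by move=> a _; rewrite mem_undup mem_root_seq // => /mupNroot ->.
transitivity (\prod_(a <- undup (root_seq f)) ('X - a%:P) ^+ mup a f).
  by apply: eq_bigl => a; rewrite in_setT.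
rewrite [RHS](monic_root_seqE fm).
apply: etrans _ (big_undup_iterop_count _ (root_seq f) predT (fun a => 'X - a%:P)).
apply: eq_bigr => a _.
by rewrite count_root_seq.
Qed.

(** The order is the difference of the multiplicities of [f'] and [f]; as these have no common root,
    its positive and negative parts recover the two multiplicities. *)
Lemma dlog_divisors (f : {poly C}) : f \is monic -> f^`() != 0 ->
  (forall a, root f a -> ~~ root f^`() a) ->
  zero_divisor (dlog f) = (lead_coef f^`())^-1 *: f^`() /\ pole_divisor (dlog f) = f.
Proof.
move=> fm d0 sf; have f0 := monic_neq0 fm.
have oE a : divisor_order (dlog f) a = (mup a f^`())%:Z - (mup a f)%:Z.
  exact/divisor_orderE/has_order_dlog.
have l0 : (lead_coef f^`())^-1 != 0 by rewrite invr_eq0 lead_coef_eq0.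
have dm : (lead_coef f^`())^-1 *: f^`() \is monic.
  by rewrite monicE lead_coefZ mulVf // lead_coef_eq0.
have cases a : (mup a f = 0)%N \/ (mup a f^`() = 0)%N.
  have [fa|/mupNroot ->] := boolP (root f a); last by left.
  by right; apply: mupNroot; exact: sf.
split.
  rewrite -[RHS]fsbig_mup //; apply: eq_fsbigr => a _; congr (_ ^+ _).
  rewrite -mul_polyC mupMr ?rootE ?hornerC // oE.
  by case: (cases a) => ->; lia.
rewrite -[RHS]fsbig_mup //; apply: eq_fsbigr => a _; congr (_ ^+ _).
by rewrite oE; case: (cases a) => ->; lia.
Qed.

End LogarithmicDerivative.

(** * The equivariant correspondence between configurations and differentials *)

Section ConfigurationsAndDifferentials.
Variables (R : realType) (n : nat) (kappa : seq nat).
Hypothesis n_ge2 : (2 <= n)%N.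
Hypothesis kappaP : is_partition kappa n.-1.
Local Notation C := R[i].
Local Notation Cf := (Conf R n kappa).
Local Notation p := (size kappa).

Lemma Conf_simple_roots (f : {poly C}) : Conf_set n kappa f ->
  forall a, root f a -> ~~ root f^`() a.
Proof. by move=> [fm _ sq _]; exact: (squarefreeP (monic_neq0 fm)).1 sq. Qed.

Lemma uniq_root_seq (f : {poly C}) : f != 0 -> (forall a, root f a -> ~~ root f^`() a) ->
  uniq (root_seq f).
Proof.
move=> f0 sf; apply: count_mem_uniq => a; rewrite count_root_seq // mem_root_seq //.
have [fa|/mupNroot ->//] := boolP (root f a).
by rewrite (mup_simple_root f0 fa (sf a fa)).
Qed.

Lemma dlog_MD (f : {poly C}) : Conf_set n kappa f -> MD_set n kappa (dlog f).
Proof.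
move=> Sf; have sf1 := Conf_simple_roots Sf.
have [fm sf [w iw [cw fw]]] := (Conf_critP n_ge2 kappaP f).1 Sf.
have f0 := monic_neq0 fm; have [d0 dl] := monic_deriv_neq0 n_ge2 fm sf.
have ho a := has_order_dlog a f0 d0.
have [cI cI0 lI] := dlog_infty fm sf (ltnW n_ge2).
have rd a : root f^`() a = [exists i, w i == a].
  by rewrite cw rootZ ?natn_neq0 // root_mult_poly //; exact: (mults_gt0 kappaP).
have mupd i : mup (w i) f^`() = mults i.
  by rewrite cw -mul_polyC mupMr ?mup_mult_poly_inj // rootE hornerC natn_neq0.
split.
  split; last exact: dlog_normalized.
    by move=> a; have [c _ lc] := ho a; exists ((mup a f^`())%:Z - (mup a f)%:Z), c.
  by exists (- 1), cI.
exists [seq w i | i <- enum 'I_p], (root_seq f); split.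
- rewrite cat_uniq (map_inj_uniq iw) enum_uniq uniq_root_seq // andbT /=.
  apply/hasPn => a; rewrite mem_root_seq // => fa; apply/negP => /mapP[i _ ai].
  by have := fw i; rewrite -ai (eqP fa) eqxx.
- by rewrite size_map size_enum_ord (size_root_seq sf).
- move=> i ip; rewrite (nth_map (Ordinal ip)) ?size_enum_ord //.
  rewrite (nth_ord_enum _ (Ordinal ip)).
  have := ho (w (Ordinal ip)); rewrite mupd [mup _ f]mupNroot ?subr0 //.
  by rewrite rootE fw.
- move=> a; rewrite mem_root_seq // => fa.
  have [c c0 lc] := dlog_simple_pole f0 fa (sf1 a fa).
  by split; [exists c; rewrite ?c0 ?oner_neq0|exists 0%N, c].
split; last first.
  by split; [exists cI; rewrite ?cI0 ?oppr_eq0 ?natn_neq0|exists 0%N, cI].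
move=> a; rewrite mem_cat negb_or mem_root_seq // => /andP[aw fa].
have := ho a; rewrite [mup a f]mupNroot // mupNroot ?subr0 //.
rewrite rd; apply/existsP => -[i /eqP wi]; move/negP: aw; apply.
by apply/mapP; exists i; rewrite ?mem_enum.
Qed.

Lemma near_notin (a : C) (s : seq C) : \forall z \near (a : C^o)^', z \notin s.
Proof.
elim: s => [|x s IH]; first by apply: filterS (near_dnbhs_lt a ltr01).
have near_x : \forall z \near (a : C^o)^', z != x.
  have [->|ax] := eqVneq a x; first by apply: filterS (near_dnbhs_lt x ltr01) => z [].
  have d0 : 0 < `|x - a| by rewrite normr_gt0 subr_eq0 eq_sym.
  apply: filterS (near_dnbhs_lt a d0) => z [_]; apply: contraTneq => ->.
  by rewrite ltxx.
by apply: filterS2 near_x IH => z zx zs; rewrite inE negb_or zx.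
Qed.

Lemma laurent_removable g (a : C) c : c 0%N = 0 -> laurent_at g a (- 1) c ->
  laurent_at g a 0 (fun j => c j.+1).
Proof.
move=> c0 lc; rewrite -[0](addNr 1); apply/laurent_shift.
move: lc; congr laurent_at; apply/funext => -[|j] //.
Qed.

Lemma laurent_nonneg_order g (a : C) (m : nat) : has_order g a m%:Z ->
  exists c, laurent_at g a 0 c.
Proof.
by move=> [c _ lc]; eexists; apply: laurent_shiftn; rewrite add0r; exact: lc.
Qed.

(* The difference of two normalized differentials with the same simple polar
   parts extends to an entire function that vanishes at infinity. *)
Lemma normalized_eq (g1 g2 : C -> C) (s : seq C) : normalized g1 -> normalized g2 ->
  (forall a, a \in s -> exists c1 c2, [/\ c1 0%N = c2 0%N, c1 0%N != 0,
     laurent_at g1 a (- 1) c1 & laurent_at g2 a (- 1) c2]) ->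
  (forall a, a \notin s -> exists c1 c2, laurent_at g1 a 0 c1 /\ laurent_at g2 a 0 c2) ->
  (exists c1 c2, [/\ c1 0%N = c2 0%N, laurent_at (chart_infty g1) 0 (- 1) c1
     & laurent_at (chart_infty g2) 0 (- 1) c2]) ->
  g1 = g2.
Proof.
move=> n1 n2 polar regular [cI1 [cI2 [cI12 lI1 lI2]]].
pose D z := g1 z - g2 z.
have lD a : exists c, laurent_at D a 0 c.
  have [/polar [c1 [c2 [e _ l1 l2]]]|/regular [c1 [c2 [l1 l2]]]] := boolP (a \in s).
    exists (fun j => c1 j.+1 - c2 j.+1).
    apply: (@laurent_removable _ _ (fun j => c1 j - c2 j)); first by rewrite e subrr.
    exact: laurent_sub.
  by exists (fun j => c1 j - c2 j); exact: laurent_sub.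
pose cD a := projT1 (cid (lD a)); pose h a := cD a 0%N.
have cDP a : laurent_at D a 0 (cD a) by rewrite /cD; case: cid.
have hD a : a \notin s -> h a = D a.
  move=> /regular [c1 [c2 [l1 l2]]]; rewrite /h.
  rewrite (laurent_unique (cDP a) (laurent_sub l1 l2)) /D.
  by rewrite ((n1 a).1 _ l1) ((n2 a).1 _ l2).
have eh : entire h.
  move=> a; exists (cD a) => //; apply: laurent_ext (cDP a).
  by apply: filterS (near_notin a s) => z zs; rewrite hD.
have h0 : forall z, h z = 0.
  apply: liouville0 => // e e0.
  (* Equal residues at infinity cancel the remaining pole, and the factor [w^2] of the chart then
     gives [D z = O(|z|^-2)]. The radius is also kept at most 1, so that [|z|^-2 <= |z|^-1]. *)
  have lI : laurent_at (chart_infty D) 0 0 (fun j => cI1 j.+1 - cI2 j.+1).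
    apply: (@laurent_removable _ _ (fun j => cI1 j - cI2 j)); first by rewrite cI12 subrr.
    have := laurent_sub lI1 lI2; apply: laurent_ext.
    apply: filterS (near_dnbhs_lt 0 ltr01) => w _.
    by rewrite /chart_infty /D -mulrBl -opprD.
  have [B B0 hB] := laurent_asymptotics 0 lI.
  have B1 : 0 < B + 1 by rewrite ltr_wpDl.
  have [d1 d10 [d1e d11]] := gt0_min (divr_gt0 e0 B1) (@ltr01 C).
  have [_ /complex_gt0P[d d0 ->] hd] := (near_dnbhsP 0 _).1
    (filterI (filterI hB (near_dnbhs_lt 0 d10)) (near_notin 0 [seq x^-1 | x <- s])).
  exists d^-1 => z dz.
  have z0 : z != 0.
    apply: contraTneq dz => ->; rewrite normr0 ltcE /= negb_and -leNgt.
    by rewrite invr_ge0 (ltW d0) orbT.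
  have wd : `|z^-1 - 0| < (d%:C)%C.
    rewrite subr0 normfV; have -> : (d%:C)%C = ((d^-1)%:C)%C^-1.
      by rewrite -fmorphV invrK.
    have dp : 0 < ((d^-1)%:C)%C by rewrite ltcR invr_gt0.
    by rewrite ltf_pV2 ?posrE ?normr_gt0 //.
  have := hd z^-1; rewrite invr_eq0 z0 => /(_ isT wd) [[hz [_ zd1]] zs].
  have zs' : z \notin s by apply: contra zs => zs; apply/mapP; exists z.
  rewrite hD //; move: hz; rewrite big_geq // subr0 addr0 expr0z normr1 mulr1 => hz.
  have nz : `|z| ^+ 2 != 0 by rewrite expf_neq0 // normr_eq0.
  have -> : `|D z| = `|chart_infty D z^-1| * `|z|^-1 ^+ 2.
    rewrite /chart_infty invrK normrM normrN normfV normrX normfV exprVn invrK.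
    by rewrite mulfK.
  rewrite subr0 normfV in zd1; have z1 := ltW (lt_le_trans zd1 d11).
  have iz0 : 0 <= `|z|^-1 by rewrite invr_ge0.
  apply: (@le_lt_trans _ _ ((B + 1) * `|z|^-1 ^+ 2)).
    by rewrite ler_wpM2r ?exprn_ge0 //; apply: le_trans hz _; rewrite lerDl.
  rewrite mulrC -ltr_pdivlMr //; apply: lt_le_trans d1e; apply: le_lt_trans zd1.
  by rewrite expr2 ler_piMl.
(* [h] only controls the values outside [s]. At a point of [s] both functions have a genuine pole,
   and normalization makes both vanish there. *)
apply/funext => a; have [as_|as_] := boolP (a \in s); last first.
  by apply/eqP; rewrite -subr_eq0; have := h0 a; rewrite hD // /D => ->.
have [c1 [c2 [e c10 l1 l2]]] := polar a as_.
have c20 : c2 0%N != 0 by rewrite -e.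
have ho1 : has_order g1 a (- 1%:Z) := ex_intro2 _ _ c1 c10 l1.
have ho2 : has_order g2 a (- 1%:Z) := ex_intro2 _ _ c2 c20 l2.
have g1a := (n1 a).2 (laurent_neg_order (m := 0) ho1).
have g2a := (n2 a).2 (laurent_neg_order (m := 0) ho2).
exact: etrans g1a (esym g2a).
Qed.

Lemma MD_dlog (g : C -> C) : MD_set n kappa g ->
  exists2 f, Conf_set n kappa f & dlog f = g.
Proof.
move=> [[_ _ ng] [zs [ps [uzp [szs sps] hzs hps [hreg [hoI hrI]]]]]].
move: uzp; rewrite cat_uniq => /and3P[uzs zps ups].
pose f := \prod_(z <- ps) ('X - z%:P).
have fm : f \is monic by exact: monic_prod_XsubC.
have f0 := monic_neq0 fm.
have sf : size f = n.+1 by rewrite size_prod_XsubC sps.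
have rf a : root f a = (a \in ps) by rewrite root_prod_XsubC.
have mf a : mup a f = (a \in ps) by rewrite mup_prod_XsubC count_uniq_mem.
have [d0 dl] := monic_deriv_neq0 n_ge2 fm sf.
have sf1 a : root f a -> ~~ root f^`() a.
  move=> fa; apply/negP => dfa; have := mf a; rewrite -rf fa => m1.
  have [h ha fE] := mup_split a f0; rewrite m1 expr1 in fE.
  move: dfa; rewrite fE derivM derivXsubC mul1r rootE hornerD hornerM hornerXsubC.
  by rewrite subrr mul0r addr0 (negPf ha).
have ho a := has_order_dlog a f0 d0.
have gE : dlog f = g.
  apply: (normalized_eq (s := ps) (dlog_normalized f0 sf1) ng).
  - move=> a aps; have [c1 c10 l1] := dlog_simple_pole f0 (etrans (rf a) aps) (sf1 a (etrans (rf a) aps)).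
    have [ho1 hr1] := hps a aps; have [c2 c20 l2] := laurent_simple_pole ho1 hr1.
    by exists c1, c2; rewrite c10 c20 oner_neq0.
  - move=> a aps.
    have fa : f.[a] != 0 by rewrite -rootE rf.
    have [c1 _ l1] := laurent_ratio f^`() fa.
    suff [c2 l2] : exists c, laurent_at g a 0 c by exists c1, c2; exact: conj l1 l2.
    have [az|az] := boolP (a \in zs).
      have ip : (index a zs < size kappa)%N by rewrite -szs index_mem.
      by have := hzs _ ip; rewrite nth_index //; exact: laurent_nonneg_order.
    apply: (@laurent_nonneg_order _ _ 0%N); apply: hreg.
    by rewrite mem_cat negb_or az.
  have [c1 c10 l1] := dlog_infty fm sf (ltnW n_ge2).
  have [c2 c20 l2] := laurent_simple_pole hoI hrI.
  by exists c1, c2; rewrite c10 c20.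
(* The stratum condition is read off the orders: where [f] does not vanish, the order of [dlog f] is
   the multiplicity of [f'], so the critical points are the listed zeroes with the prescribed
   multiplicities. *)
exists f => //; apply/(Conf_critP n_ge2 kappaP); split=> //.
pose w (i : 'I_p) := nth 0 zs i.
have wz i : w i \in zs by rewrite mem_nth // szs.
have wp i : w i \notin ps.
  by apply/negP => wps; move/hasPn: zps => /(_ _ wps) /negP; apply.
have iw : injective w.
  by move=> i j /eqP; rewrite nth_uniq ?szs // => /eqP/val_inj.
exists w => //; split; last by move=> i; rewrite -rootE rf.
have mE a k : has_order g a k -> (mup a f^`())%:Z - (mup a f)%:Z = k.
  by rewrite -gE => hk; exact: has_order_unique (ho a) hk.
have n0 := natn_neq0 R n_ge2.
rewrite /crit -[LHS](scalerKV n0); congr (_ *: _); apply: monic_eq_mup.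
- by rewrite monicE lead_coefZ dl mulVf.
- exact: mult_poly_monic.
move=> a; rewrite -mul_polyC mupMr ?rootE ?hornerC ?invr_eq0 // mup_mult_poly.
have [az|az] := boolP (a \in zs).
  have ip : (index a zs < p)%N by rewrite -szs index_mem.
  have wa : w (Ordinal ip) = a by rewrite /w /= nth_index.
  have := mE _ _ (hzs _ (ltn_ord (Ordinal ip))); rewrite -/(w (Ordinal ip)) wa mf.
  have -> : (a \in ps) = false by rewrite -wa; apply/negbTE.
  rewrite subr0 => -[->]; rewrite (bigD1 (Ordinal ip)) //= wa eqxx mul1n.
  rewrite big1 ?addn0 // => i ij; rewrite -{1}wa (inj_eq iw) (negPf ij) //.
rewrite big1 => [|i _]; last by case: eqP => // wa; move: az; rewrite -wa wz.
have [aps|aps] := boolP (a \in ps).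
  by apply: mupNroot; apply: sf1; rewrite rf.
have := mE a 0; rewrite mf (negPf aps) subr0 => H.
by have [] : (mup a f^`())%:Z = 0 by apply: H; apply: hreg; rewrite mem_cat negb_or az.
Qed.

Lemma crd_dlog (f : Cf) : spt Cf f -> crd (dlog f : MD R n kappa) =
  (\row_(i < n.-1) (n%:R^-1 *: (poly_of (crd f))^`())`_i, crd f).
Proof.
move=> Sf; have [fm sf _ _] := Sf; have [df dl] := monic_deriv_neq0 n_ge2 fm sf.
have [zE pE] := dlog_divisors fm df (Conf_simple_roots Sf).
rewrite -[LHS]/(\row_(i < n.-1) (zero_divisor (dlog f))`_i,
  \row_(i < n) (pole_divisor (dlog f))`_i).
by rewrite pE zE dl (Conf_poly_of Sf).
Qed.

(** In coordinates the map is [f |-> (f'/n, f)], affine in the coefficients; its inverse is the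
    second projection. *)
Lemma holo_dlog : @holo R Cf (MD R n kappa) (@dlog R).
Proof.
apply: (@holo_entire R Cf (MD R n kappa) _
  (fun v : Cn R n => (\row_(i < n.-1) (n%:R^-1 *: (poly_of v)^`())`_i : Cn R n.-1, v))).
- by move=> f; exact: dlog_MD.
- by move=> f; exact: crd_dlog.
move=> v; apply: differentiable_pair; last exact: differentiable_idfun.
apply: differentiable_rowP => i; under eq_fun do rewrite mxE.
apply: (@coef_differentiable_scale _ _ (fun=> n%:R^-1)); first exact: differentiable_const.
exact: coef_differentiable_deriv (poly_of_differentiable v).
Qed.

Lemma holo_pole_divisor : @holo R (MD R n kappa) Cf (@pole_divisor R).
Proof.
apply: (@holo_entire R (MD R n kappa) Cf _ (fun v : (Cn R n.-1 * Cn R n)%type => v.2)) => //.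
  move=> g /MD_dlog[f Sf <-]; have [fm sf _ _] := Sf.
  have [df _] := monic_deriv_neq0 n_ge2 fm sf.
  by have [_ ->] := dlog_divisors fm df (Conf_simple_roots Sf).
by move=> v; exact: differentiable_snd_comp (differentiable_idfun v).
Qed.

Lemma pole_divisor_dlog (f : {poly C}) : Conf_set n kappa f -> pole_divisor (dlog f) = f.
Proof.
move=> Sf; have [fm sf _ _] := Sf; have [df _] := monic_deriv_neq0 n_ge2 fm sf.
by have [] := dlog_divisors fm df (Conf_simple_roots Sf).
Qed.

Lemma dlog_pole_divisor (g : C -> C) : MD_set n kappa g -> dlog (pole_divisor g) = g.
Proof. by move=> /MD_dlog[f Sf <-]; rewrite pole_divisor_dlog. Qed.

Lemma MD_crd_inj : {in spt (MD R n kappa) &, injective (@crd R (MD R n kappa))}.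
Proof.
move=> g1 g2 /set_mem /MD_dlog[f1 S1 <-] /set_mem /MD_dlog[f2 S2 <-].
rewrite !crd_dlog // => -[_ e]; congr dlog.
by apply: (@Conf_crd_inj R n kappa); rewrite ?inE.
Qed.

(** The moved polynomial is [a^n f(al^-1 z)] and its derivative is [a^(n-1) f'(al^-1 z)]; their
    quotient carries the factor [a^-1] that the pullback of [dz] produces. *)
Lemma pullback_dlog (al : aff R) (f : {poly C}) : al.1 != 0 -> Conf_set n kappa f ->
  pullback (aff_inv al) (dlog f) = dlog (move_roots al f).
Proof.
move=> a0 Sf; have [_ sf _ _] := Sf; apply/funext => z.
rewrite /pullback /dlog (deriv_move_roots n_ge2 a0 Sf) (Conf_move_rootsE a0 Sf).
have sd : (size f^`() <= n.-1.+1)%N.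
  by rewrite prednK ?(ltnW n_ge2) //; apply: leq_trans (size_poly _ _) _; rewrite sf.
rewrite (horner_move_poly z a0 sd) horner_move_poly ?sf // -[in X in _ = _ / (X * _)](prednK (ltnW n_ge2)) exprS.
set F := f.[_]; rewrite !invfM; have : al.1 ^+ n.-1 != 0 by rewrite expf_neq0.
by move: (F^-1) => y X0; rewrite /=; field; rewrite a0 X0.
Qed.

End ConfigurationsAndDifferentials.

Theorem theorem1p4 (R : realType) (n : nat) (kappa : seq nat)
    (hn : (2 <= n)%N) (hkappa : is_partition kappa n.-1) :
  @orbifold_isomorphism R (Conf_quotient R n kappa) (Omega R n kappa)
    (@dlog R)
    (fun af => (af.1, dlog af.2)).
Proof.
apply: (@aff_quotient_isomorphism R (Conf R n kappa) (MD R n kappa)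
  (@move_roots R) (fun al => pullback (aff_inv al)) (@dlog R) (@pole_divisor R)).
- exact: Conf_manifold.
- exact: holo_move_roots.
- by move=> f [fm _ _ _]; exact: move_roots_id.
- by move=> al be f _ _ _; exact: move_roots_mul.
- exact: move_roots_proper.
- exact: move_roots_isotropy.
- exact: MD_crd_inj.
- exact: holo_dlog.
- exact: holo_pole_divisor.
- exact: pole_divisor_dlog.
- exact: dlog_pole_divisor.
- exact: pullback_dlog.
Qed.
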